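(* Let $\nu=\mathcal{N}(m_0,C)$ be a Gaussian probability measure on $\mathbb{R}^{d_M}$ with mean $m_0\in\mathbb{R}^{d_M}$ and symmetric positive definite covariance $C\in\mathbb{R}^{d_M\times d_M}$. Let $q:\mathbb{R}^{d_M}\to\mathbb{R}^{d_Q}$ be differentiable with $\int\|q\|_{\ell^2(\mathbb{R}^{d_Q})}^2\,d\nu<\infty$ and with all entries of $\nabla q^T\nabla q$ being $\nu$-integrable, where $\nabla q(m)\in\mathbb{R}^{d_Q\times d_M}$ is the Jacobian. Let $\lambda^M_1\ge\lambda^M_2\ge\dots\ge\lambda^M_{d_M}\ge 0$ and $v_1,\dots,v_{d_M}$ be the eigenpairs of the generalized eigenvalue problem $$\mathbb{E}_\nu[\nabla q^T\nabla q]\,v_i=\lambda^M_i\,C^{-1}v_i,\qquad v_i^TC^{-1}v_j=\delta_{ij}.$$ For integers $1\le r_M\le d_M$ and $1\le r_Q\le d_Q$, let $V_{r_M}=[v_1,\dots,v_{r_M}]\in\mathbb{R}^{d_M\times r_M}$, let $P_{r_M}=V_{r_M}V_{r_M}^TC^{-1}\in\mathbb{R}^{d_M\times d_M}$, and let $$q_{r_M}(m)=\mathbb{E}_\nu[q\,|\,\sigma(P_{r_M})](m)$$ be the conditional expectation of $q$ with respect to the $\sigma$-algebra generated by $P_{r_M}$. Let $\widehat\Phi_{r_Q}\in\mathbb{R}^{d_Q\times r_Q}$ be a matrix whose columns are orthonormal eigenvectors of $\mathbb{E}_\nu[q_{r_M}q_{r_M}^T]=\int_{\mathbb{R}^{d_M}}q_{r_M}(m)q_{r_M}(m)^T\,d\nu(m)$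 corresponding to its $r_Q$ largest eigenvalues (the rank-$r_Q$ POD basis of $q_{r_M}$). Let $\lambda^Q_1\ge\dots\ge\lambda^Q_{d_Q}\ge0$ be the eigenvalues of $\mathbb{E}_\nu[qq^T]=\int_{\mathbb{R}^{d_M}} q(m)q(m)^T\,d\nu(m)$. Then $$\int_{\mathbb{R}^{d_M}}\big\|q(m)-\widehat\Phi_{r_Q}\widehat\Phi_{r_Q}^Tq_{r_M}(m)\big\|^2_{\ell^2(\mathbb{R}^{d_Q})}\,d\nu(m)\le\sum_{i=r_M+1}^{d_M}\lambda^M_i+\sum_{i=r_Q+1}^{d_Q}\lambda^Q_i.$$ Further, if $q$ is Lipschitz continuous with constant $L\ge0$, and $c_1\ge c_2\ge\dots\ge c_{d_M}$ are the eigenvalues of $C$, then $$\int_{\mathbb{R}^{d_M}}\big\|q(m)-\widehat\Phi_{r_Q}\widehat\Phi_{r_Q}^Tq_{r_M}(m)\big\|^2_{\ell^2(\mathbb{R}^{d_Q})}\,d\nu(m)\le L^2\sum_{i=r_M+1}^{d_M}c_i+\sum_{i=r_Q+1}^{d_Q}\lambda^Q_i.$$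
   Context: $\mathbb{E}_\nu[\cdot]$ denotes expectation (integration) with respect to $\nu$, taken entrywise for vectors and matrices. $\sigma(P_{r_M})$ is the $\sigma$-algebra on $\mathbb{R}^{d_M}$ generated by the linear map $m\mapsto P_{r_M}m$. Since $\nu$ is Gaussian and $P_{r_M}$ is a projector orthogonal with respect to the inner product induced by $C^{-1}$, the conditional expectation can be written as $\mathbb{E}_\nu[q|\sigma(P_{r_M})](m)=\mathbb{E}_{y\sim\nu}[q(P_{r_M}m+(I_{d_M}-P_{r_M})y)]$. Lipschitz continuity with constant $L$ means $\|q(m)-q(m')\|_{\ell^2(\mathbb{R}^{d_Q})}\le L\|m-m'\|_{\ell^2(\mathbb{R}^{d_M})}$ for all $m,m'\in\mathbb{R}^{d_M}$. Empty sums are zero. *)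

(* Defs.v *)
From HB Require Import structures.
From mathcomp Require Import all_boot all_order all_algebra all_fingroup.
From mathcomp Require Import all_classical all_reals all_analysis.
Import Order.TTheory GRing.Theory Num.Theory.
Import numFieldNormedType.Exports.

Set Implicit Arguments.
Unset Strict Implicit.
Unset Printing Implicit Defensive.

Local Open Scope classical_set_scope.
Local Open Scope ring_scope.

(* The topology of ['cV[R]_d] comes from the sup norm, but it is the usual
   topology of R^d, so that this is the usual Borel sigma-algebra. *)
Notation Borel T := (g_sigma_algebraType (@open T)).

(* [`| x |] on ['cV[R]_d] is the sup norm, hence this definition. *)
Definition l2norm (R : realType) d (x : 'cV[R]_d) : R :=
  Num.sqrt (\sum_(i < d) x i 0 ^+ 2).

Definition l2lipschitz (R : realType) d d' (L : R) (f : 'cV[R]_d -> 'cV[R]_d') :=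
  forall x y, l2norm (f x - f y) <= L * l2norm (x - y).

Definition spd (R : realType) d (C : 'M[R]_d) :=
  C^T = C /\ forall x : 'cV[R]_d, x != 0 -> 0 < (x^T *m C *m x) 0 0.

(* [nu] = N(m0, C): every nonzero linear functional [a^T m] has law
   N(a^T m0, a^T C a). The second parameter of [normal_prob] is the standard
   deviation; [a = 0] is left out because [normal_prob _ 0] is not a Dirac
   mass. *)
Definition gaussian (R : realType) d (nu : probability (Borel 'cV[R]_d) R)
    (m0 : 'cV[R]_d) (C : 'M[R]_d) :=
  forall a : 'cV[R]_d, a != 0 -> forall B : set R, measurable B ->
    nu [set m | B ((a^T *m (m : 'cV[R]_d)) 0 0)] =
    normal_prob ((a^T *m m0) 0 0) (Num.sqrt ((a^T *m C *m a) 0 0)) B.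

(* The library's [jacobian] is for row vectors and is the transpose of this. *)
Definition jac (R : realType) d d' (f : 'cV[R]_d -> 'cV[R]_d') (m : 'cV[R]_d) :
    'M[R]_(d', d) :=
  \matrix_(i, j) ('d f m (delta_mx j 0)) i 0.

Definition expect_mx (R : realType) d (nu : probability (Borel 'cV[R]_d) R)
    p k (F : 'cV[R]_d -> 'M[R]_(p, k)) : 'M[R]_(p, k) :=
  \matrix_(i, j) (\int[nu]_m F m i j).

Definition sigma_of (T : Type) d (U : measurableType d) (f : T -> U) :
    set_system T :=
  preimage_set_system setT f measurable.

(* [g] is a version of the conditional expectation of [f] given the
   sub-sigma-algebra [G]. *)
Definition cond_expectation (R : realType) d d'
    (nu : probability (Borel 'cV[R]_d) R) (G : set_system 'cV[R]_d)
    (f g : 'cV[R]_d -> 'cV[R]_d') :=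
  [/\ forall B : set (Borel 'cV[R]_d'), measurable B -> G (g @^-1` B),
      forall i, nu.-integrable setT (fun m => (g m i 0)%:E)
    & forall A, G A -> forall i,
        (\int[nu]_(m in A) (g m i 0)%:E = \int[nu]_(m in A) (f m i 0)%:E)%E].

(* The decreasing list of eigenvalues, counted with multiplicity. *)
Definition eigenvalues (R : realType) d (A : 'M[R]_d) (lam : 'I_d -> R) :=
  (forall i j : 'I_d, (i <= j)%N -> lam j <= lam i) /\
  char_poly A = \prod_(i < d) ('X - (lam i)%:P).

Definition gen_eigenpairs (R : realType) d (H C : 'M[R]_d) (lam : 'I_d -> R)
    (v : 'I_d -> 'cV[R]_d) :=
  [/\ forall i j : 'I_d, (i <= j)%N -> lam j <= lam i,
      forall i, H *m v i = lam i *: (invmx C *m v i)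
    & forall i j, ((v i)^T *m invmx C *m v j) 0 0 = (i == j)%:R].

Definition first_cols (R : realType) d r (hr : (r <= d)%N)
    (v : 'I_d -> 'cV[R]_d) : 'M[R]_(d, r) :=
  \matrix_(i, k) v (widen_ord hr k) i 0.

(* The permutation [s] leaves the order of the columns of [Phi] free. *)
Definition top_eigenvectors (R : realType) d r (hr : (r <= d)%N) (K : 'M[R]_d)
    (Phi : 'M[R]_(d, r)) :=
  Phi^T *m Phi = 1%:M /\
  exists (lam : 'I_d -> R) (s : 'S_r), eigenvalues K lam /\
    forall k, K *m col k Phi = lam (widen_ord hr (s k)) *: col k Phi.

(* Main.v *)
Require Import Defs.
From HB Require Import structures.
From mathcomp Require Import all_boot all_order all_algebra.
From mathcomp Require Import all_classical all_reals all_analysis.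
From mathcomp Require Import perm measurable_realfun ring lra.
Import Order.TTheory GRing.Theory Num.Theory.
Import numFieldNormedType.Exports.

Set Implicit Arguments.
Unset Strict Implicit.
Unset Printing Implicit Defensive.

Local Open Scope classical_set_scope.
Local Open Scope ring_scope.

Local Notation mu := lebesgue_measure.

(* Pythagoras splits the error into E|q - qr|^2 and the POD residual of qr. The
   latter is tr K - tr(Phi^T K Phi) = sum of the small eigenvalues of
   K = E[qr qr^T], and K <= E[q q^T] as quadratic forms.

   For the former, take an independent copy m' of m. Exchanging the coordinates
   (in the basis v_i) of a set S between m and m' preserves nu x nu; exchanging
   them one at a time and telescoping gives an Efron-Stein inequality, which
   bounds the conditional variance by the sum over i > r_M of the variances in
   the single coordinates. Each of these is at most E|grad q v_i|^2 by Chernoff's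
   proof of the Gaussian Poincare inequality on the line. Summing the entries of
   q gives v_i^T H v_i = lam_i, for H = E[grad q^T grad q].

   In the Lipschitz case H <= L^2 I, and in the basis v the two sides become a
   matrix with eigenvalues lam_i and one with the eigenvalues of C.

   When A <= B as forms, the smallest eigenvalues of A add up to at most the trace
   of A on the span of the last eigenvectors of B, whence the comparisons of
   tails of eigenvalues. *)

(** * Eigenvalues *)

(** The Gaussian law is given only through its one-dimensional marginals, so the invariance of nu x
    nu under exchanges is not read off a density: it is checked on cosines of linear functionals,
    and [cramer_wold] extends it to all measurable sets. The conditional expectation is an arbitrary
    version, known only by its measurability and its integrals over the sets of sigma(P). Hence the
    telescope is run for the residual b = f - g, f being an entry of q and g the same entry of its
    conditional expectation. After the exchange of the last coordinates, b depends on the first copy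
    through P only, so E[b(X) b(X^S)] = 0 and the telescope bounds E[b^2] itself; as g does not vary
    along the exchanged v_i, the increments of b are those of f. The final constant is 1 because the
    1/2 of the Efron-Stein sum cancels the 2 in E[(f(s) - f(t))^2] = 2 Var f. Everywhere
    differentiability does not make the derivative integrable on intervals, so Chernoff's argument
    starts from an inequality for increments that remains true when the integral is infinite. *)

Lemma char_poly_conj (R : comUnitRingType) d (P A : 'M[R]_d) :
  P \in unitmx -> char_poly (P *m A *m invmx P) = char_poly A.
Proof.
move=> Pu; rewrite /char_poly.
have -> : char_poly_mx (P *m A *m invmx P) =
    map_mx polyC P *m char_poly_mx A *m map_mx polyC (invmx P).
  rewrite /char_poly_mx mulmxBr mulmxBl !map_mxM/=.
  congr (_ - _); rewrite scalar_mxC -mulmxA.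
  by rewrite -map_mxM mulmxV// map_mx1 mulmx1.
rewrite !det_mulmx mulrAC -det_mulmx -map_mxM/= mulmxV//.
by rewrite map_mx1 det1 mul1r.
Qed.

Lemma mulmx_tr_ge0 (R : realDomainType) d (v : 'cV[R]_d) : 0 <= (v^T *m v) 0 0.
Proof. by rewrite mxE sumr_ge0// => i _; rewrite mxE -expr2 sqr_ge0. Qed.

Lemma mulmx_tr_gt0 (R : realDomainType) d (v : 'cV[R]_d) :
  v != 0 -> 0 < (v^T *m v) 0 0.
Proof.
move=> v0; rewrite lt_def mulmx_tr_ge0 andbT; apply: contra v0.
rewrite mxE psumr_eq0 => [/allP h|i _]; last by rewrite mxE -expr2 sqr_ge0.
apply/eqP/colP => i; have := h i (mem_index_enum i).
by rewrite !mxE mulf_eq0 orbb => /eqP.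
Qed.

(* Householder reflection *)
Lemma orthogonal_col0 (R : rcfType) d (x : 'cV[R]_d.+1) :
  x^T *m x = 1%:M -> exists2 H : 'M[R]_d.+1, H *m H = 1%:M /\ H^T = H & col 0 H = x.
Proof.
move=> x1; pose e : 'cV[R]_d.+1 := delta_mx 0 0.
have e1 : e^T *m e = 1%:M.
  by rewrite trmx_delta mul_delta_mx; apply/matrixP => i j; rewrite !ord1 !mxE.
have [->|xe] := eqVneq x e.
  exists 1%:M; first by rewrite mulmx1 trmx1.
  by apply/colP => i; rewrite !mxE andbT.
pose w := x - e; have w0 : w != 0 by rewrite subr_eq0.
pose s := (w^T *m w) 0 0; have s0 : s != 0 by rewrite gt_eqF// mulmx_tr_gt0.
have sE : w^T *m w = s%:M by rewrite [LHS]mx11_scalar.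
pose H : 'M[R]_d.+1 := 1%:M - (2 / s) *: (w *m w^T).
have HT : H^T = H.
  by rewrite /H linearB/= trmx1 linearZ/= trmx_mul trmxK.
exists H.
  split => //; set c := 2 / s in H HT *; set W := w *m w^T in H HT *.
  have WW : W *m W = s *: W.
    by rewrite /W mulmxA -(mulmxA w) sE scalar_mxC mul_scalar_mx -scalemxAl.
  have cs : c * (c * s) = c + c by rewrite {2}/c divfK// mulr_natr mulr2n.
  rewrite /H mulmxBl mul1mx mulmxBr mulmx1 -scalemxAl -scalemxAr WW !scalerA.
  rewrite -mulrA cs scalerDl; set cW := c *: W.
  by rewrite opprB addrK subrK.
rewrite colE -/e /H mulmxBl mul1mx -scalemxAl -mulmxA.
have ex : e^T *m x = x^T *m e.
  apply/matrixP => i j; rewrite !ord1 !mxE.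
  by apply: eq_bigr => k _; rewrite !mxE mulrC.
(* Since x and e are unit vectors, |w|^2 = 2 (1 - x.e) = - 2 w.e, which is why the reflection sends
   e to e + w = x. *)
have sE2 : s = 2 * (1 - (x^T *m e) 0 0).
  rewrite /s /w [(x - e)^T]raddfB/= mulmxBl !mulmxBr x1 e1 ex.
  rewrite !mxE eqxx/=.
  by rewrite mulr_natl mulr2n opprB addrA.
have -> : w^T *m e = (- (s / 2))%:M.
  rewrite [LHS]mx11_scalar; congr (_%:M); rewrite /w [(x - e)^T]raddfB/= mulmxBl e1.
  by rewrite sE2 mulrAC divff ?pnatr_eq0// mul1r !mxE eqxx opprB.
rewrite scalar_mxC mul_scalar_mx scalerA mulrN mulrA divfK// divff ?pnatr_eq0//.
by rewrite scaleN1r opprK /w addrC subrK.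
Qed.

(** Deflation: a unit eigenvector for [lam 0] is made the first column of a symmetric orthogonal
    [H], so that [H *m A *m H] is block diagonal, and the factor ['X - lam 0] is cancelled from its
    characteristic polynomial. The splitting over the reals is assumed, so no root has to be shown
    real. *)
Lemma spectral_real (R : rcfType) d (A : 'M[R]_d) (lam : 'I_d -> R) :
  A^T = A -> char_poly A = \prod_(i < d) ('X - (lam i)%:P) ->
  exists2 U : 'M[R]_d, U^T *m U = 1%:M &
    A = U *m diag_mx (\row_i lam i) *m U^T.
Proof.
elim: d => [|d IH] in A lam * => Asym chA.
  by exists 1%:M; rewrite ?flatmx0 // [LHS]flatmx0.
have : eigenvalue A (lam 0).
  by rewrite eigenvalue_root_char chA big_ord_recl rootM root_XsubC eqxx.
move=> /eigenvalueP[v vA v0].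
pose n := Num.sqrt ((v^T^T *m v^T) 0 0).
have n0 : 0 < n by rewrite sqrtr_gt0 mulmx_tr_gt0// trmx_eq0.
pose x := n^-1 *: v^T.
have Ax : A *m x = lam 0 *: x.
  by rewrite /x -scalemxAr -{1}Asym -trmx_mul vA linearZ/= scalerA mulrC -scalerA.
have x1 : x^T *m x = 1%:M.
  have nn : v *m v^T = (n ^+ 2)%:M.
    by rewrite sqr_sqrtr ?mulmx_tr_ge0// trmxK [LHS]mx11_scalar.
  rewrite /x [_^T]linearZ/= trmxK -scalemxAl -scalemxAr scalerA nn.
  by rewrite scale_scalar_mx -invfM -expr2 mulVf// expf_neq0// gt_eqF.
have [H [HH HT] Hx] := @orthogonal_col0 _ _ x x1.
have [B defB] : {B | B = H *m A *m H} by exists (H *m A *m H).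
have BT : B^T = B by rewrite defB !trmx_mul HT Asym mulmxA.
have B0 : col 0 B = lam 0 *: delta_mx 0 0.
  rewrite defB colE -!mulmxA -colE Hx Ax -scalemxAr; congr (_ *: _).
  by rewrite -Hx colE mulmxA HH mul1mx.
have B0E i : B i 0 = lam 0 *+ (i == 0).
  by have /colP/(_ i) := B0; rewrite !mxE andbT mulr_natr.
pose B' := drsubmx (B : 'M[R]_(1 + d)).
have BE : B = block_mx (lam 0)%:M 0 0 B' :> 'M[R]_(1 + d).
  have l0 (i : 'I_1) : lshift d i = 0 :> 'I_(1 + d) by rewrite ord1; apply/val_inj.
  rewrite -[LHS](@submxK _ 1 d 1 d); congr block_mx; apply/matrixP => i j;
    rewrite !mxE ?(l0 i) ?(l0 j).
  - by rewrite B0E !ord1.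
  - by rewrite -BT mxE B0E.
  - by rewrite B0E.
have HU : H \in unitmx by case: (mulmx1_unit HH).
have HI : invmx H = H by rewrite -[LHS]mulmx1 -HH mulmxA mulVmx// mul1mx.
have chB' : char_poly B' = \prod_(i < d) ('X - (lam (lift ord0 i))%:P).
  have chB : char_poly B = char_poly A by rewrite defB -{2}HI char_poly_conj.
  have XC0 : 'X - (lam 0)%:P != 0 :> {poly R} by rewrite polyXsubC_eq0.
  apply: (mulfI XC0); have := chA; rewrite -chB BE big_ord_recl => <-.
  rewrite /char_poly (@char_block_diag_mx _ 1 d) (@det_ublock _ 1 d); congr (_ * _).
  by rewrite det_mx11 !mxE eqxx.
have B'T : B'^T = B' by rewrite /B' trmx_drsub BT.
have [U' U'U' B'E] := IH _ _ B'T chB'.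
pose U : 'M[R]_(1 + d) := block_mx 1%:M 0 0 U'.
have UE : U^T = block_mx 1%:M 0 0 U'^T by rewrite tr_block_mx trmx1 !trmx0.
exists (H *m U).
  rewrite trmx_mul HT mulmxA -(mulmxA _ H H) HH mulmx1 UE (@mulmx_block _ 1 d 1 d 1 d).
  by rewrite !(mulmx0, mul0mx, mulmx1, addr0, add0r) U'U' -(@scalar_mx_block _ 1 d).
have DE : diag_mx (\row_i lam i) =
    block_mx (lam 0)%:M 0 0 (diag_mx (\row_i lam (lift ord0 i))) :> 'M[R]_(1 + d).
  apply/matrixP => i j; rewrite [LHS]mxE [(\row_i _) _ _]mxE.
  case: (@split_ordP 1 d i) => {}i ->; case: (@split_ordP 1 d j) => {}j ->;
    rewrite ?(block_mxEul, block_mxEur, block_mxEdl, block_mxEdr) !mxE.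
  - by rewrite !ord1 !eqxx; congr (lam _ *+ _); apply/val_inj.
  - by rewrite !ord1.
  - by rewrite !ord1.
  - by rewrite -!val_eqE /= eqSS; congr (lam _ *+ _); apply/val_inj.
rewrite DE trmx_mul HT -!mulmxA (mulmxA U) (mulmxA (U *m _)) UE.
rewrite !(@mulmx_block _ 1 d 1 d 1 d).
rewrite !(mulmx0, mul0mx, mulmx1, mul1mx, addr0, add0r) -B'E -BE defB.
by rewrite -!mulmxA HH mulmx1 !mulmxA HH mul1mx.
Qed.

(** Weight moved out of the tail goes where [a] is larger. With the threshold t = a_r, both factors
    of (a_i - t) (w_i - 1_{r <= i}) have the same sign, and t disappears from the sum because the
    total weights agree. If the tail is empty, all the weights vanish. *)
Lemma sum_tail_le_weighted (R : realDomainType) d r (a w : 'I_d -> R) :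
  (forall i j : 'I_d, (i <= j)%N -> a j <= a i) ->
  (forall i, 0 <= w i <= 1) -> \sum_i w i = \sum_(i < d | (r <= i)%N) 1 ->
  \sum_(i < d | (r <= i)%N) a i <= \sum_i a i * w i.
Proof.
move=> a_dec w01; rewrite [X in _ = X]big_mkcond => sw.
have [t Ht] : exists t, forall i, 0 <= (a i - t) * (w i - (r <= i)%N%:R).
  have [dr|rd] := leqP d r.
    exists 0 => i; have ir : (r <= i)%N = false.
      by rewrite leqNgt (leq_trans (ltn_ord i)).
    suff -> : w i = 0 by rewrite ir subrr mulr0.
    have /eqP := sw; rewrite [X in _ == X]big1 => [|j _]; last first.
      by rewrite ifN// -ltnNge (leq_trans (ltn_ord j)).
    rewrite psumr_eq0 => [/allP/(_ i (mem_index_enum i))/eqP //|j _].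
    by case/andP: (w01 j).
  exists (a (Ordinal rd)) => i; have /andP[w0 w1] := w01 i.
  have [ri|ir] := leqP r i.
    by rewrite mulr_le0// subr_le0// a_dec.
  by rewrite subr0 mulr_ge0// subr_ge0 a_dec// ltnW.
have -> : \sum_(i < d | (r <= i)%N) a i = \sum_i a i * (r <= i)%N%:R.
  rewrite big_mkcond; apply: eq_bigr => i _.
  by case: leqP => _; rewrite ?mulr1 ?mulr0.
have {}sw : \sum_i w i = \sum_(i < d) (r <= i)%N%:R.
  by rewrite sw; apply: eq_bigr => i _; case: leqP.
have -> : \sum_i a i * w i = \sum_(i < d) a i * (r <= i)%N%:R +
    \sum_i (a i - t) * (w i - (r <= i)%N%:R).
  apply: (addIr (t * \sum_i w i)); rewrite {1}sw !mulr_sumr -!big_split/=.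
  by apply: eq_bigr => i _; ring.
by rewrite lerDl sumr_ge0.
Qed.

Lemma trmx_quadE (R : comNzRingType) d (A : 'M[R]_d) (x : 'cV[R]_d) :
  (x^T *m A *m x) 0 0 = \sum_i \sum_j A i j * x i 0 * x j 0.
Proof.
rewrite mxE exchange_big; apply: eq_bigr => j _ /=.
rewrite mxE mulr_suml; apply: eq_bigr => i _.
by rewrite !mxE [x i 0 * _]mulrC.
Qed.

Lemma diag_quadE (R : comNzRingType) d (a : 'I_d -> R) (x : 'cV[R]_d) :
  (x^T *m diag_mx (\row_i a i) *m x) 0 0 = \sum_i a i * x i 0 ^+ 2.
Proof.
rewrite trmx_quadE; apply: eq_bigr => i _.
rewrite (bigD1 i)//= big1 ?addr0 => [|j ji]; first by rewrite !mxE eqxx -mulrA.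
by rewrite !mxE eq_sym (negbTE ji) mulr0n !mul0r.
Qed.

Lemma quad_conj (R : comNzRingType) d (W D : 'M[R]_d) (x : 'cV[R]_d) :
  x^T *m (W *m D *m W^T) *m x = (W^T *m x)^T *m D *m (W^T *m x).
Proof. by rewrite trmx_mul trmxK !mulmxA. Qed.

(** The trace of [A] on the span of the last eigenvectors of [B] is a weighted sum of the
    eigenvalues of [A], to which [sum_tail_le_weighted] applies. The factor k is 1 for the second
    moments and L^2 in the Lipschitz case. *)
Lemma tail_eigenvalues_le (R : rcfType) d r (A B : 'M[R]_d) (a b : 'I_d -> R) k :
  A^T = A -> B^T = B ->
  (forall i j : 'I_d, (i <= j)%N -> a j <= a i) ->
  char_poly A = \prod_(i < d) ('X - (a i)%:P) ->
  char_poly B = \prod_(i < d) ('X - (b i)%:P) ->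
  (forall x : 'cV_d, (x^T *m A *m x) 0 0 <= k * (x^T *m B *m x) 0 0) ->
  \sum_(i < d | (r <= i)%N) a i <= k * \sum_(i < d | (r <= i)%N) b i.
Proof.
move=> AT BT a_dec /(spectral_real AT)[W WW ->] /(spectral_real BT)[U UU ->] AB.
pose O := W^T *m U.
have OO : O^T *m O = 1%:M.
  by rewrite trmx_mul trmxK -mulmxA (mulmxA W) (mulmx1C WW) mul1mx.
have OO' : O *m O^T = 1%:M by rewrite mulmx1C.
have colO i : \sum_j O j i ^+ 2 = 1.
  have /matrixP/(_ i i) := OO; rewrite !mxE eqxx => h; apply: etrans h.
  by apply: eq_bigr => j _; rewrite !mxE.
have rowO j : \sum_i O j i ^+ 2 = 1.
  have /matrixP/(_ j j) := OO'; rewrite !mxE eqxx => h; apply: etrans h.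
  by apply: eq_bigr => i _; rewrite !mxE.
(* [w j] is the squared length of the projection of the j-th eigenvector of [A] on the span of the
   eigenvectors of [B] of index at least r. *)
pose w j := \sum_(i < d | (r <= i)%N) O j i ^+ 2.
apply: (le_trans (@sum_tail_le_weighted _ _ r a w a_dec _ _)).
- move=> j; rewrite sumr_ge0 => [/=|i _]; last exact: sqr_ge0.
  rewrite -(rowO j) [leRHS](bigID (fun i : 'I_d => (r <= i)%N))/= lerDl.
  by rewrite sumr_ge0// => i _; exact: sqr_ge0.
- by rewrite exchange_big; apply: eq_bigr => i _; exact: colO.
have -> : \sum_j a j * w j = \sum_(i < d | (r <= i)%N)
    ((col i U)^T *m (W *m diag_mx (\row_i a i) *m W^T) *m col i U) 0 0.
  under eq_bigr do rewrite mulr_sumr.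
  rewrite exchange_big; apply: eq_bigr => i _ /=.
  rewrite quad_conj diag_quadE.
  by apply: eq_bigr => j _; rewrite colE mulmxA -colE [in RHS]mxE.
rewrite mulr_sumr; apply: ler_sum => i _; apply: (le_trans (AB _)).
rewrite quad_conj diag_quadE.
rewrite colE mulmxA UU mul1mx (bigD1 i)//= big1 => [|j ji]; last first.
  by rewrite mxE (negbTE ji) expr0n mulr0.
by rewrite mxE !eqxx expr1n mulr1 addr0.
Qed.

Lemma mxtrace_eigenvalues (R : rcfType) d (A : 'M[R]_d) (a : 'I_d -> R) :
  A^T = A -> char_poly A = \prod_(i < d) ('X - (a i)%:P) -> \tr A = \sum_i a i.
Proof.
move=> AT /(spectral_real AT)[U UU ->].
rewrite mxtrace_mulC mulmxA UU mul1mx mxtrace_diag.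
by apply: eq_bigr => i _; rewrite mxE.
Qed.

(** The diagonal of [Phi^T *m K *m Phi] lists the eigenvalues attached to the columns of [Phi],
    which are the first r up to the permutation [s]. *)
Lemma pod_residual (R : rcfType) d r (rd : (r <= d)%N) (K : 'M[R]_d)
    (Phi : 'M[R]_(d, r)) (lam : 'I_d -> R) (s : 'S_r) :
  K^T = K -> char_poly K = \prod_(i < d) ('X - (lam i)%:P) ->
  Phi^T *m Phi = 1%:M ->
  (forall k, K *m col k Phi = lam (widen_ord rd (s k)) *: col k Phi) ->
  \tr K - \tr (Phi^T *m K *m Phi) = \sum_(i < d | (r <= i)%N) lam i.
Proof.
move=> KT chK PP KP; rewrite (mxtrace_eigenvalues KT chK).
have -> : \tr (Phi^T *m K *m Phi) = \sum_(k < r) lam (widen_ord rd k).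
  rewrite [RHS](reindex_inj (@perm_inj _ s)); apply: eq_bigr => k _ /=.
  have -> : (Phi^T *m K *m Phi) k k = (Phi^T *m (K *m col k Phi)) k 0.
    by rewrite colE !mulmxA -colE [RHS]mxE.
  rewrite KP -scalemxAr colE mulmxA PP mul1mx !mxE eqxx.
  by rewrite mulr1.
rewrite (bigID (fun i : 'I_d => (i < r)%N))/= big_ord_narrow addrAC subrr add0r.
by apply: eq_bigl => i; rewrite -leqNgt.
Qed.

(** * Interval integrals of a derivative *)

(** This plays the role of compactness of [a, b]. The supremum s of the points x with [P a x]
    satisfies [P a s], since such points exist within e of s; if s < b, the relation extends from s
    to a point beyond it, a contradiction. *)
Lemma interval_induction (R : realType) (P : R -> R -> Prop) (a b : R) :
  a <= b ->
  (forall x y z, x <= y -> y <= z -> P x y -> P y z -> P x z) ->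
  (forall x, a <= x <= b -> exists2 e, 0 < e &
     forall y, a <= y <= b -> `|y - x| < e ->
       (y <= x -> P y x) /\ (x <= y -> P x y)) ->
  P a b.
Proof.
move=> ab Ptrans Ploc.
have aab : a <= a <= b by rewrite lexx.
have Paa : P a a.
  by have [e e0 /(_ a aab)] := Ploc a aab; rewrite subrr normr0 => /(_ e0)[/(_ (lexx _))].
pose S := [set x | a <= x <= b /\ P a x].
have Sa : S a by [].
have hS : has_sup S.
  by split; [exists a|exists b => x [/andP[_ ->]]].
set s := sup S; have as_ : a <= s by apply: sup_upper_bound.
have sb : s <= b by apply: sup_le_ub => [|x [/andP[]]//]; exists a.
have asb : a <= s <= b by rewrite as_.
have [e e0 He] := Ploc s asb.
have Ps : P a s.
  have [x [/andP[ax xb] Px] sx] := sup_adherent e0 hS.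
  have xs : x <= s by apply: sup_upper_bound => //; split=> //; rewrite ax.
  apply: (Ptrans a x s) => //; apply: (He x _ _).1 => //; first by rewrite ax.
  by rewrite ler0_norm ?subr_le0// opprB ltrBlDl -ltrBlDr.
have [sb'|bs] := ltP s b; last by have -> : b = s by apply/le_anti; rewrite bs sb.
pose y := Num.min (s + e / 2) b.
have sy : s < y by rewrite lt_min sb' andbT ltrDl divr_gt0.
have yb : y <= b by rewrite ge_min lexx orbT.
have ayb : a <= y <= b by rewrite yb (le_trans as_ (ltW sy)).
have ye : `|y - s| < e.
  rewrite gtr0_norm ?subr_gt0// ltrBlDl gt_min ltrD2l.
  by rewrite ltr_pdivrMr// ltr_pMr// ltr1n.
have Sy : S y.
  split => //; apply: (Ptrans a s y) => //; first exact: ltW.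
  by apply: (He y ayb ye).2; exact: ltW.
have : y <= s by apply: sup_upper_bound.
by rewrite leNgt sy.
Qed.

Lemma is_derive_local_bound (R : realType) (f : R -> R) (x l e : R) :
  is_derive x (1 : R) f l -> 0 < e ->
  exists2 d, 0 < d & forall y, `|y - x| < d ->
    `|f y - f x| <= (`|l| + e) * `|y - x|.
Proof.
move=> [df <-] e0.
have /cvgr_dist_lt /(_ _ e0) : h^-1 *: ((f \o shift x) (h *: (1 : R)) - f x)
    @[h --> 0^'] --> 'D_1 f x by exact: df.
rewrite near_withinE => /nbhs_ballP[d /= d0 Hd].
exists d => // y yx; have [->|yx0] := eqVneq y x.
  by rewrite !subrr normr0 mulr0.
have yx0' : y - x != 0 by rewrite subr_eq0.
have := Hd (y - x); rewrite /ball/= sub0r normrN => /(_ yx yx0').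
rewrite [(y - x) *: 1]mulr1 subrK => H.
rewrite -ler_pdivrMr ?normr_gt0// -normf_div.
rewrite -[X in `|X|](subKr ('D_1 f x)) (le_trans (ler_normB _ _))// lerD2l.
by rewrite ltW// mulrC.
Qed.

Lemma integral_co_split (R : realType) (u : R -> \bar R) (x y z : R) :
  x <= y -> y <= z -> measurable_fun setT u -> (forall t, 0 <= u t)%E ->
  (\int[lebesgue_measure]_(t in `[x, z[) u t =
   \int[lebesgue_measure]_(t in `[x, y[) u t +
   \int[lebesgue_measure]_(t in `[y, z[) u t)%E.
Proof.
move=> xy yz umeas u0.
have -> : `[x, z[%classic = `[x, y[ `|` `[y, z[ :> set R.
  by rewrite -itv_bndbnd_setU// bnd_simp.
apply: ge0_integral_setU => //; first exact: measurable_funTS.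
rewrite disj_set2E; apply/eqP; rewrite -subset0 => t [] /=.
by rewrite !in_itv/= => /andP[_ ty] /andP[yt _]; move: ty; rewrite ltNge yt.
Qed.

(* A derivative that exists everywhere need not be locally integrable, so the
   fundamental theorem of calculus is not available: [u] is a sum of multiples
   of indicators of open sets around the level sets of [g], with almost the same
   integral, and bounds the slope of [f] on a neighbourhood of every point. *)
Lemma le_integral_derive (R : realType) (f f' g : R -> R) (a b : R) :
  a <= b -> (forall x, is_derive x (1 : R) f (f' x)) ->
  measurable_fun setT g -> (forall x, `|f' x| <= g x) ->
  (`|f b - f a|%:E <= \int[lebesgue_measure]_(x in `[a, b]) (g x)%:E)%E.
Proof.
move=> ab df mg f'g.
have g0 x : 0 <= g x by apply: le_trans (f'g x).
suff H (e : R) : 0 < e -> (`|f b - f a|%:E <=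
    \int[mu]_(x in `[a, b]) (g x)%:E + (2 * e * (b - a) + e)%:E)%E.
  apply/lee_addgt0Pr => e e0.
  pose e' := e / (2 * (b - a) + 1).
  have ba0 : 0 < 2 * (b - a) + 1 by rewrite ltr_wpDl// mulr_ge0// subr_ge0.
  have -> : e = 2 * e' * (b - a) + e' by rewrite /e'; field; rewrite gt_eqF.
  by apply: H; rewrite divr_gt0.
move=> e0.
(* On the layer [E k] the function g is below (k + 1) e, so that near a point of it the slopes of f
   are at most (k + 1) e + e = [c k]. On the same layer, [c k] is at most g + 2 e. *)
pose c k : R := (k.+2)%:R * e.
have c0 k : 0 < c k by rewrite mulr_gt0.
pose E k := `[a, b] `&` [set x | k%:R * e <= g x < k.+1%:R * e].
have mE k : measurable (E k).
  apply: measurableI => //; rewrite -[X in measurable X]setTI.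
  have -> : [set x | k%:R * e <= g x < k.+1%:R * e] = g @^-1` `[k%:R * e, k.+1%:R * e[.
    by apply/seteqP; split => x /=; rewrite in_itv.
  exact: mg.
have muab : (mu `[a, b]%classic < +oo)%E.
  by rewrite lebesgue_measure_itv/=; case: ifPn => // _; rewrite -EFinB ltry.
have muE k : (mu (E k) < +oo)%E.
  by apply: le_lt_trans muab; apply: le_measure;
    [rewrite inE; exact: mE|by rewrite inE|exact: subIsetl].
(* The tolerance is divided by [c k] because [u] takes the multiple [c k] of the indicator of [U k]:
   the excess integrals e / 2^(k+1) then add up to e. *)
have /choice[U HU] : forall k, exists U : set R, [/\ open U, E k `<=` U &
    (mu (U `\` E k) < (e / (2 ^ k.+1)%:R / c k)%:E)%E].
  move=> k; apply: (lebesgue_regularity_outer (mE k) (muE k)).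
  by rewrite !divr_gt0// ltr0n expn_gt0.
have mO k : measurable (U k) by apply: open_measurable; case: (HU k).
pose u x : \bar R := (\sum_(k <oo) ((c k)%:E * (\1_(U k) x)%:E))%E.
have u0 x : (0 <= u x)%E.
  by apply: nneseries_ge0 => k _ _; rewrite mule_ge0// lee_fin ltW.
have mcO k : measurable_fun setT (fun x : R => ((c k)%:E * (\1_(U k) x)%:E)%E).
  apply: measurable_funeM; apply/measurable_EFinP; exact: measurable_indic.
have mu_ : measurable_fun setT u.
  apply: ge0_emeasurable_sum => // k x _ _.
  by rewrite mule_ge0// lee_fin ltW.
(* The relation is transitive by the triangle inequality and additivity of the integral. It holds
   near x in [E k] because [u] is at least [c k] on the neighbourhood [U k] of x. *)
have key : (`|f b - f a|%:E <= \int[mu]_(x in `[a, b[) u x)%E.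
  apply: (@interval_induction _ (fun x y =>
    (`|f y - f x|%:E <= \int[mu]_(t in `[x, y[) u t)%E) _ _ ab).
    move=> x y z xy yz Pxy Pyz; rewrite (integral_co_split xy yz mu_ u0).
    apply: le_trans (leeD Pxy Pyz); rewrite -EFinD lee_fin.
    by rewrite [leRHS]addrC (le_trans _ (ler_normD _ _))// addrA subrK.
  move=> x xab; have [k Ek] : exists k, E k x.
    exists (Num.truncn (g x / e)); split; first by rewrite /= in_itv.
    have /truncn_itv := divr_ge0 (g0 x) (ltW e0).
    by rewrite /= ler_pdivlMr// ltr_pdivrMr.
  have [oO EO _] := HU k.
  have /nbhs_ballP[d1 /= d10 Hd1] : nbhs x (U k) by apply: open_nbhs_nbhs; split => //; exact: EO.
  have [d2 d20 Hd2] := is_derive_local_bound (df x) e0.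
  exists (Num.min d1 d2); first by rewrite lt_min d10.
  move=> y _; rewrite lt_min => /andP[yd1 yd2].
  have fy : `|f y - f x| <= c k * `|y - x|.
    apply: (le_trans (Hd2 _ yd2)); apply: ler_wpM2r => //.
    rewrite /c -natr1 mulrDl mul1r lerD2r (le_trans (f'g x))//.
    by case: Ek => _ /= /andP[_ /ltW].
  have locu z w : z <= w -> `[z, w[ `<=` U k ->
      ((c k * (w - z))%:E <= \int[mu]_(t in `[z, w[) u t)%E.
    move=> zw zwO.
    have -> : (c k * (w - z))%:E = (\int[mu]_(t in `[z, w[) (cst (c k)%:E t))%E.
      rewrite integral_cst//= lebesgue_measure_itv/= lte_fin.
      case: ltP => [_|wz]; first by rewrite -EFinB -EFinM.
      have -> : w = z by apply/le_anti; rewrite wz zw.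
      by rewrite subrr mulr0 mule0.
    apply: ge0_le_integral => //.
    - by move=> t _; rewrite lee_fin ltW.
    - exact: measurable_funTS.
    move=> t /zwO Ut; apply: le_trans (nneseries_lim_ge k.+1 _).
      rewrite big_nat_recr//= indicE mem_set// mule1 leeDr//.
      by apply: sume_ge0 => i _; rewrite mule_ge0// lee_fin ltW.
    by move=> i _ _; rewrite mule_ge0// lee_fin ltW.
  split=> yx.
    rewrite [in X in (X <= _)%E]distrC; apply: le_trans (locu _ _ yx _).
      by rewrite lee_fin (le_trans fy)// distrC ger0_norm// subr_ge0.
    move=> t /=; rewrite in_itv/= => /andP[yt tx]; apply: Hd1 => /=.
    rewrite /ball/= gtr0_norm ?subr_gt0//; apply: le_lt_trans yd1.
    by rewrite distrC ger0_norm ?subr_ge0// lerD2l lerN2.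
  apply: le_trans (locu _ _ yx _).
    by rewrite lee_fin (le_trans fy)// ger0_norm// subr_ge0.
  move=> t /=; rewrite in_itv/= => /andP[xt ty]; apply: Hd1 => /=.
  rewrite /ball/= distrC ger0_norm ?subr_ge0//; apply: lt_le_trans (ltW yd1).
  by rewrite ger0_norm ?subr_ge0// ltrD2r.
apply: (le_trans key).
have tE : trivIset setT E.
  have E_le i j x : E i x -> E j x -> (i <= j)%N.
    move=> [_ /= /andP[ix _]] [_ /= /andP[_ jx]].
    by have := le_lt_trans ix jx; rewrite ltr_pM2r// ltr_nat ltnS.
  move=> i j _ _ [x [Ei Ej]]; apply/eqP; rewrite eqn_leq.
  by rewrite (E_le _ _ _ Ei Ej) (E_le _ _ _ Ej Ei).
have mg2 : measurable_fun setT (fun x => (g x + 2 * e)%:E).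
  by apply/measurable_EFinP; exact: measurable_funD.
have g2_ge0 x : (0 <= (g x + 2 * e)%:E)%E.
  by rewrite lee_fin addr_ge0// mulr_ge0// ltW.
apply: (@le_trans _ _ (\sum_(k <oo) (c k)%:E * mu (E k) + e%:E)%E).
  rewrite integral_nneseries//; last first.
  - by move=> k x _; rewrite mule_ge0// lee_fin ltW.
  - by move=> k; apply: measurable_funTS; exact: mcO.
  apply: le_trans (epsilon_trick _ _ (ltW e0)); last first.
    by move=> k; rewrite mule_ge0// lee_fin ltW.
  apply: lee_nneseries => [k _ _|k _].
    by apply: integral_ge0 => x _; rewrite mule_ge0// lee_fin ltW.
  have [oU EU UE] := HU k.
  rewrite ge0_integralZl//; last 2 first.
  - by apply/measurable_EFinP/measurable_indic; exact: mO.
  - by rewrite lee_fin ltW.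
  rewrite integral_indic//; last exact: mO.
  have -> : (e / (2 ^ k.+1)%:R)%:E = ((c k)%:E * (e / (2 ^ k.+1)%:R / c k)%:E)%E.
    by rewrite -EFinM; congr EFin; rewrite [RHS]mulrC divfK// gt_eqF.
  rewrite -ge0_muleDr// ?lee_fin; last first.
    by rewrite !divr_ge0// ltW.
  apply: lee_wpmul2l; first by rewrite lee_fin ltW.
  apply: (@le_trans _ _ (mu (E k `|` (U k `\` E k)))).
    apply: le_measure; rewrite ?inE; [by apply: measurableI; [exact: mO|exact: measurable_itv]| |].
      by apply: measurableU; [exact: mE|apply: measurableD; [exact: mO|exact: mE]].
    by move=> x [Ux _]; have [Ex|nEx] := pselect (E k x); [left|right].
  apply: (le_trans (measureU2 _ _ _)); [exact: mE|by apply: measurableD; [exact: mO|exact: mE]|].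
  by rewrite leeD2l// ltW.
rewrite EFinD addeA leeD2r//.
have -> : (\int[mu]_(x in `[a, b]) (g x)%:E + (2 * e * (b - a))%:E =
    \int[mu]_(x in `[a, b]) (g x + 2 * e)%:E)%E.
  under [RHS]eq_integral do rewrite EFinD.
  rewrite ge0_integralD//; last 3 first.
  - by move=> x _; rewrite lee_fin.
  - by apply/measurable_EFinP; exact: measurable_funTS.
  - by move=> x _; rewrite lee_fin mulr_ge0// ltW.
  congr (_ + _)%E; rewrite [RHS]integral_cst//= lebesgue_measure_itv/= lte_fin.
  case: ltP => [_|ba]; first by rewrite -EFinB -EFinM.
  have -> : b = a by apply/le_anti; rewrite ba ab.
  by rewrite subrr mulr0 mule0.
apply: (@le_trans _ _ (\int[mu]_(x in \bigcup_k E k) (g x + 2 * e)%:E)%E); last first.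
  apply: ge0_subset_integral => //; first by apply: bigcup_measurable => k _; exact: mE.
  - exact: measurable_funTS.
  - by move=> x [k _ []].
rewrite ge0_integral_bigcup; [|exact: mE|exact: measurable_funTS|by []|by []].
apply: lee_nneseries => [k _ _|k _]; first by rewrite mule_ge0// lee_fin ltW.
rewrite -integral_cst; last exact: mE.
apply: ge0_le_integral => //.
- exact: mE.
- by move=> x _; rewrite lee_fin ltW.
- exact: measurable_funTS.
- move=> x [_ /= /andP[kg _]]; rewrite lee_fin /c.
  by rewrite -[k.+2]addn2 natrD mulrDl lerD2r.
Qed.

(* Cauchy-Schwarz, through [|f'| <= (s + f'^2 / s) / 2] for an optimal s. *)
Lemma sqr_increment_le (R : realType) (f f' : R -> R) (a b : R) :
  a <= b -> (forall x, is_derive x (1 : R) f (f' x)) -> measurable_fun setT f' ->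
  (((f b - f a) ^+ 2)%:E <=
   (b - a)%:E * \int[mu]_(x in `[a, b]) (f' x ^+ 2)%:E)%E.
Proof.
move=> ab df mf'.
have [->|A0] := eqVneq (f b) (f a).
  rewrite subrr expr0n mule_ge0 ?lee_fin ?subr_ge0//.
  by apply: integral_ge0 => x _; rewrite lee_fin sqr_ge0.
have ab' : a < b.
  by rewrite lt_neqAle ab andbT; apply: contra A0 => /eqP ->.
set A := `|f b - f a|; have {}A0 : 0 < A by rewrite normr_gt0 subr_eq0.
have l0 : 0 < b - a by rewrite subr_gt0.
(* For this s, the constant term s (b - a) / 2 is A / 2, half of the left-hand side; what remains
   says s A <= D, that is A^2 <= (b - a) D. *)
pose s := A / (b - a); have s0 : 0 < s by rewrite divr_gt0.
have mf2 : measurable_fun `[a, b] (fun x => (f' x ^+ 2)%:E).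
  by apply/measurable_EFinP/measurable_funTS/measurable_funX.
set D := (\int[mu]_(x in `[a, b]) (f' x ^+ 2)%:E)%E.
have D0 : (0 <= D)%E by apply: integral_ge0 => x _; rewrite lee_fin sqr_ge0.
have key : (A%:E <= (A / 2)%:E + (1 / (2 * s))%:E * D)%E.
  pose g x := s / 2 + 1 / (2 * s) * f' x ^+ 2.
  have mg : measurable_fun setT g.
    by apply: measurable_funD => //; apply: measurable_funM => //; apply: measurable_funX.
  have f'g x : `|f' x| <= g x.
    have -> : g x = `|f' x| + (s - `|f' x|) ^+ 2 / (2 * s).
      by rewrite /g -[f' x ^+ 2]real_normK ?num_real//; field; rewrite gt_eqF.
    by rewrite lerDl divr_ge0 ?sqr_ge0// mulr_ge0// ltW.
  apply: (le_trans (le_integral_derive ab df mg f'g)).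
  under eq_integral do rewrite EFinD.
  have mc2 : measurable_fun `[a, b] (fun x => (1 / (2 * s) * f' x ^+ 2)%:E).
    by apply/measurable_EFinP/measurable_funM => //; apply/measurable_EFinP.
  have c0 : 0 <= 1 / (2 * s) by rewrite divr_ge0// mulr_ge0// ltW.
  rewrite ge0_integralD//; last 2 first.
  - by move=> x _; rewrite lee_fin divr_ge0// ltW.
  - by move=> x _; rewrite lee_fin mulr_ge0 ?sqr_ge0.
  rewrite integral_cst//= lebesgue_measure_itv/= lte_fin ab' -EFinB -EFinM.
  rewrite [s / 2 * _](_ : _ = A / 2); last by rewrite /s mulrAC divfK// gt_eqF.
  rewrite leeD2l//; under eq_integral do rewrite EFinM.
  by rewrite ge0_integralZl// => x _; rewrite lee_fin sqr_ge0.
have -> : (f b - f a) ^+ 2 = A ^+ 2 by rewrite real_normK ?num_real.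
move: D D0 key => [D| |] //= D0.
  rewrite -EFinM -EFinD !lee_fin /s => key.
  suff : A * (A / 2) <= A * (1 / (2 * (A / (b - a))) * D).
    have -> : A * (1 / (2 * (A / (b - a))) * D) = (b - a) * D / 2.
      by field; rewrite !gt_eqF.
    by rewrite mulrA ler_pM2r ?invr_gt0// expr2.
  by rewrite ler_pM2l//; move: key; set Y := _ * D; lra.
by move=> _; rewrite gt0_muley ?lte_fin// leey.
Qed.

(** The Radon-Nikodym derivative of [normal_prob] and the function [normal_pdf] have the same
    integral over every measurable set, hence agree almost everywhere. *)
Lemma ge0_integral_normal_prob (R : realType) (m s : R) (f : R -> \bar R) :
  measurable_fun setT f -> (forall x, 0 <= f x)%E ->
  (\int[normal_prob m s]_x f x = \int[mu]_x (f x * (normal_pdf m s x)%:E))%E.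
Proof.
move=> mf f0; have dom := @normal_prob_dominates R m s.
rewrite -(Radon_Nikodym_SigmaFinite.change_of_variables dom)//.
have mRN := measurable_int _ (Radon_Nikodym_SigmaFinite.f_integrable dom).
have mpdf : measurable_fun setT (EFin \o @normal_pdf R m s).
  by apply/measurable_EFinP; exact: measurable_normal_pdf.
apply: ge0_ae_eq_integral => //.
- exact: emeasurable_funM.
- exact: emeasurable_funM.
- by move=> x _; rewrite mule_ge0// Radon_Nikodym_SigmaFinite.f_ge0.
- by move=> x _; rewrite mule_ge0// lee_fin normal_pdf_ge0.
apply: ae_eqe_mul2l; apply: integral_ae_eq => //.
  exact: Radon_Nikodym_SigmaFinite.f_integrable.
by move=> E _ mE; rewrite -Radon_Nikodym_SigmaFinite.f_integral.
Qed.

(** * The Gaussian Poincaré inequality on the line *)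

Lemma is_derive_normal_pdf1 (R : realType) (m x : R) :
  is_derive x (1 : R) (normal_pdf m 1) (- ((x - m) * normal_pdf m 1 x)).
Proof.
rewrite (normal_pdfE m (oner_neq0 R)).
have -> : (fun x => normal_peak 1 * normal_fun m 1 x) =
    (normal_peak 1 : R) \*: (expR \o ((- 2^-1 : R) \*: ((id - cst m) ^+ 2))).
  apply/funext => t; rewrite /normal_fun/= expr1n.
  by congr (_ * expR _); rewrite mulNr mulrC -mulNr.
have h1 : is_derive x (1 : R) ((- 2^-1 : R) \*: ((id - cst m) ^+ 2)) (- (x - m)).
  apply: is_derive_eq; rewrite /GRing.scale/= subr0 expr1 mulr1 -mulr_natl.
  by rewrite mulrA mulNr mulVf ?mulN1r// pnatr_eq0.
have h2 : is_derive x (1 : R) (expR \o ((- 2^-1 : R) \*: ((id - cst m) ^+ 2)))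
    (expR ((- 2^-1 : R) * (x - m) ^+ 2) * - (x - m)).
  by apply: is_derive1_comp.
apply: is_derive_eq; rewrite /GRing.scale/= /normal_fun expr1n.
have -> : - (x - m) ^+ 2 / (1 *+ 2) = - 2^-1 * (x - m) ^+ 2.
  by rewrite mulNr mulrC -mulNr.
by rewrite mulrN mulrN; congr (- _); rewrite mulrA mulrC.
Qed.

Lemma cvg_normal_pdf1_y (R : realType) (m : R) :
  normal_pdf m 1 x @[x --> +oo] --> (0 : R).
Proof.
rewrite (normal_pdfE m (oner_neq0 R)) -(mulr0 (normal_peak (1 : R))).
apply: cvgMr.
have -> : normal_fun m 1 = gauss_fun \o (fun x : R => (Num.sqrt 2)^-1 * (x - m)).
  apply/funext => x; rewrite /normal_fun /gauss_fun/= expr1n exprMn exprVn.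
  by rewrite sqr_sqrtr// mulNr [_^-1 * _]mulrC.
apply: (cvg_comp _ _ _ (@cvg_gauss_fun R)).
apply: gt0_cvgMry; first by rewrite invr_gt0 sqrtr_gt0.
exact: cvg_addrr.
Qed.

(** The integrand has the primitive [- normal_pdf m 1], which vanishes at infinity. That no constant
    appears is due to the unit variance. *)
Lemma normal_tail_moment (R : realType) (m u : R) : m <= u ->
  (\int[mu]_(t in `[u, +oo[) ((t - m) * normal_pdf m 1 t)%:E =
   (normal_pdf m 1 u)%:E)%E.
Proof.
move=> mu_.
have cpdf : continuous (normal_pdf m (1 : R)).
  by apply: continuous_normal_pdf; exact: oner_neq0.
rewrite (@ge0_continuous_FTC2y _ _ (- normal_pdf m 1) _ 0).
- by rewrite EFinN oppeK add0e.
- by move=> x ux; rewrite mulr_ge0 ?normal_pdf_ge0// subr_ge0 (le_trans mu_).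
- apply: continuous_subspaceT => x; apply: cvgM; last exact: cpdf.
  by apply: cvgB; [exact: cvg_id|exact: cvg_cst].
- by rewrite -oppr0; apply: cvgN; exact: cvg_normal_pdf1_y.
- by move=> x _; apply: derivableN; case: (is_derive_normal_pdf1 m x).
- by apply: cvg_at_right_filter; apply: cvgN; exact: cpdf.
- move=> x _; have [h1 h2] := is_derive_normal_pdf1 m x.
  by rewrite derive1E deriveN// h2 opprK.
Qed.

Lemma normal_tail_momentNy (R : realType) (m u : R) : u <= m ->
  (\int[mu]_(t in `]-oo, u]) ((m - t) * normal_pdf m 1 t)%:E =
   (normal_pdf m 1 u)%:E)%E.
Proof.
move=> um.
have pdfN x : normal_pdf m 1 (- x) = normal_pdf (- m) 1 x.
  rewrite (normal_pdfE m (oner_neq0 R)) (normal_pdfE (- m) (oner_neq0 R)).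
  rewrite /normal_fun (_ : (- x - m) ^+ 2 = (x - - m) ^+ 2)//.
  by rewrite -sqrrN opprB !opprK addrC.
rewrite -[u in LHS]opprK ge0_integration_by_substitutionNy.
- have <- : normal_pdf (- m) 1 (- u) = normal_pdf m 1 u by rewrite -pdfN opprK.
  have mu_ : - m <= - u by rewrite lerN2.
  apply: etrans (normal_tail_moment mu_).
  by apply: eq_integral => t _ /=; rewrite pdfN !opprK addrC.
- apply: continuous_subspaceT => x; apply: cvgM.
    by apply: cvgB; [exact: cvg_cst|exact: cvg_id].
  by apply: continuous_normal_pdf; exact: oner_neq0.
- move=> x; rewrite !in_itv/= opprK => xu.
  by rewrite mulr_ge0 ?normal_pdf_ge0// subr_ge0 ltW// (lt_le_trans xu).
Qed.

(* Chernoff's proof of the Poincare inequality, centred at [f m] instead of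
   the mean: Cauchy-Schwarz on [m, t], then Tonelli, as the weight
   [|t - m| phi t] integrates to [phi u] over the t beyond u. *)
Lemma chernoff_normal (R : realType) (f f' : R -> R) (m : R) :
  (forall x, is_derive x (1 : R) f (f' x)) -> measurable_fun setT f' ->
  (\int[normal_prob m 1]_t ((f t - f m) ^+ 2)%:E <=
   \int[normal_prob m 1]_t (f' t ^+ 2)%:E)%E.
Proof.
move=> df mf'; pose phi t := normal_pdf m (1 : R) t.
have phi0 t : 0 <= phi t by exact: normal_pdf_ge0.
have mphi : measurable_fun setT phi by exact: measurable_normal_pdf.
have cf : continuous f.
  by move=> x; apply/differentiable_continuous/derivable1_diffP; case: (df x).
have mf : measurable_fun setT f by exact: continuous_measurable_fun.
have mf2 : measurable_fun setT (fun x => (f' x ^+ 2)%:E).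
  by apply/measurable_EFinP/measurable_funX.
rewrite ge0_integral_normal_prob; last 2 first.
- by apply/measurable_EFinP/measurable_funX/measurable_funB.
- by move=> x; rewrite lee_fin sqr_ge0.
rewrite ge0_integral_normal_prob//; last by move=> x; rewrite lee_fin sqr_ge0.
(* For z = (t, u), [B] says that u lies between m and t. At u = m the product vanishes whatever t
   is, so that line is taken out; the inner integral over t is then 0 there. *)
pose B : set (R * R) := [set z | 0 <= (z.2 - m) * (z.1 - z.2)] `&` [set z | z.2 != m].
have mB : measurable B.
  have m1 : measurable_fun setT (fun z : R * R => z.1 : R) by exact: measurable_fst.
  have m2 : measurable_fun setT (fun z : R * R => z.2 : R) by exact: measurable_snd.
  apply: measurableI.
    rewrite -[X in measurable X]setTI; apply: measurable_fun_le => //.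
    by apply: measurable_funM; apply: measurable_funB.
  rewrite -[X in measurable X]setTI.
  have -> : [set z : R * R | z.2 != m] = snd @^-1` (~` [set m]).
    by apply/seteqP; split=> z /= /eqP.
  by apply: m2 => //; apply: measurableC.
pose k (z : R * R) : \bar R :=
  ((`|z.1 - m| * phi z.1)%:E * (f' z.2 ^+ 2)%:E * (\1_B z)%:E)%E.
have k0 z : (0 <= k z)%E.
  by rewrite !mule_ge0// lee_fin ?sqr_ge0// mulr_ge0.
have mk : measurable_fun setT k.
  apply: emeasurable_funM; last by apply/measurable_EFinP; exact: measurable_indic.
  apply: emeasurable_funM; last exact: (measurableT_comp mf2).
  apply/measurable_EFinP/measurable_funM; last exact: measurableT_comp.
  apply: measurableT_comp => //; exact: measurable_funB.
apply: (@le_trans _ _ (\int[mu]_t \int[mu]_u k (t, u))%E).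
  apply: ge0_le_integral => //.
  - by move=> t _; rewrite mule_ge0// lee_fin ?sqr_ge0.
  - apply: emeasurable_funM; last exact/measurable_EFinP.
    by apply/measurable_EFinP/measurable_funX/measurable_funB.
  - exact: (measurable_fun_fubini_tonelli_F (m2 := mu)).
  move=> t _; pose I := `](Num.min m t), (Num.max m t)[%classic.
  have mI : measurable (I : set (measurableTypeR R)) by exact: measurable_itv.
  have key : (((f t - f m) ^+ 2)%:E <= `|t - m|%:E * \int[mu]_(u in I) (f' u ^+ 2)%:E)%E.
    rewrite /I; have [mt|tm] := leP m t.
      apply: le_trans (sqr_increment_le mt df mf') _.
      by rewrite integral_itv_bndoo ?ger0_norm ?subr_ge0//; exact: measurable_funTS.
    rewrite -sqrrN opprB; apply: le_trans (sqr_increment_le (ltW tm) df mf') _.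
    rewrite integral_itv_bndoo; last exact: measurable_funTS.
    by rewrite ltr0_norm ?subr_lt0// opprB.
  apply: (@le_trans _ _ (\int[mu]_(u in I) k (t, u))%E); last first.
    by apply: ge0_subset_integral => //; exact: (measurableT_comp mk (pair1_measurable t)).
  rewrite [leRHS](_ : _ = (`|t - m| * phi t)%:E * \int[mu]_(u in I) (f' u ^+ 2)%:E)%E.
    have -> : ((`|t - m| * phi t)%:E = (phi t)%:E * `|t - m|%:E)%E.
      by rewrite -EFinM mulrC.
    rewrite -[leRHS]muleA [leLHS]muleC.
    by apply: lee_wpmul2l; rewrite ?lee_fin.
  rewrite -ge0_integralZl//; last 3 first.
  - exact: measurable_funTS.
  - by move=> u _; rewrite lee_fin sqr_ge0.
  - by rewrite lee_fin mulr_ge0.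
  apply: eq_integral => u; rewrite inE /I /= in_itv/= => /andP[mu_ uM].
  rewrite /k indicE mem_set ?mule1//=; move: mu_ uM; case: (leP m t) => [mt mu_ ut|tm tu um]; split => /=.
  - by rewrite mulr_ge0// subr_ge0 ltW.
  - by rewrite gt_eqF.
  - by rewrite mulr_le0// subr_le0 ltW.
  - by rewrite lt_eqF.
have -> : (\int[mu]_t \int[mu]_u k (t, u) = \int[mu]_u \int[mu]_t k (t, u))%E.
  exact: (@fubini_tonelli _ _ _ _ R mu mu k mk k0).
apply: ge0_le_integral => //.
- by move=> u _; apply: integral_ge0.
- exact: (measurable_fun_fubini_tonelli_G (m1 := mu)).
- by apply: emeasurable_funM => //; exact/measurable_EFinP.
have mw : measurable_fun setT (fun t : R => ((t - m) * normal_pdf m 1 t)%:E).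
  by apply/measurable_EFinP/measurable_funM => //; apply: measurable_funB.
have mw' : measurable_fun setT (fun t : R => ((m - t) * normal_pdf m 1 t)%:E).
  by apply/measurable_EFinP/measurable_funM => //; apply: measurable_funB.
move=> u _; have [um|um|->] := ltgtP u m; last first.
- rewrite integral0_eq ?mule_ge0 ?lee_fin ?sqr_ge0// => t _.
  by rewrite /k indicE memNset ?mule0//= => -[_] /=; rewrite eqxx.
- rewrite [leLHS](_ : _ = \int[mu]_(t in `[u, +oo[) k (t, u))%E; last first.
    rewrite [RHS]integral_mkcond; apply: eq_integral => t _.
    rewrite patchE; case: ifPn => //; rewrite notin_setE/= in_itv/= andbT => /negP tu.
    rewrite (_ : point = 0%E)// /k indicE memNset ?mule0//= => -[] /=.
    by rewrite pmulr_rge0 ?subr_gt0// subr_ge0 => /(negP tu).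
  rewrite muleC -(normal_tail_moment (ltW um)) -ge0_integralZr//; last 3 first.
  - exact: measurable_funTS.
  - move=> t; rewrite /= in_itv/= andbT => ut.
    by rewrite lee_fin mulr_ge0// subr_ge0 (le_trans (ltW um)).
  - by rewrite lee_fin sqr_ge0.
  rewrite le_eqVlt; apply/orP; left; apply/eqP/eq_integral => t.
  rewrite inE/= in_itv/= andbT => ut; rewrite /k indicE mem_set ?mule1/=.
    by rewrite ger0_norm// subr_ge0 (le_trans (ltW um)).
  by split; rewrite /= ?gt_eqF// mulr_ge0// subr_ge0// ltW.
- rewrite [leLHS](_ : _ = \int[mu]_(t in `]-oo, u]) k (t, u))%E; last first.
    rewrite [RHS]integral_mkcond; apply: eq_integral => t _.
    rewrite patchE; case: ifPn => //; rewrite notin_setE/= in_itv/= => /negP tu.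
    rewrite (_ : point = 0%E)// /k indicE memNset ?mule0//= => -[] /=.
    by rewrite nmulr_rge0 ?subr_lt0// subr_le0 => /(negP tu).
  rewrite muleC -(normal_tail_momentNy (ltW um)) -ge0_integralZr//; last 3 first.
  - exact: measurable_funTS.
  - move=> t; rewrite /= in_itv/= => tu.
    by rewrite lee_fin mulr_ge0// subr_ge0 (le_trans tu (ltW um)).
  - by rewrite lee_fin sqr_ge0.
  rewrite le_eqVlt; apply/orP; left; apply/eqP/eq_integral => t.
  rewrite inE/= in_itv/= => tu; rewrite /k indicE mem_set ?mule1/=.
    by rewrite distrC ger0_norm// subr_ge0 (le_trans tu (ltW um)).
  by split; rewrite /= ?lt_eqF// mulr_le0// subr_le0// ltW.
Qed.

(** * Square-integrable functions *)

Section square_integrable.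
Context d (T : measurableType d) (R : realType) (P : probability T R).
Implicit Types f g h : T -> R.

Definition rint f := P.-integrable setT (EFin \o f).

Definition sqint f := measurable_fun setT f /\ rint (fun x => f x ^+ 2).

Lemma rint_measurable f : rint f -> measurable_fun setT f.
Proof. by move=> /measurable_int /measurable_EFinP. Qed.

Lemma EFin_Rintegral f : rint f -> (\int[P]_x f x)%:E = (\int[P]_x (f x)%:E)%E.
Proof. by move=> fi; rewrite /Rintegral fineK//; exact: integrable_fin_num. Qed.

Lemma ge0_rint f : measurable_fun setT f -> (forall x, 0 <= f x) ->
  (\int[P]_x (f x)%:E < +oo)%E -> rint f.
Proof.
move=> mf f0 fy; apply/integrableP; split; first exact/measurable_EFinP.
by under eq_integral do rewrite /= ger0_norm//.
Qed.

Lemma le_rint f g : measurable_fun setT f -> (forall x, `|f x| <= g x) ->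
  rint g -> rint f.
Proof.
move=> mf fg; apply: le_integrable => //; first exact/measurable_EFinP.
by move=> x _ /=; rewrite lee_fin (le_trans (fg x))// ler_norm.
Qed.

Lemma rintD f g : rint f -> rint g -> rint (fun x => f x + g x).
Proof. by move=> fi gi; exact: (integrableD _ fi gi). Qed.

Lemma rintB f g : rint f -> rint g -> rint (fun x => f x - g x).
Proof. by move=> fi gi; exact: (integrableB _ fi gi). Qed.

Lemma rintZ (k : R) f : rint f -> rint (fun x => k * f x).
Proof. by move=> fi; exact: (integrableZl _ k fi). Qed.

Lemma rint_cst (k : R) : rint (fun=> k).
Proof. exact: finite_measure_integrable_cst. Qed.

Lemma rint_sum n (f : 'I_n -> T -> R) :
  (forall i, rint (f i)) -> rint (fun x => \sum_i f i x).
Proof.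
move=> fi; rewrite (_ : (fun x => _) = \sum_i f i)%R; last first.
  by apply/funext => x; rewrite fct_sumE.
elim/big_rec: _ => [|i g _ gi]; first exact: rint_cst.
exact: rintD.
Qed.

Lemma sqint_mul f g : sqint f -> sqint g -> rint (fun x => f x * g x).
Proof.
move=> [mf fi] [mg gi]; apply: (le_rint _ _ (rintD fi gi)).
  exact: measurable_funM.
by move=> x; rewrite ler_norml; apply/andP; split; nra.
Qed.

Lemma sqint_cst (k : R) : sqint (fun=> k).
Proof. by split => //; exact: rint_cst. Qed.

Lemma sqint_rint f : sqint f -> rint f.
Proof.
move=> fi; rewrite (_ : f = fun x => f x * 1); last by apply/funext => x; rewrite mulr1.
exact: (sqint_mul fi (sqint_cst 1)).
Qed.

Lemma sqintD f g : sqint f -> sqint g -> sqint (fun x => f x + g x).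
Proof.
move=> [mf fi] [mg gi]; split; first exact: measurable_funD.
apply: (le_rint _ _ (rintZ 2 (rintD fi gi))).
  by apply: measurable_funX; exact: measurable_funD.
by move=> x; rewrite ger0_norm ?sqr_ge0//; have := sqr_ge0 (f x - g x); lra.
Qed.

Lemma sqintZ (k : R) f : sqint f -> sqint (fun x => k * f x).
Proof.
move=> [mf fi]; split; first exact: measurable_funM.
rewrite (_ : (fun x => _) = fun x => k ^+ 2 * f x ^+ 2); first exact: rintZ.
by apply/funext => x; rewrite exprMn.
Qed.

Lemma sqintB f g : sqint f -> sqint g -> sqint (fun x => f x - g x).
Proof.
move=> fi gi; rewrite (_ : (fun x => _) = fun x => f x + (-1) * g x).
  by apply: sqintD => //; exact: sqintZ.
by apply/funext => x; rewrite mulN1r.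
Qed.

Lemma sqint_sum n (f : 'I_n -> T -> R) :
  (forall i, sqint (f i)) -> sqint (fun x => \sum_i f i x).
Proof.
move=> fi; rewrite (_ : (fun x => _) = \sum_i f i)%R; last first.
  by apply/funext => x; rewrite fct_sumE.
elim/big_rec: _ => [|i g _ gi]; first exact: sqint_cst.
exact: sqintD.
Qed.

Lemma Rintegral_sum n (f : 'I_n -> T -> R) : (forall i, rint (f i)) ->
  \int[P]_x (\sum_i f i x) = \sum_i \int[P]_x f i x.
Proof.
elim: n => [|n IH] in f * => fi.
  rewrite big_ord0; under eq_Rintegral do rewrite big_ord0.
  by rewrite Rintegral_cst// mul0r.
rewrite big_ord_recl -IH => [|i]; last exact: fi.
rewrite -RintegralD//; last 2 first.
- exact: fi.
- by apply: rint_sum => i; exact: fi.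
by apply: eq_Rintegral => x _; rewrite big_ord_recl.
Qed.

Lemma Rintegral_cst1 (k : R) : \int[P]_x k = k.
Proof.
by rewrite Rintegral_cst//; have := @probability_setT _ _ _ P => /= ->; rewrite mulr1.
Qed.

Lemma ge0_sqint f : measurable_fun setT f ->
  (\int[P]_x (f x ^+ 2)%:E < +oo)%E -> sqint f.
Proof.
move=> mf fy; split => //; apply: ge0_rint => //; first exact: measurable_funX.
by move=> x; exact: sqr_ge0.
Qed.

End square_integrable.

(** With a = f - f m, the left-hand side is 2 E[a^2] - 2 (E[a])^2. Dropping the last square leaves
    the quantity that Chernoff's inequality bounds, so centring at [f m] costs nothing. *)
Lemma normal_variance_le (R : realType) (f f' : R -> R) (m : R) :
  (forall x, is_derive x (1 : R) f (f' x)) -> measurable_fun setT f' ->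
  (\int[normal_prob m 1]_s \int[normal_prob m 1]_t ((f s - f t) ^+ 2)%:E <=
   2%:E * \int[normal_prob m 1]_t (f' t ^+ 2)%:E)%E.
Proof.
move=> df mf'; pose P : probability _ R := normal_prob m 1.
rewrite -/P.
have [Doo|Doo] := eqVneq (\int[P]_t (f' t ^+ 2)%:E)%E +oo%E.
  by rewrite Doo gt0_muley ?leey// lte_fin.
have cf : continuous f.
  by move=> x; apply/differentiable_continuous/derivable1_diffP; case: (df x).
have mf : measurable_fun setT f by exact: continuous_measurable_fun.
have cher := chernoff_normal m df mf'.
pose a t := f t - f m; have ma : measurable_fun setT a by exact: measurable_funB.
have a2 : sqint P a.
  by apply: ge0_sqint => //; apply: le_lt_trans cher _; rewrite ltey.
have a1 := sqint_rint a2; have [_ a2'] := a2.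
pose A := \int[P]_t a t; pose S := \int[P]_t (a t ^+ 2).
have J s : (\int[P]_t ((f s - f t) ^+ 2)%:E)%E = (a s ^+ 2 - 2 * A * a s + S)%:E.
  have -> : a s ^+ 2 - 2 * A * a s + S = \int[P]_t (a s ^+ 2 - 2 * a s * a t + a t ^+ 2).
    rewrite RintegralD//; last by apply: rintB; [exact: rint_cst|exact: rintZ].
    rewrite RintegralB//; [|exact: rint_cst|exact: rintZ].
    by rewrite RintegralZl// Rintegral_cst1; congr (_ - _ + _); rewrite mulrAC.
  rewrite EFin_Rintegral; last first.
    by apply: rintD => //; apply: rintB; [exact: rint_cst|exact: rintZ].
  by apply: eq_integral => t _; congr EFin; rewrite /a; ring.
under eq_integral do rewrite J.
rewrite -EFin_Rintegral; last first.
  by apply: rintD; [apply: rintB => //; exact: rintZ|exact: rint_cst].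
rewrite RintegralD//; [|by apply: rintB => //; exact: rintZ|exact: rint_cst].
rewrite RintegralB//; last exact: rintZ.
rewrite RintegralZl// Rintegral_cst1.
apply: (@le_trans _ _ (2 * S)%:E).
  by rewrite lee_fin -/A -/S; have := sqr_ge0 A; lra.
by rewrite EFinM lee_wpmul2l ?lee_fin// /S EFin_Rintegral.
Qed.

(** * Cramér-Wold *)

(* [sg_step] iterates to the sign on [-1, 1]: together with the sine, it turns
   indicators into pointwise limits of trigonometric polynomials. *)
Definition sg_step (R : realType) (y : R) : R := (3 * y - y ^+ 3) / 2.

Lemma sg_stepN (R : realType) (y : R) : sg_step (- y) = - sg_step y.
Proof. by rewrite /sg_step; field. Qed.

Lemma iter_sg_stepN (R : realType) (y : R) n :
  iter n (@sg_step R) (- y) = - iter n (@sg_step R) y.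
Proof. by elim: n => //= n ->; exact: sg_stepN. Qed.

(** One step multiplies the distance 1 - z by 1 - z (1 + z) / 2, which is at most 1 - y / 2 because
    the iterates z stay above y. *)
Lemma iter_sg_step01 (R : realType) (y : R) n : 0 < y -> y <= 1 ->
  y <= iter n (@sg_step R) y <= 1 /\ 1 - iter n (@sg_step R) y <= (1 - y / 2) ^+ n.
Proof.
move=> y0 y1; elim: n => [|n [/= /andP[yz z1] zn]] /=.
  by rewrite lexx y1 expr0 lerBlDr lerDl ltW.
set z := iter n _ y in yz z1 zn *; rewrite /sg_step; split.
  have z0 : 0 < z by exact: lt_le_trans y0 yz.
  apply/andP; split.
    have -> : (3 * z - z ^+ 3) / 2 = z + z * (1 - z) * (1 + z) / 2 by field.
    by rewrite ler_wpDr// divr_ge0// !mulr_ge0 ?subr_ge0 ?addr_ge0// ltW.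
  rewrite -subr_ge0.
  have -> : 1 - (3 * z - z ^+ 3) / 2 = (1 - z) ^+ 2 * (2 + z) / 2 by field.
  by rewrite divr_ge0// mulr_ge0 ?sqr_ge0// addr_ge0// ltW.
have -> : 1 - (3 * z - z ^+ 3) / 2 = (1 - z) * (1 - z * (1 + z) / 2) by field.
rewrite exprSr ler_pM ?subr_ge0 ?z1//; first by nra.
by rewrite lerD2l lerN2 ler_pM2r ?invr_gt0//; nra.
Qed.

Lemma iter_sg_step_le1 (R : realType) (y : R) n : `|y| <= 1 ->
  `|iter n (@sg_step R) y| <= 1.
Proof.
wlog y0 : y / 0 <= y => [h|].
  have [|y0] := leP 0 y; first exact: h.
  by move=> y1; rewrite -normrN -iter_sg_stepN h ?normrN// oppr_ge0 ltW.
move: y0; rewrite le_eqVlt => /predU1P[<- _|y0].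
  suff -> : iter n (@sg_step R) 0 = 0 by rewrite normr0.
  by elim: n => //= n ->; rewrite /sg_step expr0n/= mulr0 subrr mul0r.
rewrite gtr0_norm// => y1; have [/andP[yz z1] _] := iter_sg_step01 n y0 y1.
by rewrite ger0_norm// (le_trans (ltW y0)).
Qed.

Lemma cvg_iter_sg_step (R : realType) (y : R) : `|y| <= 1 ->
  iter n (@sg_step R) y @[n --> \oo] --> Num.sg y.
Proof.
have pos (z : R) : 0 < z -> z <= 1 -> iter n (@sg_step R) z @[n --> \oo] --> (1 : R).
  move=> z0 z1; have h n := iter_sg_step01 n z0 z1.
  have lim1 : 1 - (1 - z / 2) ^+ n @[n --> \oo] --> (1 : R).
    rewrite -[X in _ --> X]subr0; apply: cvgB; first exact: cvg_cst.
    by apply: cvg_expr; rewrite ltr_norml; apply/andP; split; lra.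
  apply: (squeeze_cvgr _ lim1); last exact: (@cvg_cst _ (1 : R)).
  near=> n; have [/andP[_ ->]] := h n; rewrite andbT.
  by rewrite lerBlDr addrC -lerBlDr.
move=> y1; have [y0|y0|<-] := ltgtP 0 y.
- by rewrite gtr0_sg//; apply: pos => //; move: y1; rewrite gtr0_norm.
- rewrite ltr0_sg//; have -> : y = - - y by rewrite opprK.
  under eq_fun do rewrite iter_sg_stepN.
  apply: cvgN; apply: pos; first by rewrite oppr_gt0.
  by rewrite -ltr0_norm.
- rewrite sgr0 (_ : (fun n => _) = cst 0); first exact: cvg_cst.
  apply/funext => n; elim: n => //= n; rewrite /cst => ->.
  by rewrite /sg_step expr0n/= mulr0 subrr mul0r.
Unshelve. all: by end_near. Qed.

(** The sequence is eventually constant: once |x| / (n + 1) < pi, the sine has the sign of x. *)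
Lemma cvg_sg_sin (R : realType) (x : R) :
  Num.sg (sin (x / n.+1%:R)) @[n --> \oo] --> Num.sg x.
Proof.
have [->|x0] := eqVneq x 0.
  under eq_fun do rewrite mul0r sin0.
  exact: cvg_cst.
have hpi : 0 < (pi : R) by exact: pi_gt0.
apply: cvg_near_cst; exists (Num.truncn (`|x| / pi)) => // n /= xn.
have {}xn : `|x / n.+1%:R| < pi.
  rewrite normrM normfV [X in _ / X]ger0_norm// ltr_pdivrMr// mulrC -ltr_pdivrMr//.
  have /truncn_itv/andP[_] : 0 <= `|x| / pi by rewrite divr_ge0// ltW.
  by move=> h; apply: (lt_le_trans h); rewrite ler_nat ltnS.
have [x0'|x0'|x0'] := ltgtP 0 x; last by rewrite -x0' eqxx in x0.
- have h : 0 < x / n.+1%:R by rewrite divr_gt0.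
  rewrite !gtr0_sg//; apply: sin_gt0_pi; rewrite // h/=.
  by move: xn; rewrite gtr0_norm.
- have h : 0 < - (x / n.+1%:R) by rewrite oppr_gt0 pmulr_llt0// invr_gt0.
  rewrite !ltr0_sg// -oppr_gt0 -sinN; apply: sin_gt0_pi; rewrite h/=.
  by move: xn; rewrite ltr0_norm// -oppr_gt0.
Qed.

Lemma cvg_norm_le (R : realType) (u : nat -> R) (l M : R) :
  (forall n, `|u n| <= M) -> u n @[n --> \oo] --> l -> `|l| <= M.
Proof.
move=> uM ul; rewrite -(cvg_lim (@Rhausdorff R) (cvg_norm ul)).
apply: limr_le; first by apply/cvg_ex; exists `|l|; exact: cvg_norm.
exact: nearW.
Qed.

Section cramer_wold.
Context d (T : measurableType d) (R : realType) (P1 P2 : probability T R).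
Context (I : finType) (X : I -> T -> R).
Hypothesis mX : forall i, measurable_fun setT (X i).
Implicit Types (c : I -> R) (b : R) (h u : T -> R).

(** The phase [b] brings in the sines, so that real cosines replace the complex characteristic
    function. *)
Let lin c b t : R := \sum_i c i * X i t + b.

Hypothesis cosE : forall c b,
  \int[P1]_t cos (lin c b t) = \int[P2]_t cos (lin c b t).

Let mlin c b : measurable_fun setT (lin c b).
Proof.
apply: measurable_funD => //.
by apply: measurable_sum => i; apply: measurable_funM.
Qed.

Let mcos c b : measurable_fun setT (fun t => cos (lin c b t)).
Proof.
by apply: measurableT_comp => //; apply: continuous_measurable_fun => ?; exact: continuous_cos.
Qed.

Definition bounded_mfun h := measurable_fun setT h /\ exists M, forall t, `|h t| <= M.

Let bounded_mul h u : bounded_mfun h -> bounded_mfun u -> bounded_mfun (fun t => h t * u t).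
Proof.
move=> [mh [M hM]] [mu [N uN]]; split; first exact: measurable_funM.
by exists (M * N) => t; rewrite normrM ler_pM.
Qed.

Let bounded_add h u : bounded_mfun h -> bounded_mfun u -> bounded_mfun (fun t => h t + u t).
Proof.
move=> [mh [M hM]] [mu [N uN]]; split; first exact: measurable_funD.
by exists (M + N) => t; rewrite (le_trans (ler_normD _ _))// lerD.
Qed.

Let bounded_cst b : bounded_mfun (fun=> b).
Proof. by split => //; exists `|b|. Qed.

Let bounded_cos c b : bounded_mfun (fun t => cos (lin c b t)).
Proof. by split => //; exists 1 => t; exact: cos_max. Qed.

Let rint_bounded (P : probability T R) h : bounded_mfun h -> rint P h.
Proof.
move=> [mh [M hM]]; apply: (le_rint mh _ (rint_cst P M)); exact: hM.
Qed.

(** Testing against every cosine, and not only against 1, is what makes each cosine a multiplier: a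
    product of two cosines is half a sum of two cosines. *)
Let same h := bounded_mfun h /\
  forall c b, \int[P1]_t (h t * cos (lin c b t)) = \int[P2]_t (h t * cos (lin c b t)).

(* Multipliers contain the cosines, and are stable under sums, products and
   bounded limits, hence their indicators form a sigma-algebra. *)
Let multiplier u := bounded_mfun u /\ forall h, same h -> same (fun t => u t * h t).

Let cvg_Rintegral (P : probability T R) (h_ : nat -> T -> R) h M :
  (forall n, measurable_fun setT (h_ n)) -> (forall n t, `|h_ n t| <= M) ->
  (forall t, h_ n t @[n --> \oo] --> h t) ->
  \int[P]_t h_ n t @[n --> \oo] --> \int[P]_t h t.
Proof.
move=> mh_ hM hh.
have mh : measurable_fun setT h by apply: (measurable_fun_cvg mh_) => t _; exact: hh.
have hM' t : `|h t| <= M.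
  exact: (cvg_norm_le _ (hh t)).
have [] := @dominated_convergence _ _ _ P setT measurableT
  (fun n t => (h_ n t)%:E) (fun t => (h t)%:E) (fun=> M%:E).
- by move=> n; exact/measurable_EFinP.
- exact/measurable_EFinP.
- by apply/aeW => t _; apply/fine_cvgP; split; [exact: nearW|exact: hh].
- exact: rint_cst.
- by apply/aeW => t n _; rewrite /= lee_fin.
move=> _ _ lim; apply: fine_cvg; rewrite fineK//.
by apply: integrable_fin_num => //; apply: rint_bounded; split => //; exists M.
Qed.

Let same_lim (h_ : nat -> T -> R) h M : (forall n, same (h_ n)) ->
  (forall n t, `|h_ n t| <= M) -> (forall t, h_ n t @[n --> \oo] --> h t) -> same h.
Proof.
move=> hs hM hh.
have mh : measurable_fun setT h.
  by apply: (measurable_fun_cvg (h := h_)) => [n|t _]; [case: (hs n) => -[]|exact: hh].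
have hM' t : `|h t| <= M.
  exact: (cvg_norm_le _ (hh t)).
split; first by split => //; exists M.
move=> c b.
have lim (P : probability T R) : \int[P]_t (h_ n t * cos (lin c b t)) @[n --> \oo] -->
    \int[P]_t (h t * cos (lin c b t)).
  apply: (@cvg_Rintegral P _ _ M).
  - by move=> n; apply: measurable_funM => //; case: (hs n) => -[].
  - by move=> n t; rewrite normrM -[M]mulr1 ler_pM// cos_max.
  - by move=> t; apply: cvgMl; exact: hh.
have e : (fun n => \int[P1]_t (h_ n t * cos (lin c b t))) =
    (fun n => \int[P2]_t (h_ n t * cos (lin c b t))).
  by apply/funext => n; exact: (hs n).2.
have := lim P1; rewrite e => l1; exact: (cvg_unique _ l1 (lim P2)).
Qed.

Let multiplier_lim (u_ : nat -> T -> R) u M : (forall n, multiplier (u_ n)) ->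
  (forall n t, `|u_ n t| <= M) -> (forall t, u_ n t @[n --> \oo] --> u t) ->
  multiplier u.
Proof.
move=> us uM uu; split.
  have mu : measurable_fun setT u.
    by apply: (measurable_fun_cvg (h := u_)) => [n|t _]; [case: (us n) => -[]|exact: uu].
  split => //; exists M => t.
  exact: (cvg_norm_le _ (uu t)).
move=> h hs; have [[mh [N hN]] _] := hs.
apply: (@same_lim (fun n t => u_ n t * h t) _ (M * N)).
- by move=> n; exact: (us n).2.
- by move=> n t; rewrite normrM ler_pM.
- by move=> t; apply: cvgMl; exact: uu.
Qed.

Let same_rint (P : probability T R) h c b : same h ->
  rint P (fun t => h t * cos (lin c b t)).
Proof. by move=> [bh _]; apply: rint_bounded; exact: bounded_mul. Qed.

Let same_add h k : same h -> same k -> same (fun t => h t + k t).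
Proof.
move=> hs ks; split; first by apply: bounded_add; [case: hs|case: ks].
move=> c b; under eq_Rintegral do rewrite mulrDl.
under [RHS]eq_Rintegral do rewrite mulrDl.
rewrite !RintegralD//; [|exact: same_rint..].
by rewrite (hs.2) (ks.2).
Qed.

Let same_scale a h : same h -> same (fun t => a * h t).
Proof.
move=> hs; split; first by apply: bounded_mul; [exact: bounded_cst|case: hs].
move=> c b; under eq_Rintegral do rewrite -mulrA.
under [RHS]eq_Rintegral do rewrite -mulrA.
by rewrite !RintegralZl//; [rewrite (hs.2)|exact: same_rint..].
Qed.

Let same1 : same (fun=> 1).
Proof.
split; first exact: bounded_cst.
move=> c b; under eq_Rintegral do rewrite mul1r.
by under [RHS]eq_Rintegral do rewrite mul1r.
Qed.

Let multiplier_add u v : multiplier u -> multiplier v -> multiplier (fun t => u t + v t).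
Proof.
move=> [bu hu] [bv hv]; split => [|h hs]; first exact: bounded_add.
rewrite (_ : (fun t => _) = fun t => u t * h t + v t * h t); last first.
  by apply/funext => t; rewrite mulrDl.
by apply: same_add; [exact: hu|exact: hv].
Qed.

Let multiplier_cst a : multiplier (fun=> a).
Proof. by split => [|h hs]; [exact: bounded_cst|exact: same_scale]. Qed.

Let multiplier_mul u v : multiplier u -> multiplier v -> multiplier (fun t => u t * v t).
Proof.
move=> [bu hu] [bv hv]; split => [|h hs]; first exact: bounded_mul.
rewrite (_ : (fun t => _) = fun t => u t * (v t * h t)); last first.
  by apply/funext => t; rewrite mulrA.
by apply: hu; exact: hv.
Qed.

Let multiplier_cos c b : multiplier (fun t => cos (lin c b t)).
Proof.
split => [|h hs]; first exact: bounded_cos.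
split; first by apply: bounded_mul; [exact: bounded_cos|case: hs].
move=> c' b'.
have linD t : lin c b t + lin c' b' t = lin (fun i => c i + c' i) (b + b') t.
  rewrite /lin addrACA -big_split/=; congr (_ + _).
  by apply: eq_bigr => i _; rewrite mulrDl.
have linB t : lin c b t - lin c' b' t = lin (fun i => c i - c' i) (b - b') t.
  rewrite /lin opprD addrACA -sumrB; congr (_ + _).
  by apply: eq_bigr => i _; rewrite mulrBl.
have E t : cos (lin c b t) * h t * cos (lin c' b' t) =
    2^-1 * (h t * cos (lin (fun i => c i + c' i) (b + b') t)) +
    2^-1 * (h t * cos (lin (fun i => c i - c' i) (b - b') t)).
  by rewrite -linD -linB cosD cosB; field.
under eq_Rintegral do rewrite E.
under [RHS]eq_Rintegral do rewrite E.
rewrite !RintegralD//; try by apply: rintZ; exact: same_rint.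
by rewrite !RintegralZl//; try exact: same_rint; rewrite !(hs.2).
Qed.

Let multiplier_sg_step u : multiplier u -> multiplier (fun t => sg_step (u t)).
Proof.
move=> mu; rewrite (_ : (fun t => _) =
    fun t => (3 / 2) * u t + (- 2^-1) * (u t * (u t * u t))).
  apply: multiplier_add; apply: multiplier_mul; try exact: multiplier_cst => //.
    by [].
  by do ?apply: multiplier_mul.
by apply/funext => t; rewrite /sg_step; field.
Qed.

Let multiplier_iter u n : multiplier u -> multiplier (fun t => iter n (@sg_step R) (u t)).
Proof. by move=> mu; elim: n => // n IH; exact: multiplier_sg_step. Qed.

(** Two nested bounded limits. The iterates of [sg_step] turn a sine, which is a cosine with phase -
    pi / 2, into its sign; stretching the period then turns the sign of the sine into the sign of
    its argument. *)
Let multiplier_sg i a : multiplier (fun t => Num.sg (X i t - a)).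
Proof.
apply: (@multiplier_lim (fun n t => Num.sg (sin ((X i t - a) / n.+1%:R))) _ 1).
- move=> n; apply: (@multiplier_lim
    (fun k t => iter k (@sg_step R) (sin ((X i t - a) / n.+1%:R))) _ 1).
  + move=> k; apply: multiplier_iter.
    rewrite (_ : (fun t => _) = fun t => cos (lin (fun j => (j == i)%:R / n.+1%:R)
        (- a / n.+1%:R - pi / 2) t)); first exact: multiplier_cos.
    apply/funext => t; rewrite /lin (bigD1 i)//= big1 => [|j /negbTE ->]; last first.
      by rewrite !mul0r.
    rewrite eqxx addr0 addrA cosBpihalf; congr sin.
    by rewrite mul1r mulrBl mulNr mulrC.
  + by move=> k t; apply: iter_sg_step_le1; exact: sin_max.
  + by move=> t; apply: cvg_iter_sg_step; exact: sin_max.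
- by move=> n t; rewrite normr_sg; case: eqP.
- by move=> t; exact: cvg_sg_sin.
Qed.

Let good : set_system T := [set A | measurable A /\ multiplier (\1_A : T -> R)].

Let sigma_good : sigma_algebra setT good.
Proof.
have goodC A : good A -> good (~` A).
  move=> [mA mulA]; split; first exact: measurableC.
  rewrite (_ : (\1_(~` A) : T -> R) = fun t => 1 + (-1) * \1_A t).
    by apply: multiplier_add => //; apply: multiplier_mul.
  apply/funext => t; rewrite !indicE in_setC; case: (t \in A) => /=.
    by rewrite mulr1 subrr.
  by rewrite mulr0 addr0.
have goodI A B : good A -> good B -> good (A `&` B).
  move=> [mA mulA] [mB mulB]; split; first exact: measurableI.
  rewrite (_ : (\1_(A `&` B) : T -> R) = fun t => \1_A t * \1_B t).
    exact: multiplier_mul.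
  by apply/funext => t; rewrite indicI.
have good0 : good set0.
  by split => //; rewrite indic0; exact: multiplier_cst.
have goodU A B : good A -> good B -> good (A `|` B).
  by move=> gA gB; rewrite -[_ `|` _]setCK setCU; apply/goodC/goodI; exact: goodC.
split=> // [A|A gA]; first by rewrite setTD; exact: goodC.
have gU n : good (\big[setU/set0]_(k < n) A k).
  by elim/big_ind : _ => // i _; exact: gA.
split; first by apply: bigcupT_measurable => n; case: (gA n).
apply: (@multiplier_lim (fun n t => \1_(\big[setU/set0]_(k < n) A k) t) _ 1).
- by move=> n; exact: (gU n).2.
- by move=> n t; rewrite indicE; case: (_ \in _); rewrite ?normr1 ?normr0.
- move=> t; apply: cvg_near_cst.
  have [[k _ Ak]|nA] := pselect ((\bigcup_k A k) t).
    exists k.+1 => // n /= kn; rewrite !indicE !mem_set//; first by exists k.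
    by rewrite -bigcup_mkord; exists k.
  apply: nearW => n; rewrite !indicE !memNset// -bigcup_mkord => -[k kn Ak].
  by apply: nA; exists k.
Qed.

Lemma cramer_wold A :
  <<s [set B | exists i a, B = [set t | a < X i t]] >> A -> P1 A = P2 A.
Proof.
have good_sub : <<s [set B | exists i a, B = [set t | a < X i t]] >> `<=` good.
  apply: smallest_sub => // _ [i [a ->]]; split.
    rewrite -[X in measurable X]setTI.
    rewrite (_ : [set t | _] = X i @^-1` `]a, +oo[); first exact: mX.
    by apply/seteqP; split => t; rewrite /= in_itv/= andbT.
  (* The indicator of y > 0 is (s + s^2) / 2 for s the sign of y. *)
  rewrite (_ : (\1_(_) : T -> R) = fun t => 2^-1 * (Num.sg (X i t - a) +
      Num.sg (X i t - a) * Num.sg (X i t - a))).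
    by apply: multiplier_mul => //; apply: multiplier_add => //; apply: multiplier_mul.
  apply/funext => t; rewrite indicE.
  have -> : (t \in [set t | a < X i t]) = (0 < X i t - a).
    by rewrite subr_gt0; apply/idP/idP; rewrite inE.
  by case: sgrP => _ /=; field.
move=> /good_sub[mA [_ mulA]].
have [_ /(_ (fun=> 0) 0)] := mulA _ same1.
have E t : \1_A t * 1 * cos (lin (fun=> 0) 0 t) = \1_A t :> R.
  by rewrite /lin big1 ?addr0 ?cos0 ?mulr1// => i _; rewrite mul0r.
under eq_Rintegral do rewrite E.
under [RHS]eq_Rintegral do rewrite E.
rewrite /Rintegral !integral_indic// !setIT => e.
rewrite -[LHS]fineK ?fin_num_measure// -[RHS]fineK ?fin_num_measure//.
by rewrite e.
Qed.

End cramer_wold.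

(** * The Borel sets of R^d *)

(** An open set is the countable union of the boxes it contains that have rational centres and radii
    1 / (n + 1), and the preimage of a box is a finite intersection of preimages under the
    coordinates. *)
Lemma measurable_fun_Borel (R : realType) d (T : measurableType d) n
    (f : T -> 'cV[R]_n) :
  (forall i, measurable_fun setT (fun t => f t i 0)) ->
  measurable_fun setT (f : T -> Borel 'cV[R]_n).
Proof.
move=> mf; apply: (@measurability _ _ T (Borel 'cV[R]_n) setT f open).
  by [].
move=> _ [U oU <-]; rewrite setTI.
pose box (p : 'cV[rat]_n * nat) : set 'cV[R]_n :=
  [set x | forall i, `|ratr (p.1 i 0) - x i 0| < p.2.+1%:R^-1].
pose F (p : 'cV[rat]_n * nat) := if pselect (box p `<=` U) then f @^-1` box p else set0.
have -> : f @^-1` U = \bigcup_k odflt set0 (omap F (unpickle k)).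
  apply/seteqP; split=> [t Ut|t [k _]]; last first.
    by case: unpickle => //= p; rewrite /F; case: pselect => //= pU; exact: pU.
  have /nbhs_ballP[e /= e0 eU] : nbhs (f t) U by exact: open_nbhs_nbhs.
  pose k := Num.truncn (2 / e).
  have k2 : 2 / e < k.+1%:R.
    by have /truncn_itv/andP[] : 0 <= 2 / e by rewrite divr_ge0// ltW.
  have ke : k.+1%:R^-1 + k.+1%:R^-1 < e :> R.
    rewrite -mulr2n -[_ *+ 2]mulr_natl ltr_pdivrMr// mulrC.
    by rewrite -ltr_pdivrMr.
  have /choice[p Hp] : forall i, exists q : rat, `|ratr q - f t i 0| < k.+1%:R^-1.
    move=> i; have [|q] := @rat_in_itvoo R (f t i 0 - k.+1%:R^-1) (f t i 0 + k.+1%:R^-1).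
      by rewrite ltrD2l (@lt_trans _ _ 0)// ?oppr_lt0 invr_gt0.
    by rewrite in_itv/= => h; exists q; rewrite ltr_distl.
  exists (pickle (\col_i p i, k)); first by [].
  rewrite pickleK [odflt _ _]/= /F.
  case: pselect => [_ i|nbox]/=; first by rewrite mxE.
  case: nbox => x xb; apply: eU; split => // i j; rewrite ord1.
  rewrite /ball/= -(subrK (ratr (p i)) (f t i 0)) -addrA.
  apply: le_lt_trans ke; apply: (le_trans (ler_normD _ _)); rewrite lerD//.
    by rewrite distrC ltW.
  by have := xb i; rewrite /= mxE => /ltW.
apply: bigcupT_measurable => k; case: unpickle => //= p.
rewrite /F; case: pselect => pU; last exact: measurable0.

rewrite (_ : f @^-1` box p = \bigcap_(i in [set: 'I_n])
    ((fun t => f t i 0) @^-1` [set y | `|ratr (p.1 i 0) - y| < p.2.+1%:R^-1])).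
  apply: fin_bigcap_measurable => [|i _]; first exact: finite_finset.
  rewrite -[X in measurable X]setTI; apply: mf => //.
  rewrite (_ : [set y | _] = ball (ratr (p.1 i 0) : R) p.2.+1%:R^-1)//.
  exact: measurable_ball.
apply/seteqP; split => t h i; [move=> _; exact: h|exact: (h i Logic.I)].
Qed.

Lemma continuous_Borel_measurable (R : realType) n (f : 'cV[R]_n -> R) :
  continuous f -> measurable_fun setT (f : Borel 'cV[R]_n -> R).
Proof.
move=> /continuousP cf; apply: (measurability _ (RGenOInfty.measurableE R)).
move=> _ [_ [a ->] <-]; rewrite setTI.
by apply: sub_sigma_algebra; apply: cf; exact: interval_open.
Qed.

Lemma measurable_coord (R : realType) n (i : 'I_n) :
  measurable_fun setT (fun x : Borel 'cV[R]_n => (x : 'cV[R]_n) i 0).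
Proof. by apply: continuous_Borel_measurable; exact: coord_continuous. Qed.

(** By [measurable_fun_Borel], the identity is measurable from the sigma-algebra generated by the 2
    n coordinates. It follows that cosines of linear functionals determine the law of a pair of
    vectors. *)
Lemma prod_Borel_generated (R : realType) n :
  @measurable _ (Borel 'cV[R]_n * Borel 'cV[R]_n)%type `<=`
  <<s [set B | exists (i : 'I_n + 'I_n) a, B = [set z : 'cV[R]_n * 'cV[R]_n |
      a < match i with inl k => z.1 k 0 | inr k => z.2 k 0 end]] >>.
Proof.
set G := [set B | _]; move=> A mA.
pose T := g_sigma_algebraType G.
have mcoord (i : 'I_n + 'I_n) : measurable_fun setT (fun z : T =>
    match i with inl k => (z : 'cV[R]_n * 'cV[R]_n).1 k 0
               | inr k => (z : 'cV[R]_n * 'cV[R]_n).2 k 0 end).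
  apply: (measurability _ (RGenOInfty.measurableE R)) => _ [_ [a ->] <-].
  rewrite setTI; apply: sub_sigma_algebra; exists i, a.
  by apply/seteqP; split => z; rewrite /= in_itv/= andbT.
have mid : measurable_fun setT (fun z : T => z : Borel 'cV[R]_n * Borel 'cV[R]_n).
  apply/measurable_fun_pairP; split; apply: measurable_fun_Borel => k.
    exact: (mcoord (inl k)).
  exact: (mcoord (inr k)).
by have := mid measurableT A mA; rewrite setTI.
Qed.

(** * Gaussian vectors *)

Lemma normal_pdf_shift (R : realType) (m s b x : R) : s != 0 ->
  normal_pdf (m + b) s (x + b) = normal_pdf m s x.
Proof.
move=> s0; rewrite (normal_pdfE (m + b) s0) (normal_pdfE m s0) /normal_fun.
by rewrite opprD addrACA subrr addr0.
Qed.

(* Completing the square in x. *)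
Lemma normal_pdf_conv (R : realType) (m b s t x y : R) : 0 < s -> 0 < t ->
  normal_pdf m s x * normal_pdf (x + b) t y =
  normal_pdf (m + b) (Num.sqrt (s ^+ 2 + t ^+ 2)) y *
  normal_pdf ((t ^+ 2 * m + s ^+ 2 * (y - b)) / (s ^+ 2 + t ^+ 2))
    (s * t / Num.sqrt (s ^+ 2 + t ^+ 2)) x.
Proof.
move=> s0 t0; have s2 : 0 < s ^+ 2 by rewrite exprn_gt0.
have t2 : 0 < t ^+ 2 by rewrite exprn_gt0.
have st2 : 0 < s ^+ 2 + t ^+ 2 by rewrite addr_gt0.
set r := Num.sqrt _; have r0 : 0 < r by rewrite sqrtr_gt0.
have r2 : r ^+ 2 = s ^+ 2 + t ^+ 2 by rewrite sqr_sqrtr// ltW.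
have w0 : 0 < s * t / r by rewrite divr_gt0// mulr_gt0.
rewrite (normal_pdfE _ (lt0r_neq0 s0)) (normal_pdfE _ (lt0r_neq0 t0)).
rewrite (normal_pdfE _ (lt0r_neq0 r0)) (normal_pdfE _ (lt0r_neq0 w0)).
rewrite mulrACA [RHS]mulrACA /normal_fun -!expRD; congr (_ * expR _); last first.
  rewrite !expr_div_n exprMn r2; field.
  by rewrite !gt_eqF.
have p0 (u : R) : 0 <= u ^+ 2 * pi *+ 2.
  by rewrite mulrn_wge0// mulr_ge0 ?sqr_ge0 ?pi_ge0.
rewrite /normal_peak -!invfM -!sqrtrM ?p0//.
congr (Num.sqrt _)^-1; rewrite expr_div_n exprMn r2; field.
by rewrite gt_eqF.
Qed.

Lemma ge0_integral_normal_shift (R : realType) (m s b : R) (g : R -> R) :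
  s != 0 -> continuous g -> (forall x, 0 <= g x) ->
  (\int[normal_prob m s]_x (g (x + b))%:E =
   \int[normal_prob (m + b) s]_x (g x)%:E)%E.
Proof.
move=> s0 cg g0.
have cgb : continuous (fun x => g (x + b)).
  move=> x; apply: continuous_comp; last exact: cg.
  by apply: cvgD; [exact: cvg_id|exact: cvg_cst].
have mg : measurable_fun setT (fun x => (g x)%:E).
  by apply/measurable_EFinP; exact: continuous_measurable_fun.
have mgb : measurable_fun setT (fun x : R => (g (x + b))%:E).
  by apply/measurable_EFinP; exact: continuous_measurable_fun.
rewrite (ge0_integral_normal_prob m s mgb) => [|x]; last by rewrite lee_fin.
rewrite (ge0_integral_normal_prob (m + b) s mg) => [|x]; last by rewrite lee_fin.
pose F (x : R) := x + b.
have dF x : is_derive x (1 : R) F 1.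
  by rewrite /F; apply: is_derive_eq; rewrite ?addr0.
have F'E : F^`()%classic = cst 1.
  by apply/funext => x; rewrite derive1E; case: (dF x).
under [RHS]eq_integral do rewrite -EFinM.
rewrite [RHS](@increasing_ge0_integration_by_substitutionT _ F).
- apply: eq_integral => x _; rewrite F'E.
  rewrite -(normal_pdf_shift m b x s0) -EFinM; congr EFin.
  exact: (esym (mulr1 _)).
- by move=> x y xy; rewrite /F ltrD2r.
- by rewrite F'E => x; exact: cvg_cst.
- by rewrite F'E; exact: is_cvg_cst.
- by rewrite F'E; exact: is_cvg_cst.
- by move=> x; case: (dF x).
- exact: cvg_addrr_Ny.
- exact: cvg_addrr.
- move=> x; apply: cvgM; [exact: cg|exact: continuous_normal_pdf].
- by move=> x; rewrite mulr_ge0// normal_pdf_ge0.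
Qed.

(** After the exchange of the integrals, completing the square leaves a normal density in x, which
    integrates to 1. *)
Lemma ge0_integral_normal_conv (R : realType) (m s t b : R) (g : R -> R) :
  0 < s -> 0 < t -> measurable_fun setT g -> (forall x, 0 <= g x) ->
  (\int[normal_prob m s]_x \int[normal_prob (x + b)%R t]_y (g y)%:E =
   \int[normal_prob (m + b) (Num.sqrt (s ^+ 2 + t ^+ 2))]_y (g y)%:E)%E.
Proof.
move=> s0 t0 mg g0.
have mgE : measurable_fun setT (EFin \o g) by exact/measurable_EFinP.
have gE0 x : (0 <= (g x)%:E)%E by rewrite lee_fin.
have pdf0 c u x : (0 <= (normal_pdf c u x : R)%:E)%E by rewrite lee_fin normal_pdf_ge0.
have mpdf c u : measurable_fun setT (fun x : R => (normal_pdf c u x)%:E).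
  by apply/measurable_EFinP; exact: measurable_normal_pdf.
pose k (z : R * R) : \bar R :=
  ((g z.2)%:E * (normal_pdf m s z.1 * normal_pdf (z.1 + b) t z.2)%:E)%E.
have pdfE x y : normal_pdf (x + b) t y = normal_pdf 0 t (y - (x + b)).
  by rewrite -(normal_pdf_shift 0 (x + b) _ (lt0r_neq0 t0)) add0r subrK.
have k0 z : (0 <= k z)%E by rewrite mule_ge0// lee_fin mulr_ge0// normal_pdf_ge0.
have m1 : measurable_fun setT (fun z : R * R => z.1 : R) by exact: measurable_fst.
have m2 : measurable_fun setT (fun z : R * R => z.2 : R) by exact: measurable_snd.
have mpdf2 : measurable_fun setT (fun z : R * R => normal_pdf (z.1 + b) t z.2).
  under eq_fun do rewrite pdfE.
  apply: measurableT_comp; first exact: measurable_normal_pdf.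
  by apply: measurable_funB => //; exact: measurable_funD.
have mk : measurable_fun setT k.
  apply: emeasurable_funM; first exact: (measurableT_comp mgE m2).
  apply/measurable_EFinP/measurable_funM => //.
  exact: (measurableT_comp (measurable_normal_pdf m s) m1).
have inner x : (\int[normal_prob (x + b)%R t]_y (g y)%:E =
    \int[mu]_y ((g y)%:E * (normal_pdf (x + b) t y)%:E))%E.
  exact: ge0_integral_normal_prob.
transitivity (\int[mu]_x \int[mu]_y k (x, y))%E.
  under eq_integral do rewrite inner.
  rewrite ge0_integral_normal_prob.
  - apply: eq_integral => x _; rewrite -ge0_integralZr//; last 2 first.
    + exact: (emeasurable_funM mgE (mpdf _ _)).
    + by move=> y _; rewrite mule_ge0.
    by apply: eq_integral => y _; rewrite /k/= mulrC EFinM muleA.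
  - have := @measurable_fun_fubini_tonelli_F _ _ _ _ R mu
      (fun z : R * R => (g z.2)%:E * (normal_pdf (z.1 + b) t z.2)%:E)%E.
    apply.
      by apply: emeasurable_funM; [exact: (measurableT_comp mgE m2)|exact/measurable_EFinP].
    by move=> z; rewrite mule_ge0.
  - by move=> x; apply: integral_ge0 => y _; rewrite mule_ge0.
have -> : (\int[mu]_x \int[mu]_y k (x, y) = \int[mu]_y \int[mu]_x k (x, y))%E.
  exact: (@fubini_tonelli _ _ _ _ R mu mu k mk k0).
rewrite ge0_integral_normal_prob//; apply: eq_integral => y _.
rewrite /k/=; under eq_integral do rewrite normal_pdf_conv// EFinM muleA.
rewrite ge0_integralZl//.
- by rewrite integral_normal_pdf mule1.
- exact: mpdf.
- exact: mule_ge0.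
Qed.

(* [cos] integrated against N(c, s), s being the variance; the case s = 0 is
   apart because [normal_prob c 0] is not a Dirac mass. *)
Definition normal_cos (R : realType) (c s : R) : R :=
  if s == 0 then cos c else \int[normal_prob c (Num.sqrt s)]_x cos x.

Lemma rint_cos (R : realType) d (T : measurableType d) (P : probability T R)
  (f : T -> R) : measurable_fun setT f -> rint P (fun t => cos (f t)).
Proof.
move=> mf; apply: (le_rint _ _ (rint_cst P 1)); last by move=> t; exact: cos_max.
apply: measurableT_comp => //.
by apply: continuous_measurable_fun => ?; exact: continuous_cos.
Qed.

(** As 1 + cos is nonnegative, the identities for integrals of nonnegative functions transfer to the
    cosine. *)
Lemma EFin_Rintegral_1cos (R : realType) d (T : measurableType d)
    (P : probability T R) (f : T -> R) : measurable_fun setT f ->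
  (\int[P]_t (1 + cos (f t))%:E = (1 + \int[P]_t cos (f t))%:E)%E.
Proof.
move=> mf; have cf := rint_cos P mf.
rewrite -EFin_Rintegral; last by apply: rintD => //; exact: rint_cst.
by rewrite RintegralD//; [rewrite Rintegral_cst1|exact: rint_cst].
Qed.

Lemma continuous_1cos (R : realType) : continuous (fun x : R => 1 + cos x).
Proof. by move=> x; apply: cvgD; [exact: cvg_cst|exact: continuous_cos]. Qed.

Lemma cos1_ge0 (R : realType) (x : R) : 0 <= 1 + cos x.
Proof. by have := cos_geN1 x; lra. Qed.

Lemma normal_cos_shift (R : realType) (c s b : R) : 0 < s ->
  \int[normal_prob c (Num.sqrt s)]_x cos (x + b) = normal_cos (c + b) s.
Proof.
move=> s0; rewrite /normal_cos (gt_eqF s0).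
have ss0 : Num.sqrt s != 0 by rewrite gt_eqF// sqrtr_gt0.
have h := ge0_integral_normal_shift c b ss0 (@continuous_1cos R) (@cos1_ge0 R).
have mb : measurable_fun setT (fun x : R => x + b) by exact: measurable_funD.
have e1 := @EFin_Rintegral_1cos R _ _ (normal_prob c (Num.sqrt s)) _ mb.
have e2 := EFin_Rintegral_1cos (normal_prob (c + b) (Num.sqrt s)) (@measurable_id _ R setT).
have e := EFin_inj (etrans (esym e1) (etrans h e2)).
exact: (addrI _ e).
Qed.

Lemma measurable_normal_cos (R : realType) (c s : R) : 0 <= s ->
  measurable_fun setT (fun x : R => normal_cos (x + c) s).
Proof.
rewrite le_eqVlt => /predU1P[<-|s0].
  rewrite /normal_cos eqxx; apply: measurableT_comp; last exact: measurable_funD.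
  by apply: continuous_measurable_fun => ?; exact: continuous_cos.
have mcos : measurable_fun setT (fun z : R * R => cos (z.2 + (z.1 + c))).
  apply: measurableT_comp.
    by apply: continuous_measurable_fun => ?; exact: continuous_cos.
  apply: measurable_funD; first exact: measurable_snd.
  by apply: measurable_funD => //; exact: measurable_fst.
pose P : probability _ R := normal_prob 0 (Num.sqrt s).
have := @measurable_fun_fubini_tonelli_F _ _ _ _ R P
  (fun z : R * R => (1 + cos (z.2 + (z.1 + c)))%:E).
have m1cos : measurable_fun setT (fun z : R * R => (1 + cos (z.2 + (z.1 + c)))%:E).
  by apply/measurable_EFinP/measurable_funD.
move=> /(_ m1cos) mF.
have {}mF : measurable_fun setT (fun x : R => (1 + normal_cos (x + c) s)%:E).
  apply: eq_measurable_fun (mF _) => [x _|z]; last by rewrite lee_fin cos1_ge0.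
  rewrite /fubini_F/= EFin_Rintegral_1cos; last exact: measurable_funD.
  by have := @normal_cos_shift R 0 s (x + c) s0; rewrite add0r => <-.
rewrite (_ : (fun x => _) = fun x : R => (1 + normal_cos (x + c) s) - 1).
  by apply: measurable_funB => //; exact/measurable_EFinP.
by apply/funext => x; rewrite addrAC subrr add0r.
Qed.

Lemma normal_cos_bound (R : realType) (c s : R) : `|normal_cos c s| <= 1.
Proof.
rewrite /normal_cos; case: eqP => _; first exact: cos_max.
have ic := rint_cos (normal_prob c (Num.sqrt s)) (@measurable_id _ R setT).
apply: (le_trans (le_normr_Rintegral _ ic)) => //.
rewrite -[leRHS](Rintegral_cst1 (normal_prob c (Num.sqrt s)) 1).
apply: le_Rintegral => //; last by move=> x _; exact: cos_max.
- exact: (integrable_abse ic).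
- exact: rint_cst.
Qed.

(** The second variance may be 0: this covers a pair of functionals whose second member is zero. *)
Lemma normal_cos_conv (R : realType) (c b s t : R) : 0 < s -> 0 <= t ->
  \int[normal_prob c (Num.sqrt s)]_x normal_cos (x + b) t = normal_cos (c + b) (s + t).
Proof.
move=> s0 t0; have mn := measurable_normal_cos b t0.
have ni : rint (normal_prob c (Num.sqrt s)) (fun x => normal_cos (x + b) t).
  apply: (@le_rint _ _ _ _ _ (fun=> 1)) => //; last exact: rint_cst.
  by move=> x; exact: normal_cos_bound.
move: t0 mn ni; rewrite le_eqVlt => /predU1P[<- _ _|t0 mn ni].
  rewrite addr0 -normal_cos_shift//; apply: eq_Rintegral => x _.
  by rewrite /normal_cos eqxx.
have mc : measurable_fun setT (fun x : R => 1 + cos x).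
  by apply: continuous_measurable_fun; exact: continuous_1cos.
have ss0 : 0 < Num.sqrt s by rewrite sqrtr_gt0.
have st0 : 0 < Num.sqrt t by rewrite sqrtr_gt0.
have h := ge0_integral_normal_conv c b ss0 st0 mc (@cos1_ge0 R).
rewrite (sqr_sqrtr (ltW s0)) (sqr_sqrtr (ltW t0)) in h.
have e2 := EFin_Rintegral_1cos (normal_prob (c + b) (Num.sqrt (s + t)))
  (@measurable_id _ R setT).
have nt x : normal_cos x t = \int[normal_prob x (Num.sqrt t)]_x cos x.
  by rewrite /normal_cos (gt_eqF t0).
have e1 : (\int[normal_prob c (Num.sqrt s)]_x
    \int[normal_prob (x + b)%R (Num.sqrt t)]_y (1 + cos y)%:E =
    (1 + \int[normal_prob c (Num.sqrt s)]_x normal_cos (x + b) t)%:E)%E.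
  rewrite -[X in (X + _)%:E](Rintegral_cst1 (normal_prob c (Num.sqrt s)) 1).
  rewrite -(RintegralD measurableT (rint_cst _ 1) ni).
  rewrite (EFin_Rintegral (rintD (rint_cst _ 1) ni)).
  apply: eq_integral => x _ /=; rewrite nt.
  exact: (EFin_Rintegral_1cos (normal_prob (x + b) (Num.sqrt t)) (@measurable_id _ R setT)).
have e := EFin_inj (etrans (esym e1) (etrans h e2)).
by rewrite {2}/normal_cos (gt_eqF (addr_gt0 s0 t0)); exact: (addrI _ e).
Qed.

(** * Image measures and independent copies *)

Section law.
Context d1 d2 (T1 : measurableType d1) (T2 : measurableType d2) (R : realType).
Implicit Types (P : probability T1 R) (Q : probability T2 R) (phi : T1 -> T2).

Definition has_law P phi Q := measurable_fun setT phi /\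
  forall A, measurable A -> P (phi @^-1` A) = Q A.

Lemma ge0_integral_law P phi Q (f : T2 -> \bar R) : has_law P phi Q ->
  measurable_fun setT f -> (forall x, 0 <= f x)%E ->
  (\int[P]_x f (phi x) = \int[Q]_y f y)%E.
Proof.
move=> [mphi law] mf f0.
have := ge0_integral_pushforward mphi P measurableT mf (fun x _ => f0 x).
rewrite preimage_setT => <-; apply: eq_measure_integral => A mA _; exact: law.
Qed.

Lemma rint_law P phi Q (f : T2 -> R) : has_law P phi Q ->
  rint Q f -> rint P (fun x => f (phi x)).
Proof.
move=> law fi; have mf := rint_measurable fi.
move/integrableP : (fi) => [_ fy]; apply/integrableP; split.
  by apply/measurable_EFinP; apply: measurableT_comp => //; case: law.
rewrite (ge0_integral_law (f := fun x => `|(f x)%:E|%E) law)//.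
exact/measurable_EFinP/measurableT_comp.
Qed.

Lemma Rintegral_law P phi Q (f : T2 -> R) : has_law P phi Q ->
  rint Q f -> \int[P]_x f (phi x) = \int[Q]_y f y.
Proof.
move=> law fi; have mf := rint_measurable fi; have f1 := rint_law law fi.
have [mphi lw] := law.
have mfE : measurable_fun setT (EFin \o f) by exact/measurable_EFinP.
have := @integral_pushforward _ _ _ _ _ phi mphi P setT (EFin \o f) mfE.
rewrite preimage_setT => /(_ f1 measurableT) e; rewrite /Rintegral; congr fine.
rewrite -e; apply: eq_measure_integral => A mA _; exact: lw.
Qed.

Lemma sqint_law P phi Q (f : T2 -> R) : has_law P phi Q ->
  sqint Q f -> sqint P (fun x => f (phi x)).
Proof.
move=> law [mf fi]; split; last exact: (rint_law law fi).
by apply: measurableT_comp => //; case: law.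
Qed.

End law.

Section product_law.
Context d1 d2 (T1 : measurableType d1) (T2 : measurableType d2) (R : realType).
Variables (P1 : probability T1 R) (P2 : probability T2 R).

Definition prodP : probability (T1 * T2)%type R := (P1 \x P2)%E.

Lemma fst_law : has_law prodP fst P1.
Proof.
split=> [|A mA]; first exact: measurable_fst.
rewrite (_ : fst @^-1` A = A `*` setT); last by apply/seteqP; split => z //= [].
by rewrite /prodP/= product_measure1E// [X in (_ * X)%E]probability_setT mule1.
Qed.

Lemma Rintegral_prodP (f : T1 * T2 -> R) : rint prodP f ->
  \int[prodP]_z f z = fine (\int[P1]_x \int[P2]_y (f (x, y))%:E)%E.
Proof. by move=> fi; rewrite /Rintegral -integral12_prod_meas1. Qed.

End product_law.

(** This is [cramer_wold] for [P] and its image under [phi]. *)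
Lemma law_of_cos d (T : measurableType d) (R : realType) (P : probability T R)
    (phi : T -> T) (I : finType) (X : I -> T -> R) :
  measurable_fun setT phi -> (forall i, measurable_fun setT (X i)) ->
  (forall (c : I -> R) b, \int[P]_t cos (\sum_i c i * X i (phi t) + b) =
     \int[P]_t cos (\sum_i c i * X i t + b)) ->
  @measurable _ T `<=` <<s [set B | exists i a, B = [set t | a < X i t]] >> ->
  has_law P phi P.
Proof.
move=> mphi mX cosE gen; split => // A mA.
pose f : {mfun T >-> T} := MeasurableFun.Pack (MeasurableFun.Class
  (isMeasurableFun.Build _ _ _ _ _ mphi)).
apply/esym; apply: (@cramer_wold _ _ _ P (distribution P f) _ X mX _ A (gen _ mA)).
move=> c b; rewrite -cosE.
have flaw : has_law P phi (distribution P f) by split.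
have mlin : measurable_fun setT (fun t => \sum_i c i * X i t + b).
  apply: measurable_funD => //.
  by apply: measurable_sum => i; apply: measurable_funM.
exact: (Rintegral_law flaw (rint_cos _ mlin)).
Qed.

Section gaussian_law.
Context (R : realType) (d : nat) (nu : probability (Borel 'cV[R]_d) R).
Variables (m0 : 'cV[R]_d) (C : 'M[R]_d).
Hypotheses (nuG : gaussian nu m0 C) (Cspd : spd C).

Lemma dot_measurable (a : 'cV[R]_d) :
  measurable_fun setT (fun m : Borel 'cV[R]_d => (a^T *m (m : 'cV[R]_d)) 0 0).
Proof.
under eq_fun do rewrite mxE.
apply: measurable_sum => j; apply: measurable_funM => //; exact: measurable_coord.
Qed.

Lemma gaussian_has_law (a : 'cV[R]_d) : a != 0 ->
  @has_law _ _ _ (measurableTypeR R) _ nu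
    (fun m : Borel 'cV[R]_d => (a^T *m (m : 'cV[R]_d)) 0 0)
    (normal_prob ((a^T *m m0) 0 0) (Num.sqrt ((a^T *m C *m a) 0 0))).
Proof.
move=> a0; split; first exact: dot_measurable.
by move=> B mB; exact: (nuG a0 mB).
Qed.

Lemma gaussian_cos (a : 'cV[R]_d) (b : R) :
  \int[nu]_m cos ((a^T *m (m : 'cV[R]_d)) 0 0 + b) =
  normal_cos ((a^T *m m0) 0 0 + b) ((a^T *m C *m a) 0 0).
Proof.
have [->|a0] := eqVneq a 0.
  under eq_Rintegral do rewrite trmx0 mul0mx mxE add0r.
  by rewrite Rintegral_cst1 !trmx0 !mul0mx /normal_cos !mxE eqxx add0r.
have s0 : 0 < (a^T *m C *m a) 0 0 by exact: Cspd.2.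
rewrite -(normal_cos_shift _ _ s0).
have mb : measurable_fun setT (fun x : R => x + b) by exact: measurable_funD.
have h := @Rintegral_law _ _ _ (measurableTypeR R) _ _ _ _
  (fun x => cos ((x : R) + b)) (gaussian_has_law a0).
by apply: h; exact: rint_cos.
Qed.

(** The value depends on a and b only through the total mean and the total variance, so an exchange
    that preserves both preserves all cosine integrals. *)
Lemma gaussian_pair_cos (a b : 'cV[R]_d) (c : R) :
  \int[prodP nu nu]_z cos ((a^T *m (z.1 : 'cV[R]_d)) 0 0 +
     (b^T *m (z.2 : 'cV[R]_d)) 0 0 + c) =
  normal_cos ((a^T *m m0) 0 0 + (b^T *m m0) 0 0 + c)
    ((a^T *m C *m a) 0 0 + (b^T *m C *m b) 0 0).
Proof.
have bCb : 0 <= (b^T *m C *m b) 0 0.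
  have [->|b0] := eqVneq b 0; first by rewrite mulmx0 mxE.
  by apply/ltW/Cspd.2.
have m1 := measurableT_comp (dot_measurable a) (@measurable_fst _ _ (Borel 'cV[R]_d) (Borel 'cV[R]_d)).
have m2 := measurableT_comp (dot_measurable b) (@measurable_snd _ _ (Borel 'cV[R]_d) (Borel 'cV[R]_d)).
have mab := measurable_funD (measurable_funD m1 m2) (@measurable_cst _ _ _ _ setT c).
pose h (x : R) := normal_cos (x + ((b^T *m m0) 0 0 + c)) ((b^T *m C *m b) 0 0).
have inner x : (\int[nu]_y (cos ((a^T *m (x : 'cV[R]_d)) 0 0 +
     (b^T *m (y : 'cV[R]_d)) 0 0 + c))%:E = (h ((a^T *m x) 0 0))%:E)%E.
  have mb : measurable_fun setT (fun y : Borel 'cV[R]_d =>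
      (b^T *m (y : 'cV[R]_d)) 0 0 + ((a^T *m x) 0 0 + c)).
    by apply: measurable_funD => //; exact: dot_measurable.
  rewrite /h [_ + (_ + c)]addrCA -gaussian_cos (EFin_Rintegral (rint_cos nu mb)).
  by apply: eq_integral => y _; rewrite addrCA addrA.
transitivity (\int[nu]_x h ((a^T *m (x : 'cV[R]_d)) 0 0)).
  apply: etrans (Rintegral_prodP (rint_cos (prodP nu nu) mab)) _.
  by congr fine; apply: eq_integral => x _; exact: inner.
have [->|a0] := eqVneq a 0.
  under eq_Rintegral do rewrite trmx0 mul0mx mxE.
  rewrite Rintegral_cst1 /h.
  have z0 (x : 'cV[R]_d) : ((0 : 'cV[R]_d)^T *m x) 0 0 = 0 by rewrite trmx0 mul0mx mxE.
  rewrite z0 add0r.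
  have -> : ((0 : 'cV[R]_d)^T *m C *m (0 : 'cV[R]_d)) 0 0 = 0.
    by rewrite trmx0 !mul0mx mxE.
  by rewrite !add0r.
have s0 : 0 < (a^T *m C *m a) 0 0 by exact: Cspd.2.
rewrite -addrA -(normal_cos_conv _ _ s0 bCb).
have mh : measurable_fun setT h by exact: measurable_normal_cos.
pose N : probability _ R := normal_prob ((a^T *m m0) 0 0) (Num.sqrt ((a^T *m C *m a) 0 0)).
have hi : rint N h.
  apply: (@le_rint _ _ _ _ _ (fun=> 1)) => //; last exact: rint_cst.
  by move=> x; exact: normal_cos_bound.
exact: (@Rintegral_law _ _ _ (measurableTypeR R) _ _ _ _ h (gaussian_has_law a0) hi).
Qed.

(* Exchanges the [Q]-components of two independent copies. *)
Definition swap (Q : 'M[R]_d) (z : Borel 'cV[R]_d * Borel 'cV[R]_d) :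
    Borel 'cV[R]_d * Borel 'cV[R]_d :=
  let x : 'cV[R]_d := z.1 in let y : 'cV[R]_d := z.2 in
  (x + Q *m (y - x), y - Q *m (y - x)).

(* The commutation says that [Q] is self-adjoint for the inner product of
   [C^-1], so that both sides have the same cosine integrals. *)
Lemma gaussian_swap (Q : 'M[R]_d) : Q *m Q = Q -> Q *m C = C *m Q^T ->
  has_law (prodP nu nu) (swap Q) (prodP nu nu).
Proof.
move=> QQ QC.
pose X (i : 'I_d + 'I_d) (z : Borel 'cV[R]_d * Borel 'cV[R]_d) : R :=
  match i with inl k => (z.1 : 'cV[R]_d) k 0 | inr k => (z.2 : 'cV[R]_d) k 0 end.
have mX i : measurable_fun setT (X i).
  case: i => k.
    exact: (measurableT_comp (measurable_coord k) measurable_fst).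
  exact: (measurableT_comp (measurable_coord k) measurable_snd).
apply: (@law_of_cos _ _ _ _ _ _ X) => //; last exact: prod_Borel_generated.
  have m1 k : measurable_fun setT (fun z : Borel 'cV[R]_d * Borel 'cV[R]_d =>
      (z.1 : 'cV[R]_d) k 0) by exact: (mX (inl k)).
  have m2 k : measurable_fun setT (fun z : Borel 'cV[R]_d * Borel 'cV[R]_d =>
      (z.2 : 'cV[R]_d) k 0) by exact: (mX (inr k)).
  have mQ i : measurable_fun setT (fun z : Borel 'cV[R]_d * Borel 'cV[R]_d =>
      (Q *m ((z.2 : 'cV[R]_d) - z.1)) i 0).
    under eq_fun do rewrite mxE.
    apply: measurable_sum => k; apply: measurable_funM => //.
    by under eq_fun do rewrite !mxE; exact: measurable_funB.
  apply/measurable_fun_pairP; split; apply: measurable_fun_Borel => i.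
    under eq_fun do rewrite mxE; exact: measurable_funD.
  under eq_fun do rewrite mxE [X in _ + X]mxE; exact: measurable_funB.
move=> c b.
pose a1 := \col_k c (inl k); pose a2 := \col_k c (inr k).
have linE z : \sum_i c i * X i z + b = (a1^T *m z.1) 0 0 + (a2^T *m z.2) 0 0 + b.
  rewrite big_sumType !mxE; congr (_ + _ + _); apply: eq_bigr => k _; by rewrite !mxE.
(* The adjoint action of the exchange: the functionals (a1, a2) of the exchanged pair are (a1 + w,
   a2 - w) of the pair itself. Their sum, hence the total mean, does not change. *)
pose w := Q^T *m (a2 - a1).
have add00 (x y : 'M[R]_1) : x 0 0 + y 0 0 = (x + y) 0 0 by rewrite mxE.
have swapE (z : 'cV[R]_d * 'cV[R]_d) : (a1^T *m (swap Q z).1) 0 0 + (a2^T *m (swap Q z).2) 0 0 =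
   ((a1 + w)^T *m z.1) 0 0 + ((a2 - w)^T *m z.2) 0 0.
  rewrite !add00; congr (fun_of_matrix _ 0 0); rewrite /swap/=.
  set x := z.1; set y := z.2; set u := Q *m (y - x).
  have wu : w^T *m (y - x) = (a2 - a1)^T *m u by rewrite /w trmx_mul trmxK /u mulmxA.
  rewrite mulmxBr [(a2 - a1)^T]raddfB/= mulmxBl in wu.
  rewrite mulmxDr mulmxBr [(a1 + w)^T]raddfD [(a2 - w)^T]raddfB/= mulmxDl mulmxBl.
  rewrite addrACA [RHS]addrACA; congr (_ + _).
  by have := congr1 -%R wu; rewrite !opprB => ->.
transitivity (\int[prodP nu nu]_z cos (((a1 + w)^T *m (z.1 : 'cV[R]_d)) 0 0 +
     ((a2 - w)^T *m (z.2 : 'cV[R]_d)) 0 0 + b)).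
  by apply: eq_Rintegral => z _; rewrite linE swapE.
transitivity (\int[prodP nu nu]_z cos ((a1^T *m (z.1 : 'cV[R]_d)) 0 0 +
     (a2^T *m (z.2 : 'cV[R]_d)) 0 0 + b)); last first.
  by apply: eq_Rintegral => z _; rewrite linE.
rewrite (gaussian_pair_cos (a1 + w) (a2 - w) b) (gaussian_pair_cos a1 a2 b).
apply: (f_equal2 (@normal_cos R)).
  congr (_ + _); rewrite !add00; congr (fun_of_matrix _ 0 0).
  by rewrite -!mulmxDl -!raddfD/= addrACA subrr addr0.
pose B (x y : 'cV[R]_d) := (x^T *m C *m y) 0 0.
have BD x y z : B (x + y) z = B x z + B y z.
  by rewrite /B [(x + y)^T]raddfD/= !mulmxDl mxE.
have BN x z : B (- x) z = - B x z by rewrite /B [(- x)^T]raddfN/= !mulNmx mxE.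
have BC x y : B x y = B y x.
  rewrite /B (_ : x^T *m C *m y = (y^T *m C *m x)^T) ?mxE//.
  by rewrite !trmx_mul trmxK Cspd.1 mulmxA.
(* Idempotence and commutation with [C] make w the orthogonal projection of a2 - a1 for the form
   [B], so the change 2 B(w, w) - 2 B(a2 - a1, w) of the total variance is 0. *)
have Bww : B w w = B (a2 - a1) w.
  congr (fun_of_matrix _ 0 0); rewrite /w trmx_mul trmxK.
  by rewrite -!mulmxA (mulmxA C) -QC !mulmxA -(mulmxA _ Q Q) QQ.
rewrite -/(B _ _) -/(B (a2 - w) _) -/(B a1 _) -/(B a2 _).
rewrite !BD !BN ![B _ (_ + _)]BC !BD !BN.
rewrite [B w a1]BC [B w a2]BC.
move: Bww; rewrite BD BN; lra.
Qed.

End gaussian_law.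

(** * Changing one coordinate *)

Section direction.
Context (R : realType) (d : nat) (nu : probability (Borel 'cV[R]_d) R).
Variables (m0 : 'cV[R]_d) (C : 'M[R]_d).
Hypotheses (nuG : gaussian nu m0 C) (Cspd : spd C).
Variables (v a : 'cV[R]_d).
Hypotheses (Cav : C *m a = v) (av : a^T *m v = 1%:M).

(** The coordinate of m along v. Since a = C^-1 v and v is a unit vector for C^-1, its variance a^T
    C a is 1, whence the law [gam]. *)
Let xi (m : 'cV[R]_d) : R := (a^T *m m) 0 0.
Let Q : 'M[R]_d := v *m a^T.
Let gam : probability (measurableTypeR R) R := normal_prob (xi m0) 1.

Lemma direction_proj : Q *m Q = Q.
Proof. by rewrite /Q mulmxA -(mulmxA v) av mulmx1. Qed.

Lemma direction_selfadjoint : Q *m C = C *m Q^T.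
Proof. by rewrite /Q -Cav trmx_mul trmxK trmx_mul Cspd.1 !mulmxA. Qed.

Let QE (m : 'cV[R]_d) : Q *m m = xi m *: v.
Proof. by rewrite /Q -mulmxA [a^T *m m]mx11_scalar mul_mx_scalar. Qed.

Let a0 : a != 0.
Proof.
apply/eqP => a0; have := av; rewrite a0 trmx0 mul0mx => /matrixP/(_ 0 0).
by rewrite !mxE eqxx => /eqP; rewrite eq_sym oner_eq0.
Qed.

Let xi_law : @has_law _ _ _ (measurableTypeR R) _ nu xi gam.
Proof.
have s1 : (a^T *m C *m a) 0 0 = 1 by rewrite -mulmxA Cav av mxE eqxx.
by have := gaussian_has_law nuG a0; rewrite s1 sqrtr1.
Qed.

Let line (m : 'cV[R]_d) (s : R) : 'cV[R]_d := m + (s - xi m) *: v.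

Let mline_pair : measurable_fun setT
  (fun z : Borel 'cV[R]_d * measurableTypeR R => line z.1 z.2 : Borel 'cV[R]_d).
Proof.
apply: measurable_fun_Borel => i; under eq_fun do rewrite mxE [X in _ + X]mxE.
have m1 : measurable_fun setT (fun z : Borel 'cV[R]_d * measurableTypeR R =>
    (z.1 : 'cV[R]_d) i 0).
  exact: (measurableT_comp (measurable_coord i) measurable_fst).
have m2 : measurable_fun setT (fun z : Borel 'cV[R]_d * measurableTypeR R => xi z.1).
  exact: (measurableT_comp (dot_measurable a) measurable_fst).
have m3 : measurable_fun setT (fun z : Borel 'cV[R]_d * measurableTypeR R => z.2 : R).
  exact: measurable_snd.
by apply: measurable_funD => //; apply: measurable_funM => //; exact: measurable_funB.
Qed.

Let mline m : measurable_fun setT (fun s : measurableTypeR R => line m s : Borel 'cV[R]_d).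
Proof. exact: (measurableT_comp mline_pair (@pair1_measurable _ _ (Borel 'cV[R]_d) (measurableTypeR R) m)). Qed.

Let lineline m s t : line (line m s) t = line m t.
Proof.
rewrite /line; have -> : xi (m + (s - xi m) *: v) = s.
  rewrite /xi mulmxDr -scalemxAr av mxE [X in _ + X]mxE [1%:M _ _]mxE eqxx mulr1.
  by rewrite addrC subrK.
rewrite -addrA -scalerDl; congr (_ + _ *: _).
by rewrite addrC addrA subrK.
Qed.

(** A disintegration of nu along v that comes from the exchange alone: for independent m and m', the
    first component of the exchanged pair is [line m (xi m')]; it has law nu and involves m' only
    through [xi m']. *)
Lemma ge0_integral_line (h : Borel 'cV[R]_d -> \bar R) :
  measurable_fun setT h -> (forall x, 0 <= h x)%E ->
  (\int[nu]_m h m = \int[nu]_m \int[gam]_s h (line m s))%E.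
Proof.
move=> mh h0.
have Slaw := gaussian_swap nuG Cspd direction_proj direction_selfadjoint.
have mh1 : measurable_fun setT (fun z : Borel 'cV[R]_d * Borel 'cV[R]_d => h z.1).
  exact: (measurableT_comp mh measurable_fst).
have e1 := ge0_integral_law (fst_law nu nu) mh h0.
have e2 := ge0_integral_law Slaw mh1 (fun z => h0 z.1).
apply: etrans (esym e1) _; apply: etrans (esym e2) _.
have [mS _] := Slaw.
have mhS := measurableT_comp mh1 mS.
apply: etrans (fubini_tonelli1 _ mhS _) _; first by move=> z; exact: h0.
apply: eq_integral => m _; rewrite /fubini_F.
have mhl : measurable_fun setT (fun s => h (line m s)).
  exact: (measurableT_comp mh (mline m)).
apply: etrans _ (@ge0_integral_law _ _ _ (measurableTypeR R) _ _ _ _ _ xi_law mhl _); last first.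
  by move=> s; exact: h0.
apply: eq_integral => m' _; rewrite /comp/= QE /line; congr (h (_ + _)).
by rewrite /xi mulmxBr mxE [X in _ + X]mxE.
Qed.

(** Both sides are averaged over the line through m by [ge0_integral_line]. All the points of this
    line give the same line, so the left-hand side becomes a double integral over it and
    [normal_variance_le] applies for each m. *)
Lemma swap_variance_le (f g : Borel 'cV[R]_d -> R) :
  measurable_fun setT f -> measurable_fun setT g ->
  (forall m (t : R), is_derive t (1 : R) (fun s : R => f (m + s *: v)) (g (m + t *: v))) ->
  (\int[prodP nu nu]_z ((f z.1 - f (swap Q z).1) ^+ 2)%:E <=
   2%:E * \int[nu]_m (g m ^+ 2)%:E)%E.
Proof.
move=> mf mg df.
pose Psi m := (\int[gam]_t ((f m - f (line m t)) ^+ 2)%:E)%E.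
pose k (z : Borel 'cV[R]_d * measurableTypeR R) : \bar R :=
  ((f z.1 - f (line z.1 z.2)) ^+ 2)%:E.
have mk : measurable_fun setT k.
  apply/measurable_EFinP/measurable_funX/measurable_funB.
    exact: (measurableT_comp mf measurable_fst).
  exact: (measurableT_comp mf mline_pair).
have k0 z : (0 <= k z)%E by rewrite lee_fin sqr_ge0.
have mPsi : measurable_fun setT Psi.
  exact: (@measurable_fun_fubini_tonelli_F _ _ _ _ _ gam k mk k0).
have Psi0 m : (0 <= Psi m)%E by apply: integral_ge0 => t _; exact: (k0 (m, t)).
have -> : (\int[prodP nu nu]_z ((f z.1 - f (swap Q z).1) ^+ 2)%:E = \int[nu]_m Psi m)%E.
  have [mS _] := gaussian_swap nuG Cspd direction_proj direction_selfadjoint.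
  have mfS : measurable_fun setT (fun z => ((f z.1 - f (swap Q z).1) ^+ 2)%:E).
    apply/measurable_EFinP/measurable_funX/measurable_funB.
      exact: (measurableT_comp mf measurable_fst).
    exact: (measurableT_comp mf (measurableT_comp measurable_fst mS)).
  apply: etrans (fubini_tonelli1 _ mfS _) _; first by move=> z; rewrite lee_fin sqr_ge0.
  apply: eq_integral => m _; rewrite /fubini_F.
  have mkm : measurable_fun setT (fun t => k (m, t)).
    exact: (measurableT_comp mk (@pair1_measurable _ _ (Borel 'cV[R]_d) (measurableTypeR R) m)).
  apply: etrans _ (@ge0_integral_law _ _ _ (measurableTypeR R) _ _ _ _ _ xi_law mkm _); last first.
    by move=> s; exact: k0.
  apply: eq_integral => m' _; rewrite /k/= QE /line; congr (((_ - f (_ + _)) ^+ 2)%:E).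
  by rewrite /xi mulmxBr mxE [X in _ + X]mxE.
have mg2 : measurable_fun setT (fun m => (g m ^+ 2)%:E).
  by apply/measurable_EFinP/measurable_funX.
have g20 m : (0 <= (g m ^+ 2)%:E)%E by rewrite lee_fin sqr_ge0.
rewrite (ge0_integral_line mPsi Psi0) (ge0_integral_line mg2 g20).
have mPl : measurable_fun setT (fun z : Borel 'cV[R]_d * measurableTypeR R =>
    Psi (line z.1 z.2)) by exact: (measurableT_comp mPsi mline_pair).
have mgl : measurable_fun setT (fun z : Borel 'cV[R]_d * measurableTypeR R =>
    (g (line z.1 z.2) ^+ 2)%:E) by exact: (measurableT_comp mg2 mline_pair).
have mF1 := @measurable_fun_fubini_tonelli_F _ _ _ _ _ gam _ mPl (fun z => Psi0 _).
have mF2 := @measurable_fun_fubini_tonelli_F _ _ _ _ _ gam _ mgl (fun z => g20 _).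
have F20 m : (0 <= \int[gam]_s (g (line m s) ^+ 2)%:E)%E.
  by apply: integral_ge0 => s _; exact: g20.
rewrite -(@ge0_integralZl _ _ _ nu setT measurableT _ mF2) ?lee_fin//; last first.
  by move=> m _; exact: F20.
apply: ge0_le_integral => //.
- by move=> m _; apply: integral_ge0.
- exact: measurable_funeM.
move=> m _; rewrite /fubini_F/=.
pose w : 'cV[R]_d := (m : 'cV[R]_d) - xi m *: v.
have lineE s : line m s = w + s *: v.
  by rewrite /line /w scalerBl addrA addrAC.
have mgs : measurable_fun setT (fun s : R => g (line m s)).
  exact: (measurableT_comp mg (mline m)).
have dF (s : R) : is_derive s (1 : R) (fun s : R => f (line m s)) (g (line m s)).
  by under eq_fun do rewrite lineE; rewrite lineE; exact: df.
apply: le_trans (normal_variance_le (xi m0) dF mgs).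
rewrite le_eqVlt; apply/orP; left; apply/eqP.
apply: eq_integral => s _; apply: eq_integral => t _.
by rewrite lineline.
Qed.

End direction.

(** * Conditional expectation *)

Section weighted_preimage.
Context d d' (T : measurableType d) (U : measurableType d') (R : realType).
Variables (P : probability T R) (phi : T -> U).
Hypothesis mphi : measurable_fun setT phi.
Import HBNNSimple.

Let simple_integral (p : T -> R) (g : {nnsfun U >-> R}) :
  measurable_fun setT p -> (forall x, 0 <= p x) ->
  (\int[P]_x ((g (phi x))%:E * (p x)%:E) =
   \sum_(y \in range g) y%:E * \int[P]_(x in phi @^-1` (g @^-1` [set y])) (p x)%:E)%E.
Proof.
move=> mp p0.
have mgy y : measurable (g @^-1` [set y]).
  by rewrite -[X in measurable X]setTI; exact: measurable_funP.
have mphigy y : measurable (phi @^-1` (g @^-1` [set y])).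
  by rewrite -[X in measurable X]setTI; exact: mphi.
have m1 (A : set T) : measurable A -> measurable_fun setT (fun x : T => (\1_A x : R)%:E).
  by move=> mA; apply/measurable_EFinP; exact: measurable_indic.
have mpE : measurable_fun setT (EFin \o p) by exact/measurable_EFinP.
transitivity (\int[P]_x \sum_(y \in range g)
    ((y * \1_(g @^-1` [set y]) (phi x))%:E * (p x)%:E))%E.
  apply: eq_integral => x _; rewrite {1}(fimfunE g) -fsumEFin// ge0_mule_fsuml//.
  by move=> y; exact: nnfun_muleindic_ge0.
rewrite ge0_integral_fsum//; last 2 first.
- move=> y; apply: emeasurable_funM => //; apply/measurable_EFinP/measurable_funM => //.
  exact: (measurable_indic (mphigy y)).
- move=> y x _; apply: mule_ge0; last by rewrite lee_fin.
  exact: nnfun_muleindic_ge0.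
apply: eq_fsbigr => y /set_mem[z _ <-].
rewrite (integral_mkcond (phi @^-1` _)) -ge0_integralZl//; last 3 first.
- by apply/(measurable_restrictT _ (mphigy _)).1; exact: measurable_funTS.
- by move=> x _; rewrite erestrict_ge0// => ? _; rewrite lee_fin.
- by rewrite lee_fin.
apply: eq_integral => x _; rewrite patchE EFinM -muleA; congr (_ * _)%E.
have -> : (\1_(g @^-1` [set g z]) (phi x) : R) = (x \in phi @^-1` (g @^-1` [set g z]))%:R.
  by rewrite indicE.
by case: ifPn => _; rewrite ?mul1e ?mul0e.
Qed.

Lemma ge0_integral_same_preimage (p q : T -> R) (k : U -> R) :
  measurable_fun setT p -> (forall x, 0 <= p x) ->
  measurable_fun setT q -> (forall x, 0 <= q x) ->
  (forall B, measurable B -> (\int[P]_(x in phi @^-1` B) (p x)%:E =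
     \int[P]_(x in phi @^-1` B) (q x)%:E)%E) ->
  measurable_fun setT k -> (forall u, 0 <= k u) ->
  (\int[P]_x (k (phi x) * p x)%:E = \int[P]_x (k (phi x) * q x)%:E)%E.
Proof.
move=> mp p0 mq q0 pq mk k0.
have mkE : measurable_fun setT (EFin \o k) by exact/measurable_EFinP.
pose g := nnsfun_approx measurableT mkE.
have lim (r : T -> R) : measurable_fun setT r -> (forall x, 0 <= r x) ->
    (\int[P]_x (k (phi x) * r x)%:E =
     lim (\int[P]_x ((g n (phi x))%:E * (r x)%:E) @[n --> \oo]))%E.
  move=> mr r0.
  have krE x : ((k (phi x) * r x)%:E = lim ((g n (phi x))%:E * (r x)%:E @[n --> \oo]))%E.
    apply/esym/cvg_lim => //; rewrite EFinM; apply: cvgeZr => //.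
    by apply: (cvg_nnsfun_approx measurableT mkE) => // u _; rewrite lee_fin.
  under eq_integral do rewrite krE.
  apply: monotone_convergence => //.
  - move=> n; apply: emeasurable_funM; last exact/measurable_EFinP.
    by apply/measurable_EFinP; exact: measurableT_comp.
  - by move=> n x _; rewrite mule_ge0 ?lee_fin.
  - move=> x _ m n mn; rewrite lee_wpmul2r ?lee_fin//.
    exact/lefP/nd_nnsfun_approx.
rewrite (lim p mp p0) (lim q mq q0); congr (limn _); apply/funext => n.
rewrite !simple_integral//; apply: eq_fsbigr => y _.
by rewrite pq// -[X in measurable X]setTI; exact: measurable_funP.
Qed.

(** The hypothesis says that the positive and negative parts of [a] have equal integrals over
    preimages; [ge0_integral_same_preimage] is applied to this pair with each of the two parts of
    [k] as weight. *)
Lemma Rintegral_mul_preimage (a : T -> R) (k : U -> R) :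
  rint P a -> (forall B, measurable B -> (\int[P]_(x in phi @^-1` B) (a x)%:E = 0)%E) ->
  measurable_fun setT k -> rint P (fun x => k (phi x) * a x) ->
  \int[P]_x (k (phi x) * a x) = 0.
Proof.
move=> ai a0 mk kai; have ma := rint_measurable ai.
pose ap x := (`|a x| + a x) / 2; pose am x := (`|a x| - a x) / 2.
pose kp u := (`|k u| + k u) / 2; pose km u := (`|k u| - k u) / 2.
have pm (y : R) : [/\ 0 <= (`|y| + y) / 2, 0 <= (`|y| - y) / 2,
    (`|y| + y) / 2 <= `|y| & (`|y| - y) / 2 <= `|y|].
  by split; have := ler_norm y; have := ler_norm (- y); rewrite normrN; lra.
have mna : measurable_fun setT (fun x => `|a x|) by exact: measurableT_comp.
have mnk : measurable_fun setT (fun x => `|k x|) by exact: measurableT_comp.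
have map_ : measurable_fun setT ap.
  by apply: measurable_funM => //; exact: measurable_funD.
have mam : measurable_fun setT am.
  by apply: measurable_funM => //; exact: measurable_funB.
have mkp : measurable_fun setT kp.
  by apply: measurable_funM => //; exact: measurable_funD.
have mkm : measurable_fun setT km.
  by apply: measurable_funM => //; exact: measurable_funB.
have ani : rint P (fun x => `|a x|) by exact: (integrable_abse ai).
have api : rint P ap.
  by apply: (le_rint map_ _ ani) => x; have [h0 _ h1 _] := pm (a x); rewrite ger0_norm.
have ami : rint P am.
  by apply: (le_rint mam _ ani) => x; have [_ h0 _ h1] := pm (a x); rewrite ger0_norm.
have eqpm B : measurable B -> (\int[P]_(x in phi @^-1` B) (ap x)%:E =
    \int[P]_(x in phi @^-1` B) (am x)%:E)%E.
  move=> mB; have mA : measurable (phi @^-1` B).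
    by rewrite -[X in measurable X]setTI; exact: mphi.
  have iS r : rint P r -> P.-integrable (phi @^-1` B) (EFin \o r).
    by move=> ri; exact: (integrableS measurableT).
  have := a0 B mB.
  rewrite (_ : (\int[P]_(x in phi @^-1` B) (a x)%:E =
      \int[P]_(x in phi @^-1` B) ((ap x)%:E - (am x)%:E))%E); last first.
    by apply: eq_integral => x _; rewrite -EFinB; congr EFin; rewrite /ap /am; field.
  rewrite (integralB mA (iS _ api) (iS _ ami)) => /eqP.
  rewrite sube_eq ?add0e; first by move/eqP.
    exact: integrable_fin_num (iS _ api).
  exact/fin_num_adde_defl/(integrable_fin_num mA (iS _ ami)).
have kanp : rint P (fun x => `|k (phi x) * a x|) by exact: (integrable_abse kai).
have part (k' : U -> R) (a' : T -> R) : measurable_fun setT k' -> measurable_fun setT a' ->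
    (forall u, 0 <= k' u <= `|k u|) -> (forall x, 0 <= a' x <= `|a x|) ->
    rint P (fun x => k' (phi x) * a' x).
  move=> mk' ma' k'k a'a; apply: (le_rint _ _ kanp).
    by apply: measurable_funM => //; exact: measurableT_comp.
  move=> x; have /andP[k'0 k'1] := k'k (phi x); have /andP[a'0 a'1] := a'a x.
  by rewrite ger0_norm ?mulr_ge0// normrM ler_pM.
have bkp u : 0 <= kp u <= `|k u| by have [-> _ -> _] := pm (k u).
have bkm u : 0 <= km u <= `|k u| by have [_ -> _ ->] := pm (k u).
have bap x : 0 <= ap x <= `|a x| by have [-> _ -> _] := pm (a x).
have bam x : 0 <= am x <= `|a x| by have [_ -> _ ->] := pm (a x).
have same (k' : U -> R) : measurable_fun setT k' -> (forall u, 0 <= k' u <= `|k u|) ->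
    \int[P]_x (k' (phi x) * ap x) = \int[P]_x (k' (phi x) * am x).
  move=> mk' bk'; congr fine; apply: ge0_integral_same_preimage => //.
  - by move=> x; case/andP: (bap x).
  - by move=> x; case/andP: (bam x).
  - by move=> u; case/andP: (bk' u).
rewrite (_ : \int[P]_x _ = \int[P]_x ((kp (phi x) * ap x - kp (phi x) * am x) -
    (km (phi x) * ap x - km (phi x) * am x))); last first.
  by apply: eq_Rintegral => x _; rewrite /ap /am /kp /km; field.
have i1 := part kp ap mkp map_ bkp bap; have i2 := part kp am mkp mam bkp bam.
have i3 := part km ap mkm map_ bkm bap; have i4 := part km am mkm mam bkm bam.
rewrite (RintegralB measurableT (rintB i1 i2) (rintB i3 i4)).
rewrite (RintegralB measurableT i1 i2) (RintegralB measurableT i3 i4).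
by rewrite !same// !subrr.
Qed.

End weighted_preimage.

Section conditional.
Context d (T : measurableType d) (R : realType) (P : probability T R).
Variable G : set_system T.
Hypotheses (Gsigma : sigma_algebra setT G) (GT : G `<=` measurable).

Definition sub_measurable (h : T -> R) :=
  forall B : set R, measurable B -> G (h @^-1` B).

Let U := g_sigma_algebraType G.

Let GU (A : set U) : measurable A = G A.
Proof. by rewrite /measurable/= sigma_algebra_id. Qed.

Lemma sub_measurableW h : sub_measurable h -> measurable_fun setT h.
Proof. by move=> mh _ B mB; rewrite setTI; apply/GT/mh. Qed.

Lemma Rintegral_mul_sub_measurable (a h : T -> R) :
  rint P a -> (forall A, G A -> (\int[P]_(x in A) (a x)%:E = 0)%E) ->
  sub_measurable h -> rint P (fun x => h x * a x) ->
  \int[P]_x (h x * a x) = 0.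
Proof.
move=> ai a0 mh hai.
(* A sub-sigma-algebra is treated as the preimage sigma-algebra of the identity from T to T equipped
   with [G]. *)
have mid : measurable_fun setT (fun x : T => x : U).
  by move=> _ B mB; rewrite setTI; apply: GT; rewrite -GU.
apply: (Rintegral_mul_preimage (k := h : U -> R) mid ai) => //.
- by move=> B mB; apply: a0; rewrite -GU.
- by move=> _ B mB; rewrite setTI GU; exact: mh.
Qed.

(* Truncating at level n makes g an admissible test function. *)
Lemma cond_sqint (f g : T -> R) : sqint P f -> rint P g -> sub_measurable g ->
  (forall A, G A -> (\int[P]_(x in A) (g x)%:E = \int[P]_(x in A) (f x)%:E)%E) ->
  sqint P g.
Proof.
move=> f2 gi mg gf; have mgT := sub_measurableW mg; have fi := sqint_rint f2.
pose t n (y : R) := y * \1_(`[- n%:R, n%:R]%classic : set R) y.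
have mt n : measurable_fun setT (t n).
  by apply: measurable_funM => //; exact: measurable_indic.
pose h n x := t n (g x).
have mh n : sub_measurable (h n).
  move=> B mB; rewrite (_ : h n @^-1` B = g @^-1` (t n @^-1` B))//.
  by apply: mg; rewrite -[X in measurable X]setTI; exact: mt.
have mhT n : measurable_fun setT (h n) by exact: sub_measurableW.
have hb n x : `|h n x| <= n%:R.
  rewrite /h /t indicE.
  case: (boolP (g x \in `[- n%:R, n%:R]%classic)) => [|_]; last by rewrite mulr0 normr0.
  by rewrite inE/= in_itv/= mulr1 ler_norml.
have h2 n : sqint P (h n).
  split=> //; apply: (le_rint _ _ (rint_cst P (n%:R ^+ 2))).
    by apply: measurable_funX; exact: mhT.
  by move=> x; rewrite normrX lerXn2r ?nnegrE.
have hghi n r : rint P r -> rint P (fun x => h n x * r x).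
  move=> ri; apply: (le_rint _ _ (rintZ n%:R (integrable_abse ri))).
    by apply: measurable_funM; [exact: mhT|exact: (rint_measurable ri)].
  by move=> x; rewrite normrM ler_wpM2r.
(* Because h g = h^2, testing against h gives E[h^2] = E[h f] <= (E[h^2] + E[f^2]) / 2. The
   resulting bound does not depend on n, and Fatou's lemma carries it to g. *)
have hle n : \int[P]_x (h n x ^+ 2) <= \int[P]_x (f x ^+ 2).
  have : \int[P]_x (h n x * (g x - f x)) = 0.
    apply: Rintegral_mul_sub_measurable => //; [exact: rintB| |exact/hghi/rintB].
    move=> A GA; have mA := GT GA.
    have gA : P.-integrable A (EFin \o g) by exact: (integrableS measurableT).
    have fA : P.-integrable A (EFin \o f) by exact: (integrableS measurableT).
    under eq_integral do rewrite EFinB.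
    rewrite (integralB mA gA fA) /= (gf A GA) subee//.
    exact: integrable_fin_num fA.
  rewrite (_ : \int[P]_x _ = \int[P]_x (h n x ^+ 2 - h n x * f x)); last first.
    apply: eq_Rintegral => x _; rewrite mulrBr; congr (_ - _).
    rewrite /h /t indicE; case: (_ \in _); last by rewrite mulr0 mul0r expr0n.
    by rewrite !mulr1 expr2.
  have [_ h2i] := h2 n; have [_ f2i] := f2.
  rewrite (RintegralB measurableT h2i (hghi n f fi)) => /eqP.
  rewrite subr_eq0 => /eqP e.
  suff : 2 * \int[P]_x (h n x * f x) <= \int[P]_x (h n x ^+ 2) + \int[P]_x (f x ^+ 2).
    by rewrite -e; lra.
  rewrite -(RintegralZl _ measurableT (hghi n f fi)) -(RintegralD measurableT h2i f2i).
  apply: le_Rintegral => //; [exact/rintZ/hghi|exact: rintD|].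
  by move=> x _; have := sqr_ge0 (h n x - f x); lra.
apply: ge0_sqint => //.
apply: (@le_lt_trans _ _ (\int[P]_x (f x ^+ 2))%:E); last exact: ltry.
have hlim x : (h n x ^+ 2)%:E @[n --> \oo] --> (g x ^+ 2)%:E.
  apply: cvg_near_cst; exists (Num.truncn `|g x|).+1 => // n /= xn.
  have : `|g x| <= n%:R.
    have /truncn_itv/andP[_ /ltW h1] : 0 <= `|g x| by [].
    by apply: (le_trans h1); rewrite ler_nat.
  by rewrite ler_norml => gx; rewrite /h /t indicE mem_set ?mulr1//= in_itv.
have -> : (\int[P]_x (g x ^+ 2)%:E = \int[P]_x (limn_einf (fun n => (h n x ^+ 2)%:E)))%E.
  apply: eq_integral => x _; by rewrite (cvg_limn_einf_sup (hlim x)).1.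
have mh2 n : measurable_fun setT (fun x => (h n x ^+ 2)%:E).
  by apply/measurable_EFinP/measurable_funX; exact: mhT.
apply: (le_trans (fatou P measurableT mh2 _)) => [n x _|].
  by rewrite lee_fin sqr_ge0.
rewrite limn_einf_lim; apply: lime_le; first exact: is_cvg_einfs.
apply: nearW => n; apply: (@le_trans _ _ (\int[P]_x (h n x ^+ 2)%:E)%E).
  by apply: ereal_inf_lbound; exists n => /=.
by rewrite -(EFin_Rintegral (h2 n).2) lee_fin.
Qed.

End conditional.

(** * The subspace Poincaré inequality *)

Lemma ler_sub_trans (R : realFieldType) (x y w s t : R) :
  x - y <= s -> y - w <= t -> x - w <= t + s.
Proof. lra. Qed.

Lemma ler_half_opp (R : realFieldType) (x y r t : R) :
  t = r -> x = - y -> 2 * (x - y) <= r + t -> x <= 2^-1 * r.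
Proof. lra. Qed.

Lemma ler_mul_sum_sqr (R : realFieldType) (x y : R) : 2 * (x * y) <= x ^+ 2 + y ^+ 2.
Proof. by have := sqr_ge0 (x - y); lra. Qed.

Section hybrid.
Context (R : realType) (d : nat) (nu : probability (Borel 'cV[R]_d) R).
Variables (m0 : 'cV[R]_d) (C : 'M[R]_d).
Hypotheses (nuG : gaussian nu m0 C) (Cspd : spd C).
Variables (v a : 'I_d -> 'cV[R]_d).
Hypotheses (Cav : forall i, C *m a i = v i)
  (av : forall i j, (a i)^T *m v j = (i == j)%:R%:M).

Let Q i : 'M[R]_d := v i *m (a i)^T.
Definition proj_seq (S : seq 'I_d) : 'M[R]_d := \sum_(i <- S) Q i.
Let PP := prodP nu nu.

Let QQ i j : Q i *m Q j = if i == j then Q i else 0.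
Proof.
rewrite /Q mulmxA -(mulmxA (v i)) av; case: eqP => [->|_]; first by rewrite mulmx1.
by rewrite -scalemx1 scale0r mulmx0 mul0mx.
Qed.

Let QiC i : Q i *m C = C *m (Q i)^T.
Proof. by rewrite /Q -Cav trmx_mul trmxK trmx_mul Cspd.1 !mulmxA. Qed.

Let projC S : proj_seq S *m C = C *m (proj_seq S)^T.
Proof.
rewrite /proj_seq mulmx_suml raddf_sum mulmx_sumr.
by apply: eq_bigr => i _; exact: QiC.
Qed.

Let Qproj j S : j \notin S -> Q j *m proj_seq S = 0.
Proof.
move=> jS; rewrite /proj_seq mulmx_sumr big_seq big1// => i iS.
by rewrite QQ; case: eqP => // ji; rewrite ji iS in jS.
Qed.

Let projQ j S : j \notin S -> proj_seq S *m Q j = 0.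
Proof.
move=> jS; rewrite /proj_seq mulmx_suml big_seq big1// => i iS.
by rewrite QQ; case: eqP => // ji; rewrite -ji iS in jS.
Qed.

Let proj_idem S : uniq S -> proj_seq S *m proj_seq S = proj_seq S.
Proof.
elim: S => [|j S IH] /=; first by rewrite /proj_seq big_nil mulmx0.
move=> /andP[jS uS]; have -> : proj_seq (j :: S) = Q j + proj_seq S.
  by rewrite /proj_seq big_cons.
by rewrite mulmxDl !mulmxDr QQ eqxx Qproj// projQ// IH// addr0 add0r.
Qed.

Let swap_law S : uniq S -> has_law PP (swap (proj_seq S)) PP.
Proof. by move=> uS; apply: (gaussian_swap nuG Cspd); [exact: proj_idem|exact: projC]. Qed.

Let proj1 j : proj_seq [:: j] = Q j.
Proof. by rewrite /proj_seq big_seq1. Qed.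

Let swapj_law j : has_law PP (swap (Q j)) PP.
Proof. by rewrite -proj1; exact: swap_law. Qed.

(** The first two identities say that exchanging j beforehand interchanges X^S and X^(j :: S), hence
    negates the difference of their values. The third shows this difference to be f(X) - f(X^j)
    evaluated after the exchange of S. *)
Let swap_swap j S z : j \notin S ->
  [/\ (swap (proj_seq S) (swap (Q j) z)).1 = (swap (proj_seq (j :: S)) z).1,
      (swap (proj_seq (j :: S)) (swap (Q j) z)).1 = (swap (proj_seq S) z).1 &
      (swap (Q j) (swap (proj_seq S) z)).1 = (swap (proj_seq (j :: S)) z).1].
Proof.
move=> jS; have -> : proj_seq (j :: S) = Q j + proj_seq S.
  by rewrite /proj_seq big_cons.
case: z => x y; rewrite /swap/=; set e : 'cV[R]_d := y - x.
have eE (A : 'M[R]_d) : y - A *m e - (x + A *m e) = e - A *m e - A *m e.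
  by rewrite opprD addrA [y - A *m e - x]addrAC.
have QQe : Q j *m (Q j *m e) = Q j *m e by rewrite mulmxA QQ eqxx.
have QSe : Q j *m (proj_seq S *m e) = 0 by rewrite mulmxA Qproj// mul0mx.
have SQe : proj_seq S *m (Q j *m e) = 0 by rewrite mulmxA projQ// mul0mx.
rewrite !eE; clearbody e; split.
- by rewrite !mulmxBr SQe !subr0 mulmxDl addrA.
- rewrite !mulmxDl !mulmxBr SQe QQe !subr0 subrr sub0r.
  by rewrite -addrA addNKr.
- by rewrite !mulmxBr QSe !subr0 mulmxDl -addrA [proj_seq S *m e + _]addrC.
Qed.

Definition swap_diff (f : Borel 'cV[R]_d -> R) j : R :=
  \int[PP]_z ((f z.1 - f (swap (Q j) z).1) ^+ 2).

(* One term of the telescope is E[f(X) D], where D is the effect of exchanging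
   coordinate [j] as well. That exchange preserves the law and negates D, so
   E[f(X) D] = E[(f(X) - f(X^j)) D] / 2, and D has the law of f(X) - f(X^j). *)
Lemma hybrid_telescope (f : Borel 'cV[R]_d -> R) (S : seq 'I_d) :
  sqint nu f -> uniq S ->
  \int[nu]_m (f m ^+ 2) - \int[PP]_z (f z.1 * f (swap (proj_seq S) z).1) <=
  2^-1 * \sum_(j <- S) swap_diff f j.
Proof.
move=> f2; have f1 : sqint PP (fun z => f z.1) := sqint_law (fst_law nu nu) f2.
have fZ T : uniq T -> sqint PP (fun z => f (swap (proj_seq T) z).1).
  by move=> uT; exact: (sqint_law (swap_law uT) f1).
elim: S => [_|j S IH /= /andP[jS uS]].
  rewrite big_nil mulr0 subr_le0 -(Rintegral_law (fst_law nu nu) f2.2).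
  rewrite le_eqVlt; apply/orP; left; apply/eqP/eq_Rintegral => z _.
  by rewrite /swap/= /proj_seq big_nil mul0mx addr0 expr2.
have ujS : uniq (j :: S) by rewrite /= jS.
rewrite big_cons mulrDr.
have i1 := sqint_mul f1 (fZ _ uS); have i2 := sqint_mul f1 (fZ _ ujS).
suff : \int[PP]_z (f z.1 * f (swap (proj_seq S) z).1) -
    \int[PP]_z (f z.1 * f (swap (proj_seq (j :: S)) z).1) <= 2^-1 * swap_diff f j.
  exact: ler_sub_trans (IH uS).
have fj : sqint PP (fun z => f (swap (Q j) z).1).
  exact: (sqint_law (swapj_law j) f1).
pose D z := f (swap (proj_seq S) z).1 - f (swap (proj_seq (j :: S)) z).1.
have D2 : sqint PP D by exact: (sqintB (fZ _ uS) (fZ _ ujS)).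
have fD := sqint_mul f1 D2; have fjD := sqint_mul fj D2.
have T1 : \int[PP]_z (f z.1 * f (swap (proj_seq S) z).1) -
    \int[PP]_z (f z.1 * f (swap (proj_seq (j :: S)) z).1) = \int[PP]_z (f z.1 * D z).
  rewrite -(RintegralB measurableT i1 i2); apply: eq_Rintegral => z _.
  by rewrite mulrBr.
have T2 : \int[PP]_z (f z.1 * D z) = - \int[PP]_z (f (swap (Q j) z).1 * D z).
  rewrite -(Rintegral_law (swapj_law j) fD) -mulN1r -(RintegralZl _ measurableT fjD).
  apply: eq_Rintegral => z _; rewrite /D.
  by have [-> -> _] := swap_swap z jS; rewrite mulN1r -mulrN opprB.
have df2 := sqintB f1 fj.
have T3 : \int[PP]_z (D z ^+ 2) = swap_diff f j.
  rewrite /swap_diff -(Rintegral_law (swap_law uS) df2.2).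
  apply: eq_Rintegral => z _; rewrite /D.
  by have [_ _ ->] := swap_swap z jS.
rewrite T1.
suff : 2 * (\int[PP]_z (f z.1 * D z) - \int[PP]_z (f (swap (Q j) z).1 * D z)) <=
    swap_diff f j + \int[PP]_z (D z ^+ 2).
  exact: ler_half_opp T3 T2.
rewrite -(RintegralB measurableT fD fjD) -(RintegralZl _ measurableT (rintB fD fjD)).
rewrite -(RintegralD measurableT df2.2 D2.2).
apply: le_Rintegral => //.
- exact: (rintZ 2 (rintB fD fjD)).
- exact: (rintD df2.2 D2.2).
move=> z _; rewrite -mulrBl.
exact: ler_mul_sum_sqr.
Qed.

Definition proj_sigma (P : 'M[R]_d) : set_system (Borel 'cV[R]_d) :=
  @sigma_of (Borel 'cV[R]_d) _ (Borel 'cV[R]_d) (fun m => P *m (m : 'cV[R]_d)).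

Lemma measurable_mulmx (P : 'M[R]_d) :
  measurable_fun setT (fun m : Borel 'cV[R]_d => P *m (m : 'cV[R]_d) : Borel 'cV[R]_d).
Proof.
apply: measurable_fun_Borel => i; under eq_fun do rewrite mxE.
by apply: measurable_sum => k; apply: measurable_funM => //; exact: measurable_coord.
Qed.

Lemma proj_sigma_algebra (P : 'M[R]_d) : sigma_algebra setT (proj_sigma P).
Proof. by apply: sigma_algebra_preimage; exact: sigma_algebra_measurable. Qed.

Lemma proj_sigma_measurable (P : 'M[R]_d) : proj_sigma P `<=` measurable.
Proof. by move=> _ [B mB <-]; exact: measurable_mulmx. Qed.

Lemma cond_sub_integral (G : set_system (Borel 'cV[R]_d)) (f g : Borel 'cV[R]_d -> R) :
  G `<=` measurable -> rint nu f -> rint nu g ->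
  (forall A, G A -> (\int[nu]_(m in A) (g m)%:E = \int[nu]_(m in A) (f m)%:E)%E) ->
  forall A, G A -> (\int[nu]_(m in A) (f m - g m)%:E = 0)%E.
Proof.
move=> GT fi gi gf A GA; have mA := GT A GA.
have gA : nu.-integrable A (EFin \o g) by exact: (integrableS measurableT).
have fA : nu.-integrable A (EFin \o f) by exact: (integrableS measurableT).
under eq_integral do rewrite EFinB.
rewrite (integralB mA fA gA) /= (gf A GA) subee//.
exact: integrable_fin_num fA.
Qed.

(** The exchanged vector is P x + [proj_seq S] y. For fixed y it is a function of P x, against which
    b integrates to 0; the test set in the pair (P x, y) is cut along y by Fubini. *)
Let cross_zero (S : seq 'I_d) (b : Borel 'cV[R]_d -> R) : uniq S -> sqint nu b ->
  (forall A, proj_sigma (1%:M - proj_seq S) A -> (\int[nu]_(m in A) (b m)%:E = 0)%E) ->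
  \int[PP]_z (b z.1 * b (swap (proj_seq S) z).1) = 0.
Proof.
move=> uS b2 b0; set P := 1%:M - proj_seq S in b0.
have b1 : sqint PP (fun z => b z.1) := sqint_law (fst_law nu nu) b2.
have bZ : sqint PP (fun z => b (swap (proj_seq S) z).1).
  exact: (sqint_law (swap_law uS) b1).
pose phi (m : Borel 'cV[R]_d) : Borel 'cV[R]_d := P *m (m : 'cV[R]_d).
have mphi : measurable_fun setT phi by exact: measurable_mulmx.
pose phi2 (z : Borel 'cV[R]_d * Borel 'cV[R]_d) := (phi z.1, z.2).
have mphi2 : measurable_fun setT phi2.
  apply/measurable_fun_pairP; split; last exact: measurable_snd.
  exact: (measurableT_comp mphi measurable_fst).
pose sum2 (z : Borel 'cV[R]_d * Borel 'cV[R]_d) : Borel 'cV[R]_d :=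
  (z.1 : 'cV[R]_d) + proj_seq S *m (z.2 : 'cV[R]_d).
have msum2 : measurable_fun setT sum2.
  apply: measurable_fun_Borel => i; under eq_fun do rewrite mxE.
  apply: measurable_funD; first exact: (measurableT_comp (measurable_coord i) measurable_fst).
  exact: (measurableT_comp (measurable_coord i)
    (measurableT_comp (measurable_mulmx (proj_seq S)) measurable_snd)).
have sumE z : sum2 (phi2 z) = (swap (proj_seq S) z).1.
  rewrite /sum2 /phi2 /phi /P /swap/= mulmxBl mul1mx mulmxBr.
  by rewrite addrAC addrA.
have mb : measurable_fun setT b by case: b2.
have kai : rint PP (fun z => b (sum2 (phi2 z)) * b z.1).
  by under eq_fun do rewrite sumE; exact: sqint_mul.
transitivity (\int[PP]_z (b (sum2 (phi2 z)) * b z.1)).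
  by apply: eq_Rintegral => z _; rewrite sumE mulrC.
apply: (Rintegral_mul_preimage (k := fun z => b (sum2 z)) mphi2 (sqint_rint b1)) => //.
  move=> B mB; have mA : measurable (phi2 @^-1` B).
    by rewrite -[X in measurable X]setTI; exact: mphi2.
  rewrite integral_mkcond.
  have iB : PP.-integrable setT ((fun z => (b z.1)%:E) \_ (phi2 @^-1` B)).
    apply/(integrable_mkcond _ mA).
    exact: (integrableS measurableT mA (@subsetT _ _) (sqint_rint b1)).
  rewrite -(integral21_prod_meas1 iB); apply: integral0_eq => y _; rewrite /fubini_G.
  have mBy : measurable (ysection B y) by exact: measurable_ysection.
  have GB : proj_sigma P (phi @^-1` (ysection B y)).
    by exists (ysection B y) => //; rewrite setTI.
  rewrite -(b0 _ GB) [RHS]integral_mkcond.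
  apply: eq_integral => x _; rewrite !patchE.
  have -> : (x \in phi @^-1` ysection B y) = ((x, y) \in phi2 @^-1` B).
    by apply/idP/idP; rewrite !inE /phi2/= /ysection/= inE.
  by [].
exact: (measurableT_comp mb msum2).
Qed.

Lemma subspace_poincare (S : seq 'I_d) (f g : Borel 'cV[R]_d -> R)
    (D : 'I_d -> Borel 'cV[R]_d -> R) :
  uniq S -> sqint nu f -> rint nu g ->
  sub_measurable (proj_sigma (1%:M - proj_seq S)) g ->
  (forall A, proj_sigma (1%:M - proj_seq S) A ->
     (\int[nu]_(m in A) (g m)%:E = \int[nu]_(m in A) (f m)%:E)%E) ->
  (forall j, measurable_fun setT (D j)) ->
  (forall j (m : 'cV[R]_d) (t : R),
     is_derive t (1 : R) (fun s : R => f (m + s *: v j)) (D j (m + t *: v j))) ->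
  (\int[nu]_m ((f m - g m) ^+ 2)%:E <= \sum_(j <- S) \int[nu]_m (D j m ^+ 2)%:E)%E.
Proof.
move=> uS f2 gi mg gf mD df; pose P : 'M[R]_d := 1%:M - proj_seq S.
have GT := @proj_sigma_measurable P.
have g2 : sqint nu g := cond_sqint (proj_sigma_algebra P) GT f2 gi mg gf.
pose b m := f m - g m; have b2 : sqint nu b := sqintB f2 g2.
have b0 := cond_sub_integral GT (sqint_rint f2) gi gf.
(* Measurability with respect to sigma(P) holds everywhere and not up to a null set: the level set
   of g through x is the preimage of some set under P, so g is a genuine function of P x. *)
have gP (x y : 'cV[R]_d) : P *m x = P *m y -> g x = g y.
  move=> xy; have [B mB Bg] : proj_sigma P (g @^-1` [set g x]).
    by apply: mg; exact: measurable_set1.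
  have : (g @^-1` [set g x]) x by [].
  rewrite -Bg => -[_ /= Bx]; apply/esym.
  have : (g @^-1` [set g x]) y; last by [].
  by rewrite -Bg; split => //=; rewrite -xy.
have Pv j : j \in S -> P *m v j = 0.
  move=> jS; rewrite /P mulmxBl mul1mx /proj_seq mulmx_suml (bigD1_seq j)//=.
  rewrite /Q -mulmxA av eqxx mulmx1 big1 ?addr0 ?subrr// => i ij.
  by rewrite -mulmxA av (negbTE ij) -scalemx1 scale0r mulmx0.
have := hybrid_telescope b2 uS; rewrite (cross_zero uS b2 b0) subr0 => tele.
have f1 : sqint PP (fun z => f z.1) := sqint_law (fst_law nu nu) f2.
have fdi j : rint PP (fun z => (f z.1 - f (swap (Q j) z).1) ^+ 2).
  by case: (sqintB f1 (sqint_law (swapj_law j) f1)).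
have bf j : j \in S -> swap_diff b j = swap_diff f j.
  move=> jS; apply: eq_Rintegral => z _; congr (_ ^+ 2).
  rewrite /b (gP z.1 (swap (Q j) z).1); first by rewrite opprB addrA subrK.
  by rewrite /swap/= mulmxDr /Q -(mulmxA (v j)) (mulmxA P) Pv// mul0mx addr0.
rewrite -(EFin_Rintegral b2.2).
apply: (@le_trans _ _ (2^-1 * \sum_(j <- S) swap_diff b j)%:E); first by rewrite lee_fin.
rewrite mulr_sumr -sumEFin big_seq [leRHS]big_seq; apply: lee_sum => j jS.
rewrite (bf _ jS) EFinM /swap_diff (EFin_Rintegral (fdi j)).
have avj : (a j)^T *m v j = 1%:M by rewrite av eqxx.
have h := swap_variance_le nuG Cspd (Cav j) avj f2.1 (mD j) (df j).
apply: (@le_trans _ _ (2^-1%:E * (2%:E * \int[nu]_m (D j m ^+ 2)%:E))%E).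
  by apply: lee_wpmul2l; rewrite ?lee_fin.
by rewrite muleA -EFinM mulVf ?pnatr_eq0// mul1e.
Qed.

End hybrid.

(** * The Jacobian *)

Lemma l2norm_sqr (R : realType) d (x : 'cV[R]_d) :
  l2norm x ^+ 2 = \sum_i x i 0 ^+ 2.
Proof. by rewrite sqr_sqrtr// sumr_ge0// => i _; exact: sqr_ge0. Qed.

Lemma l2normZ_sqr (R : realType) d (k : R) (x : 'cV[R]_d) :
  l2norm (k *: x) ^+ 2 = k ^+ 2 * l2norm x ^+ 2.
Proof.
by rewrite !l2norm_sqr mulr_sumr; apply: eq_bigr => i _; rewrite mxE exprMn.
Qed.

Section jacobian.
Context (R : realType) (d p : nat) (q : 'cV[R]_d -> 'cV[R]_p).
Hypothesis q_diff : forall m, differentiable q m.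

Let jacE (m v : 'cV[R]_d) : jac q m *m v = 'd q m v.
Proof.
have -> : 'd q m v = \sum_k v k 0 *: 'd q m (delta_mx k 0).
  rewrite {1}(matrix_sum_delta v) linear_sum; apply: eq_bigr => k _.
  by rewrite big_ord1 linearZ.
apply/colP => i; rewrite mxE summxE; apply: eq_bigr => k _.
by rewrite !mxE mulrC.
Qed.

Let cvg_jac (m v : 'cV[R]_d) i :
  h^-1 * ((q (h *: v + m)) i 0 - (q m) i 0) @[h --> 0^'] --> (jac q m *m v) i 0.
Proof.
have dq : derivable q m v by exact: diff_derivable.
have := @coord_continuous _ _ _ i 0 ('D_v q m) => cont.
have h := cvg_comp _ _ dq cont.
rewrite jacE -deriveE//; apply: cvg_trans h; apply: near_eq_cvg.
by near=> h; rewrite /= !mxE.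
Unshelve. all: by end_near. Qed.

Lemma is_derive_jac (m v : 'cV[R]_d) i (t : R) :
  is_derive t (1 : R) (fun s : R => q (m + s *: v) i 0) ((jac q (m + t *: v) *m v) i 0).
Proof.
have lim : h^-1 *: (((fun s : R => q (m + s *: v) i 0) \o shift t) (h *: (1 : R)) -
    q (m + t *: v) i 0) @[h --> 0^'] --> (jac q (m + t *: v) *m v) i 0.
  apply: cvg_trans (@cvg_jac (m + t *: v) v i); apply: near_eq_cvg.
  near=> h; rewrite /= [h *: 1]mulr1 scalerDl addrCA.
  by [].
split; first by apply/cvg_ex; eexists; exact: lim.
exact: (cvg_lim _ lim).
Unshelve. all: by end_near. Qed.

(** The Jacobian need not be continuous. It is a pointwise limit of these continuous quotients, of
    step 1 / (n + 1), and inherits from them both measurability and the Lipschitz bound. *)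
Let quot (v : 'cV[R]_d) (n : nat) (m : 'cV[R]_d) : 'cV[R]_p :=
  n.+1%:R *: (q (n.+1%:R^-1 *: v + m) - q m).

Let cvg_quot (m v : 'cV[R]_d) i :
  (quot v n m) i 0 @[n --> \oo] --> (jac q m *m v) i 0.
Proof.
have h0 : n.+1%:R^-1 @[n --> \oo] --> (0 : R)^'.
  move=> A /= hA; have := @cvg_harmonic R _ hA; apply: (@filterS _ \oo) => n.
  by apply; rewrite invr_eq0.
have := cvg_comp _ _ h0 (@cvg_jac m v i); apply: cvg_trans; apply: near_eq_cvg.
by near=> n; rewrite /= /quot !mxE invrK.
Unshelve. all: by end_near. Qed.

Lemma measurable_coord_diff i :
  measurable_fun setT (fun m : Borel 'cV[R]_d => q m i 0).
Proof.
apply: continuous_Borel_measurable => m.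
apply: (continuous_comp (g := fun x : 'cV[R]_p => x i 0)); last exact: coord_continuous.
exact: differentiable_continuous.
Qed.

Lemma measurable_jac (v : 'cV[R]_d) i :
  measurable_fun setT (fun m : Borel 'cV[R]_d => (jac q m *m v) i 0).
Proof.
apply: (measurable_fun_cvg (h := fun n (m : Borel 'cV[R]_d) => (quot v n m) i 0)).
  move=> n; apply: continuous_Borel_measurable.
  move=> m; apply: (continuous_comp (f := quot v n) (g := fun x : 'cV[R]_p => x i 0)).
    have qc x : {for x, continuous q} by exact: differentiable_continuous.
    have qvc : {for m, continuous (fun m => q (n.+1%:R^-1 *: v + m))}.
      apply: (continuous_comp (f := fun m => n.+1%:R^-1 *: v + m) (g := q)); last exact: qc.
      by apply: continuousD; [exact: cst_continuous|exact: cvg_id].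
    exact: continuousZl_tmp (continuousB qvc (qc m)).
  exact: coord_continuous.
by move=> m _; exact: cvg_quot.
Qed.

Lemma lipschitz_jac (L : R) (m v : 'cV[R]_d) : l2lipschitz L q -> 0 <= L ->
  \sum_i ((jac q m *m v) i 0) ^+ 2 <= L ^+ 2 * \sum_k v k 0 ^+ 2.
Proof.
move=> qL L0.
have lim : \sum_i (quot v n m) i 0 ^+ 2 @[n --> \oo] -->
    \sum_i ((jac q m *m v) i 0) ^+ 2.
  by apply: cvg_big => [|i _]; [exact: add_continuous|apply: cvgM; exact: cvg_quot].
rewrite -(cvg_lim (@Rhausdorff R) lim); apply: limr_le.
  by apply/cvg_ex; eexists; exact: lim.
apply: nearW => n.
have := qL (n.+1%:R^-1 *: v + m) m; rewrite addrK => qn.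
have n0 : 0 < n.+1%:R :> R by [].
rewrite -!l2norm_sqr /quot l2normZ_sqr.
apply: (@le_trans _ _ (n.+1%:R ^+ 2 * (L * l2norm (n.+1%:R^-1 *: v)) ^+ 2)).
  rewrite ler_pM2l ?exprn_gt0// lerXn2r// nnegrE ?sqrtr_ge0//.
  by rewrite mulr_ge0 ?sqrtr_ge0.
rewrite exprMn l2normZ_sqr le_eqVlt; apply/orP; left; apply/eqP.
by field; rewrite gt_eqF.
Qed.

End jacobian.

(** * The generalized eigenvectors *)

Lemma spd_unitmx (R : realType) d (C : 'M[R]_d) : spd C -> C \in unitmx.
Proof.
move=> [CT C_gt0]; rewrite -row_free_unit; apply/inj_row_free => u uC.
apply/eqP/negPn/negP => u0; have := C_gt0 u^T.
rewrite trmxK uC mul0mx mxE ltxx => /(_ _)/notF; apply.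
by apply: contra u0 => /eqP uT; rewrite -[u]trmxK uT trmx0.
Qed.

Section gen_eigen.
Context (R : realType) (d : nat) (H C : 'M[R]_d) (lam : 'I_d -> R).
Variable v : 'I_d -> 'cV[R]_d.
Hypotheses (Cspd : spd C) (eig : gen_eigenpairs H C lam v).

Let Cu : C \in unitmx. Proof. exact: spd_unitmx. Qed.

Let vCv i j : (v i)^T *m invmx C *m v j = (i == j)%:R%:M.
Proof.
case: eig => _ _ vv; rewrite [LHS]mx11_scalar; congr _%:M.
exact: vv.
Qed.

Let a i := invmx C *m v i.

Lemma gen_eigen_dual i j : (invmx C *m v i)^T *m v j = (i == j)%:R%:M.
Proof. by rewrite trmx_mul trmx_inv Cspd.1 vCv. Qed.

Let M : 'M[R]_d := \matrix_(i, j) v j i 0.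

Let MCM : M^T *m invmx C *m M = 1%:M.
Proof.
apply/matrixP => i j; have /matrixP/(_ 0 0) := vCv i j.
rewrite !mxE eqxx mulr1n => <-; apply: eq_bigr => k _.
by rewrite !mxE; congr (_ * _); apply: eq_bigr => l _; rewrite !mxE.
Qed.

Let MMC : M *m M^T *m invmx C = 1%:M.
Proof. by rewrite -mulmxA; exact: mulmx1C MCM. Qed.

Let MM : M *m M^T = C.
Proof. by rewrite -[LHS]mulmx1 -(mulVmx Cu) mulmxA MMC mul1mx. Qed.

Let sum_vv (P : pred 'I_d) i j :
  (\sum_(k | P k) v k *m (v k)^T) i j = \sum_(k | P k) v k i 0 * v k j 0.
Proof.
by rewrite summxE; apply: eq_bigr => k _; rewrite mxE big_ord1 mxE.
Qed.

(** The matrices v_i v_i^T C^-1 add up to the identity, because M M^T = C for the matrix M with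
    columns v_i. The projector thus takes the form required by [subspace_poincare]. *)
Lemma gen_eigen_proj r (rd : (r <= d)%N) :
  first_cols rd v *m (first_cols rd v)^T *m invmx C =
  1%:M - proj_seq v a [seq i : 'I_d <- index_enum 'I_d | (r <= i)%N].
Proof.
have aT i : v i *m (a i)^T = v i *m (v i)^T *m invmx C.
  by rewrite /a trmx_mul trmx_inv Cspd.1 mulmxA.
have -> : proj_seq v a [seq i : 'I_d <- index_enum 'I_d | (r <= i)%N] =
    (\sum_(i < d | (r <= i)%N) v i *m (v i)^T) *m invmx C.
  by rewrite /proj_seq big_filter mulmx_suml; apply: eq_bigr => i _; exact: aT.
apply/eqP; rewrite eq_sym subr_eq -mulmxDl -MMC; apply/eqP; congr (_ *m _).
apply/matrixP => i j; rewrite [RHS]mxE sum_vv !mxE.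
rewrite (bigID (fun k : 'I_d => (k < r)%N))/=; congr (_ + _); last first.
  by apply: eq_big => k; [rewrite -leqNgt|rewrite !mxE].
rewrite (big_ord_narrow rd); by apply: eq_bigr => k _; rewrite !mxE.
Qed.

(** Substituting M x for x turns H into the diagonal matrix of the [lam i] and the identity into M^T
    M = M^-1 (M M^T) M, which is similar to M M^T = C and so has the eigenvalues of C. *)
Lemma gen_eigen_tail_le (c : 'I_d -> R) k r : H^T = H -> eigenvalues C c ->
  (forall x : 'cV[R]_d, (x^T *m H *m x) 0 0 <= k * \sum_i x i 0 ^+ 2) ->
  \sum_(i < d | (r <= i)%N) lam i <= k * \sum_(i < d | (r <= i)%N) c i.
Proof.
move=> HT [_ Cc] Hk; have [lam_dec Hv _] := eig.
have Mu : M \in unitmx by have [] := mulmx1_unit (etrans (mulmxA _ _ _) MMC).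
have HM : M^T *m H *m M = diag_mx (\row_i lam i).
  apply/matrixP => i j; rewrite !mxE.
  have -> : \sum_k0 (M^T *m H) i k0 * M k0 j = ((v i)^T *m H *m v j) 0 0.
    rewrite mxE; apply: eq_bigr => l _; rewrite !mxE; congr (_ * _).
    by apply: eq_bigr => n _; rewrite !mxE.
  rewrite -mulmxA Hv -scalemxAr mulmxA vCv !mxE eqxx mulr1n.
  by case: eqP => [->|_]; rewrite ?mulr1// mulr0.
apply: (@tail_eigenvalues_le _ _ _ (diag_mx (\row_i lam i)) (M^T *m M)) => //.
- by rewrite tr_diag_mx.
- by rewrite trmx_mul trmxK.
- rewrite char_poly_trig ?diag_mx_is_trig//.
  by apply: eq_bigr => i _; rewrite !mxE eqxx mulr1n.
- rewrite -Cc -MM -(@char_poly_conj _ _ (invmx M) (M *m M^T)) ?unitmx_inv//.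
  by rewrite invmxK mulmxA mulVmx// mul1mx.
move=> x; rewrite -HM.
have -> : x^T *m (M^T *m H *m M) *m x = (M *m x)^T *m H *m (M *m x).
  by rewrite trmx_mul !mulmxA.
apply: le_trans (Hk _) _; rewrite le_eqVlt; apply/orP; left; apply/eqP; congr (_ * _).
have -> : x^T *m (M^T *m M) *m x = (M *m x)^T *m (M *m x).
  by rewrite trmx_mul !mulmxA.
rewrite mxE.
by apply: eq_bigr => i _; rewrite [_^T _ _]mxE.
Qed.

End gen_eigen.

(** * Moments and POD *)

Lemma proj_sqr (R : comNzRingType) d r (Phi : 'M[R]_(d, r)) (u : 'cV[R]_d) :
  Phi^T *m Phi = 1%:M ->
  \sum_i ((u - Phi *m Phi^T *m u) i 0) ^+ 2 =
  \sum_i u i 0 ^+ 2 - \sum_k (Phi^T *m u) k 0 ^+ 2.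
Proof.
move=> PP.
have sqE n (x : 'cV[R]_n) : \sum_i x i 0 ^+ 2 = (x^T *m x) 0 0.
  by rewrite mxE; apply: eq_bigr => i _; rewrite mxE.
rewrite !sqE -mulmxA; set w := Phi^T *m u.
have -> : (w^T *m w) = u^T *m (Phi *m w) by rewrite trmx_mul trmxK mulmxA.
have -> : (u - Phi *m w)^T = u^T - (Phi *m w)^T by exact: linearB.
rewrite mulmxBl !mulmxBr trmx_mul.
have -> : w^T *m Phi^T *m u = w^T *m w by rewrite -mulmxA.
have -> : w^T *m Phi^T *m (Phi *m w) = w^T *m w.
  by rewrite mulmxA -[w^T *m _ *m Phi]mulmxA PP mulmx1.
by rewrite subrr subr0 !mxE.
Qed.

Section random_vectors.
Context (R : realType) (d p : nat) (nu : probability (Borel 'cV[R]_d) R).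
Implicit Types f g h : 'cV[R]_d -> 'cV[R]_p.

Definition sqint_vec f := forall i, sqint nu (fun m => f m i 0).

Local Notation moment f := (expect_mx nu (fun m => f m *m (f m)^T)).

Lemma Rintegral_dot_mul f h (x y : 'I_p -> R) : sqint_vec f -> sqint_vec h ->
  \int[nu]_m ((\sum_i x i * f m i 0) * (\sum_j y j * h m j 0)) =
  \sum_i \sum_j x i * y j * \int[nu]_m (f m i 0 * h m j 0).
Proof.
move=> f2 h2.
have fh i j : rint nu (fun m => f m i 0 * h m j 0) by exact: sqint_mul.
transitivity (\int[nu]_m (\sum_i \sum_j x i * y j * (f m i 0 * h m j 0))).
  apply: eq_Rintegral => m _; rewrite mulr_suml; apply: eq_bigr => i _.
  by rewrite mulr_sumr; apply: eq_bigr => j _; ring.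
rewrite Rintegral_sum => [|i]; last by apply: rint_sum => j; exact: rintZ.
apply: eq_bigr => i _; rewrite Rintegral_sum => [|j]; last exact: rintZ.
by apply: eq_bigr => j _; rewrite RintegralZl//; exact: fh.
Qed.

Lemma sqint_dot f (x : 'I_p -> R) : sqint_vec f ->
  sqint nu (fun m => \sum_i x i * f m i 0).
Proof. by move=> f2; apply: sqint_sum => i; apply: sqintZ; exact: f2. Qed.

Lemma moment_quad f (x : 'cV[R]_p) : sqint_vec f ->
  (x^T *m moment f *m x) 0 0 = \int[nu]_m ((\sum_i x i 0 * f m i 0) ^+ 2).
Proof.
move=> f2; rewrite trmx_quadE.
have := Rintegral_dot_mul (fun i => x i 0) (fun i => x i 0) f2 f2.
under eq_Rintegral do rewrite -expr2.
move=> ->; apply: eq_bigr => i _; apply: eq_bigr => j _.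
rewrite [_ * \int[_]_(_ in _) _]mulrC -mulrA mxE; congr (_ * _).
by apply: eq_Rintegral => m _; rewrite mxE big_ord1 mxE.
Qed.

Lemma moment_sym f : (moment f)^T = moment f.
Proof.
apply/matrixP => i j; rewrite !mxE; apply: eq_Rintegral => m _.
by rewrite !mxE !big_ord1 !mxE mulrC.
Qed.

Lemma moment_tr_sub r (Phi : 'M[R]_(p, r)) f : sqint_vec f -> Phi^T *m Phi = 1%:M ->
  \int[nu]_m (\sum_i (f m - Phi *m Phi^T *m f m) i 0 ^+ 2) =
  \tr (moment f) - \tr (Phi^T *m moment f *m Phi).
Proof.
move=> f2 PP.
under eq_Rintegral do rewrite proj_sqr//.
have fi i : rint nu (fun m => f m i 0 ^+ 2) by have [] := f2 i.
have PE k m : (Phi^T *m f m) k 0 = \sum_i Phi i k * f m i 0.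
  by rewrite mxE; apply: eq_bigr => i _; rewrite mxE.
have Pf k : rint nu (fun m => (Phi^T *m f m) k 0 ^+ 2).
  under eq_fun do rewrite PE.
  by have [] := sqint_dot (fun i => Phi i k) f2.
have s1 := rint_sum fi; have s2 := rint_sum Pf.
rewrite (RintegralB measurableT s1 s2) !Rintegral_sum//; congr (_ - _).
  apply: eq_bigr => i _; rewrite mxE; apply: eq_Rintegral => m _.
  by rewrite mxE big_ord1 mxE.
apply: eq_bigr => k _; under eq_Rintegral do rewrite PE.
have := moment_quad (col k Phi) f2; under eq_Rintegral do under eq_bigr do rewrite mxE.
move=> <-; rewrite tr_col -row_mul [LHS]mxE [RHS]mxE; apply: eq_bigr => l _.
by rewrite [row _ _ _ _]mxE [col _ _ _ _]mxE.
Qed.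

Section orthogonal.
Variables f g : 'cV[R]_d -> 'cV[R]_p.
Hypotheses (f2 : sqint_vec f) (g2 : sqint_vec g).
(** All pairs of entries are concerned, since the quadratic forms and [Phi *m Phi^T] mix the
    entries. *)
Hypothesis fg_orth : forall i j, \int[nu]_m (g m j 0 * (f m i 0 - g m i 0)) = 0.

Let w m := f m - g m.

Let w2 : sqint_vec w.
Proof. by move=> i; rewrite /w; under eq_fun do rewrite !mxE; exact: sqintB. Qed.

Let cross (x y : 'I_p -> R) :
  \int[nu]_m ((\sum_i x i * g m i 0) * (\sum_j y j * w m j 0)) = 0.
Proof.
rewrite (Rintegral_dot_mul x y g2 w2) big1// => i _; rewrite big1// => j _.
under eq_Rintegral do rewrite !mxE.
by rewrite fg_orth mulr0.
Qed.

(** Orthogonality gives E[(x.f)^2] = E[(x.g)^2] + E[(x.w)^2]. *)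
Lemma moment_quad_le (x : 'cV[R]_p) :
  (x^T *m moment g *m x) 0 0 <= (x^T *m moment f *m x) 0 0.
Proof.
rewrite !moment_quad//; pose xi i := x i 0.
have [_ gg] := sqint_dot xi g2; have [_ ww] := sqint_dot xi w2.
have gw := sqint_mul (sqint_dot xi g2) (sqint_dot xi w2).
have -> : \int[nu]_m ((\sum_i x i 0 * f m i 0) ^+ 2) =
    \int[nu]_m ((\sum_i xi i * g m i 0) ^+ 2 +
      (2 * ((\sum_i xi i * g m i 0) * (\sum_i xi i * w m i 0)) +
       (\sum_i xi i * w m i 0) ^+ 2)).
  apply: eq_Rintegral => m _.
  have -> : \sum_i x i 0 * f m i 0 =
      \sum_i xi i * g m i 0 + \sum_i xi i * w m i 0.
    by rewrite -big_split/=; apply: eq_bigr => i _; rewrite /xi !mxE; ring.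
  by ring.
rewrite (RintegralD measurableT gg (rintD (rintZ 2 gw) ww)) lerDl.
rewrite (RintegralD measurableT (rintZ 2 gw) ww) (RintegralZl _ measurableT gw).
by rewrite cross mulr0 add0r Rintegral_ge0// => m _; exact: sqr_ge0.
Qed.

(** The error is w + u, where u = (1 - Phi Phi^T) g is a linear image of g and therefore orthogonal
    to w = f - g. *)
Lemma pod_pythagoras r (Phi : 'M[R]_(p, r)) : Phi^T *m Phi = 1%:M ->
  (\int[nu]_m (l2norm (f m - Phi *m Phi^T *m g m) ^+ 2)%:E =
   \int[nu]_m (\sum_i (f m i 0 - g m i 0) ^+ 2)%:E +
   (\tr (moment g) - \tr (Phi^T *m moment g *m Phi))%:E)%E.
Proof.
move=> PP; pose u m := g m - Phi *m Phi^T *m g m.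
have uE m i : u m i 0 = \sum_j (1%:M - Phi *m Phi^T) i j * g m j 0.
  by rewrite -[LHS]/((g m - _ *m g m) i 0) -{1}[g m]mul1mx -mulmxBl mxE.
have u2 : sqint_vec u.
  by move=> i; under eq_fun do rewrite uE; exact: sqint_dot.
have si : rint nu (fun m => \sum_i (f m i 0 - g m i 0) ^+ 2).
  by apply: rint_sum => i; have [] := sqintB (f2 i) (g2 i).
have sw : rint nu (fun m => \sum_i w m i 0 ^+ 2).
  by apply: rint_sum => i; have [] := w2 i.
have su : rint nu (fun m => \sum_i u m i 0 ^+ 2).
  by apply: rint_sum => i; have [] := u2 i.
have suw : rint nu (fun m => \sum_i u m i 0 * w m i 0).
  by apply: rint_sum => i; exact: sqint_mul.
have E m : l2norm (f m - Phi *m Phi^T *m g m) ^+ 2 =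
    \sum_i w m i 0 ^+ 2 + (2 * (\sum_i u m i 0 * w m i 0) + \sum_i u m i 0 ^+ 2).
  rewrite l2norm_sqr mulr_sumr -!big_split/=; apply: eq_bigr => i _.
  have -> : (f m - Phi *m Phi^T *m g m) i 0 = w m i 0 + u m i 0.
    by rewrite /w /u !mxE; ring.
  by ring.
under eq_integral do rewrite E.
rewrite -(EFin_Rintegral (rintD sw (rintD (rintZ 2 suw) su))).
rewrite -(EFin_Rintegral si) -EFinD; congr _%:E.
rewrite (RintegralD measurableT sw (rintD (rintZ 2 suw) su)); congr (_ + _).
  by apply: eq_Rintegral => m _; apply: eq_bigr => i _; rewrite !mxE.
rewrite (RintegralD measurableT (rintZ 2 suw) su) (RintegralZl _ measurableT suw).
rewrite moment_tr_sub// Rintegral_sum => [|i]; last exact: sqint_mul.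
rewrite big1 ?mulr0 ?add0r// => i _.
have := cross (fun j => (1%:M - Phi *m Phi^T) i j) (fun j => (i == j)%:R).
move=> <-; apply: eq_Rintegral => m _; rewrite uE; congr (_ * _).
rewrite (bigD1 i)//= eqxx mul1r big1 ?addr0// => j ji.
by rewrite eq_sym (negbTE ji) mul0r.
Qed.

End orthogonal.
End random_vectors.

(** * The second moments of the gradient *)

Section gradient_moment.
Context (R : realType) (d p : nat) (nu : probability (Borel 'cV[R]_d) R).
Variable q : 'cV[R]_d -> 'cV[R]_p.
Hypothesis dq_int : forall i j,
  nu.-integrable setT (fun m => (((jac q m)^T *m jac q m) i j)%:E).

Let H := expect_mx nu (fun m => (jac q m)^T *m jac q m).

Lemma gradient_moment_quad (x : 'cV[R]_d) :
  (\int[nu]_m (\sum_i (jac q m *m x) i 0 ^+ 2)%:E = ((x^T *m H *m x) 0 0)%:E)%E.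
Proof.
have E m : \sum_i (jac q m *m x) i 0 ^+ 2 =
    \sum_i \sum_j x i 0 * x j 0 * ((jac q m)^T *m jac q m) i j.
  transitivity (((jac q m *m x)^T *m (jac q m *m x)) 0 0).
    by rewrite mxE; apply: eq_bigr => i _; rewrite [_^T _ _]mxE.
  rewrite trmx_mul mulmxA -(mulmxA x^T) trmx_quadE.
  by apply: eq_bigr => i _; apply: eq_bigr => j _; ring.
have ti i j : rint nu (fun m => x i 0 * x j 0 * ((jac q m)^T *m jac q m) i j).
  by apply: rintZ; exact: dq_int.
under eq_integral do rewrite E.
rewrite -EFin_Rintegral; last by apply: rint_sum => i; exact: rint_sum.
congr _%:E; rewrite Rintegral_sum => [|i]; last exact: rint_sum.
rewrite trmx_quadE; apply: eq_bigr => i _.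
rewrite Rintegral_sum//; apply: eq_bigr => j _.
rewrite (RintegralZl _ measurableT (dq_int i j)) [H _ _]mxE.
by rewrite mulrC mulrA.
Qed.

Lemma gradient_moment_sym : H^T = H.
Proof.
apply/matrixP => i j; rewrite !mxE; apply: eq_Rintegral => m _.
by rewrite !mxE; apply: eq_bigr => k _; rewrite !mxE mulrC.
Qed.

Lemma lipschitz_gradient_moment (L : R) (x : 'cV[R]_d) :
  (forall m, differentiable q m) -> l2lipschitz L q -> 0 <= L ->
  (x^T *m H *m x) 0 0 <= L ^+ 2 * \sum_i x i 0 ^+ 2.
Proof.
move=> q_diff qL L0; rewrite -lee_fin -gradient_moment_quad.
rewrite -(Rintegral_cst1 nu (L ^+ 2 * _)) (EFin_Rintegral (rint_cst nu _)).
apply: ge0_le_integral => //.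
- by move=> m _; rewrite lee_fin sumr_ge0// => i _; exact: sqr_ge0.
- apply/measurable_EFinP; apply: measurable_sum => i; apply: measurable_funX.
  exact: measurable_jac.
- by move=> m _; rewrite lee_fin; exact: lipschitz_jac.
Qed.

End gradient_moment.

(** * Square integrability and orthogonality of the conditional expectation, entry by entry *)

Section conditional_expectation.
Context (R : realType) (d p : nat) (nu : probability (Borel 'cV[R]_d) R).
Variables (P : 'M[R]_d) (q qr : 'cV[R]_d -> 'cV[R]_p).
Hypotheses (q2 : sqint_vec nu q) (qr_def : cond_expectation nu (proj_sigma P) q qr).

Lemma cond_expectation_coord i :
  sub_measurable (proj_sigma P) (fun m : Borel 'cV[R]_d => qr m i 0).
Proof.
case: qr_def => mqr _ _ B mB.
apply: (mqr [set x : Borel 'cV[R]_p | B (x i 0)]).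
by rewrite -[X in measurable X]setTI; exact: measurable_coord.
Qed.

Lemma cond_expectation_sqint : sqint_vec nu qr.
Proof.
case: (qr_def) => _ iqr eqr i.
exact: (cond_sqint (proj_sigma_algebra P) (@proj_sigma_measurable _ _ P)
  (q2 i) (iqr i) (@cond_expectation_coord i) (fun A GA => eqr A GA i)).
Qed.

(** Square integrability of [qr] makes the product integrable, so that the possibly unbounded entry
    [qr m j 0] is an admissible test function. *)
Lemma cond_expectation_orth i j :
  \int[nu]_m (qr m j 0 * (q m i 0 - qr m i 0)) = 0.
Proof.
case: (qr_def) => _ iqr eqr; have qr2 := cond_expectation_sqint.
apply: (Rintegral_mul_sub_measurable (proj_sigma_algebra P)
  (@proj_sigma_measurable _ _ P) (h := fun m => qr m j 0)
  (a := fun m => q m i 0 - qr m i 0)).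
- exact: rintB (sqint_rint (q2 i)) (iqr i).
- apply: cond_sub_integral (@proj_sigma_measurable _ _ P) (sqint_rint (q2 i)) (iqr i) _.
  by move=> A GA; exact: eqr.
- exact: cond_expectation_coord.
- exact: (sqint_mul (qr2 j) (sqintB (q2 i) (qr2 i))).
Qed.

End conditional_expectation.

Theorem proposition2p2 (R : realType) (dM dQ rM rQ : nat)
  (rM_gt0 : (1 <= rM)%N) (rM_le : (rM <= dM)%N)
  (rQ_gt0 : (1 <= rQ)%N) (rQ_le : (rQ <= dQ)%N)
  (m0 : 'cV[R]_dM) (C : 'M[R]_dM) (C_spd : spd C)
  (nu : probability (Borel 'cV[R]_dM) R) (nu_gaussian : gaussian nu m0 C)
  (q : 'cV[R]_dM -> 'cV[R]_dQ)
  (q_diff : forall m, differentiable q m)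
  (q_L2 : (\int[nu]_m (l2norm (q m) ^+ 2)%:E < +oo)%E)
  (dq_int : forall i j,
     nu.-integrable setT (fun m => (((jac q m)^T *m jac q m) i j)%:E))
  (lamM : 'I_dM -> R) (v : 'I_dM -> 'cV[R]_dM)
  (lamM_v : gen_eigenpairs (expect_mx nu (fun m => (jac q m)^T *m jac q m))
              C lamM v)
  (lamM_ge0 : forall i, 0 <= lamM i)
  (V : 'M[R]_(dM, rM)) (V_def : V = first_cols rM_le v)
  (P : 'M[R]_dM) (P_def : P = V *m V^T *m invmx C)
  (qr : 'cV[R]_dM -> 'cV[R]_dQ)
  (qr_def : cond_expectation nu
              (sigma_of (fun m : 'cV[R]_dM => P *m m : Borel 'cV[R]_dM)) q qr)
  (Phi : 'M[R]_(dQ, rQ))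
  (Phi_def : top_eigenvectors rQ_le
               (expect_mx nu (fun m => qr m *m (qr m)^T)) Phi)
  (lamQ : 'I_dQ -> R)
  (lamQ_def : eigenvalues (expect_mx nu (fun m => q m *m (q m)^T)) lamQ)
  (lamQ_ge0 : forall i, 0 <= lamQ i) :
  (\int[nu]_m (l2norm (q m - Phi *m Phi^T *m qr m) ^+ 2)%:E <=
    (\sum_(i < dM | (rM <= i)%N) lamM i +
     \sum_(i < dQ | (rQ <= i)%N) lamQ i)%:E)%E
  /\
  forall (L : R) (c : 'I_dM -> R),
    0 <= L -> l2lipschitz L q -> eigenvalues C c ->
    (\int[nu]_m (l2norm (q m - Phi *m Phi^T *m qr m) ^+ 2)%:E <=
      (L ^+ 2 * \sum_(i < dM | (rM <= i)%N) c i +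
       \sum_(i < dQ | (rQ <= i)%N) lamQ i)%:E)%E.
Proof.
have Cu := spd_unitmx C_spd.
pose S := [seq i : 'I_dM <- index_enum 'I_dM | (rM <= i)%N].
pose a i := invmx C *m v i.
have Cav i : C *m a i = v i by rewrite /a mulKVmx.
have av i j : (a i)^T *m v j = (i == j)%:R%:M by exact: gen_eigen_dual C_spd lamM_v i j.
have qr_proj : cond_expectation nu (proj_sigma (1%:M - proj_seq v a S)) q qr.
  by rewrite -(gen_eigen_proj C_spd lamM_v rM_le) -V_def -P_def.
have q2 : sqint_vec nu q.
  move=> i; apply: ge0_sqint; first exact: measurable_coord_diff.
  apply: le_lt_trans q_L2; apply: ge0_le_integral => //.
  - by move=> m _; rewrite lee_fin sqr_ge0.
  - by apply/measurable_EFinP; apply: measurable_funX; exact: measurable_coord_diff.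
  - apply/measurable_EFinP; under eq_fun do rewrite l2norm_sqr.
    by apply: measurable_sum => k; apply: measurable_funX; exact: measurable_coord_diff.
  - move=> m _; rewrite lee_fin l2norm_sqr (bigD1 i)//= lerDl sumr_ge0// => k _.
    exact: sqr_ge0.
have qr2 := cond_expectation_sqint q2 qr_proj.
have orth := cond_expectation_orth q2 qr_proj.
have [PP [lamK [s [lamK_def KP]]]] := Phi_def.
have [_ Kc] := lamK_def; have [_ Qc] := lamQ_def.
have pod := pod_residual (moment_sym nu qr) Kc PP KP.
have lamK_le : \sum_(i < dQ | (rQ <= i)%N) lamK i <= \sum_(i < dQ | (rQ <= i)%N) lamQ i.
  rewrite -[leRHS]mul1r.
  apply: (tail_eigenvalues_le rQ (moment_sym nu qr) (moment_sym nu q) lamK_def.1 Kc Qc).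
  by move=> x; rewrite mul1r; exact: moment_quad_le.
have ridge : (\int[nu]_m (\sum_i (q m i 0 - qr m i 0) ^+ 2)%:E <=
    (\sum_(i < dM | (rM <= i)%N) lamM i)%:E)%E.
  under eq_integral do rewrite -sumEFin.
  rewrite ge0_integral_sum//; last 2 first.
  - move=> i; apply/measurable_EFinP; apply: measurable_funX.
    by have [] := sqintB (q2 i) (qr2 i).
  - by move=> i m _; rewrite lee_fin sqr_ge0.
  (* The scalar inequality is used once for each entry i of q, with [D j] the derivative of that
     entry along [v j]. *)
  apply: (@le_trans _ _ (\sum_i \sum_(j <- S) \int[nu]_m ((jac q m *m v j) i 0 ^+ 2)%:E)%E).
    apply: lee_sum => i _.
    case: (qr_proj) => _ iqr eqr.
    apply: (subspace_poincare (m0 := m0) (C := C) (v := v) (a := a) nu_gaussian C_spd Cav av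
      (D := fun j m => (jac q m *m v j) i 0)).
    - by rewrite filter_uniq// index_enum_uniq.
    - exact: q2.
    - exact: iqr.
    - exact: cond_expectation_coord qr_proj i.
    - by move=> A GA; exact: eqr.
    - by move=> j; exact: measurable_jac.
    - by move=> j m t; exact: is_derive_jac.
  rewrite exchange_big/= /S big_filter -sumEFin; apply: lee_sum => j _.
  rewrite -ge0_integral_sum//; last 2 first.
  - by move=> i; apply/measurable_EFinP; apply: measurable_funX; exact: measurable_jac.
  - by move=> i m _; rewrite lee_fin sqr_ge0.
  under eq_integral do rewrite sumEFin.
  rewrite (gradient_moment_quad dq_int) lee_fin.
  have [_ Hv vv] := lamM_v.
  rewrite -mulmxA Hv -scalemxAr mulmxA mxE vv eqxx mulr1.
  exact: lexx.
have bound : (\int[nu]_m (l2norm (q m - Phi *m Phi^T *m qr m) ^+ 2)%:E <=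
    (\sum_(i < dM | (rM <= i)%N) lamM i + \sum_(i < dQ | (rQ <= i)%N) lamQ i)%:E)%E.
  rewrite (pod_pythagoras q2 qr2 orth PP) pod EFinD.
  by apply: leeD => //; rewrite lee_fin.
split=> [//|L c L0 qL Cc]; apply: le_trans bound _; rewrite lee_fin lerD2r.
apply: (gen_eigen_tail_le C_spd lamM_v rM (gradient_moment_sym nu q) Cc).
by move=> x; exact: lipschitz_gradient_moment.
Qed.
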